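(* The dual value function $$J(y)=J_A(y)+\sup_{\tau\in\mathcal S}\mathbb E\left[\int_0^\tau e^{-\rho t}\big(\tilde u_B(\mathcal Y_t^y)-\tilde u_A(\mathcal Y_t^y)+\mathcal Y_t^y\epsilon\big)dt\right],\qquad J_A(y)=\mathbb E\left[\int_0^\infty e^{-\rho t}\tilde u_A(\mathcal Y_t^y)\,dt\right],\quad y>0,$$ is given by $$J(y)=\begin{cases}Dy^{n_2}+\Xi_{\tilde u_B}(y)+\dfrac{\epsilon}{r}y, & y\ge z_R,\\[2mm] \Xi_{\tilde u_A}(y), & 0<y\le z_R.\end{cases}$$
   Context: Constants: $r>0$, $\rho>0$, $\mu>0$, $\sigma>0$, $\epsilon>0$, with $\mu\ne r$; $\theta=\frac{\mu-r}{\sigma}$. $B$ is a standard Brownian motion, $\mathcal F$ its augmented filtration, $\xi_t=e^{-rt-\frac12\theta^2t-\theta B_t}$, and $\mathcal Y^y_t=ye^{\rho t}\xi_t$ for $y>0$. $\mathcal S$ is the set of all $\mathcal F$-stopping times with values in $[0,\infty]$. $n_1>0$ and $n_2<0$ are the roots of $\frac{\theta^2}{2}n^2+(\rho-r-\frac{\theta^2}{2})n-\rho=0$. Class $\Sigma$: let $\mathcal D=[0,\infty)$ or $(0,\infty)$. $\Sigma$ is the set of functions $u:\mathcal D\to\mathbb R$ such that (i) $u$ is strictly increasing, strictly concave, continuously differentiable, with $\lim_{c\to\infty}u'(c)=0$; $I_u:(0,u'(0))\to(0,\infty)$ denotes the inverse of $u'$ (where $u'(0)=\lim_{c\downarrow0}u'(c)\in(0,\infty]$),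 extended by $I_u(y)=0$ for $y\ge u'(0)$; (ii) $\int_0^y\eta^{-n_2}I_u(\eta)\,d\eta<\infty$ for every $y>0$. By convention $u(0)=\lim_{c\downarrow0}u(c)$. The conjugate of $u$ is $\tilde u(y)=\sup_{c\ge0}(u(c)-yc)=u(I_u(y))-yI_u(y)$, $y>0$. Standing assumptions: $u_B,u_A\in\Sigma$ and $u_B(I_{u_B}(y))<u_A(I_{u_A}(y))$ for all $y>0$; and $\lim_{y\to0+}\Psi(y)<0$, where $\Psi(y)=\frac1y(\tilde u_B(y)-\tilde u_A(y))+\epsilon$. Under these assumptions $\Psi$ is strictly increasing with $\lim_{y\to\infty}\Psi(y)=\epsilon$, and $\bar z>0$ denotes its unique zero. Put $h(y)=y\Psi(y)$. $z_R\in(0,\bar z)$ is the unique solution of $\int_{z_R}^\infty\nu^{-n_1-1}h(\nu)\,d\nu=0$, and $D=-\frac{2}{\theta^2(n_1-n_2)}\int_0^{z_R}\nu^{-n_2-1}h(\nu)\,d\nu$. For a function $f$ on $(0,\infty)$ for which the integrals converge, $$\Xi_f(y)=\frac{2}{\theta^2(n_1-n_2)}\left[y^{n_2}\int_0^y\nu^{-n_2-1}f(\nu)\,d\nu+y^{n_1}\int_y^\infty\nu^{-n_1-1}f(\nu)\,d\nu\right].$$ *)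

(* Defs.v *)
From HB Require Import structures.
From mathcomp Require Import all_boot all_order all_algebra.
From mathcomp Require Import all_classical all_reals all_analysis.

Set Implicit Arguments.
Unset Strict Implicit.
Unset Printing Implicit Defensive.

Import Order.TTheory GRing.Theory Num.Theory.
Import numFieldNormedType.Exports.

Local Open Scope classical_set_scope.
Local Open Scope ring_scope.

(* A process is a map [R -> T -> R] from times to random variables; only the
   times t >= 0 are meaningful. *)

Definition natural_filtration (R : realType) (d : measure_display)
    (T : measurableType d) (B : R -> T -> R) (t : R) : set (set T) :=
  <<s [set E | exists s : R, exists2 V : set R,
         0 <= s <= t /\ measurable V & E = B s @^-1` V] >>.

(* Augmentation by the P-null events of the ambient sigma-algebra. When the
   probability space is complete these are all the P-negligible sets. *)
Definition augmented_filtration (R : realType) (d : measure_display)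
    (T : measurableType d) (P : probability T R) (B : R -> T -> R) (t : R) :
    set (set T) :=
  <<s natural_filtration B t `|`
      [set N : set T | measurable N /\ P N = 0%E] >>.

Record is_standard_brownian_motion (R : realType) (d : measure_display)
    (T : measurableType d) (P : probability T R) (B : R -> T -> R) : Prop := {
  bm_measurable : forall t : R, 0 <= t -> measurable_fun [set: T] (B t);
  bm_start : {ae P, forall w, B 0 w = 0};
  bm_continuous : forall w, {within `[0, +oo[, continuous (fun t => B t w)};
  (* B_t - B_s ~ N(0, t - s); [normal_prob] takes the standard deviation. *)
  bm_gaussian : forall s t : R, 0 <= s -> s < t -> forall V : set R, measurable V ->
    P ((B t \- B s) @^-1` V) = normal_prob 0 (Num.sqrt (t - s)) V;
  bm_independent : forall s t : R, 0 <= s -> s < t -> forall (E : set T) (V : set R),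
    natural_filtration B s E -> measurable V ->
    P (E `&` (B t \- B s)%R @^-1` V) = (P E * P ((B t \- B s)%R @^-1` V))%E
}.

Definition is_stopping_time (R : realType) (T : Type)
    (F : R -> set (set T)) (tau : T -> \bar R) : Prop :=
  (forall w, (0 <= tau w)%E) /\
  (forall t : R, 0 <= t -> F t [set w | (tau w <= t%:E)%E]).

Definition theta (R : realType) (mu r sigma : R) : R := (mu - r) / sigma.

Definition state_price (R : realType) (T : Type) (r th : R) (B : R -> T -> R)
    (t : R) (w : T) : R :=
  expR (- r * t - th ^+ 2 / 2 * t - th * B t w).

Definition dual_process (R : realType) (T : Type) (r rho th : R)
    (B : R -> T -> R) (y t : R) (w : T) : R :=
  y * expR (rho * t) * state_price r th B t w.

Definition char_poly_n (R : realType) (r rho th n : R) : R :=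
  th ^+ 2 / 2 * n ^+ 2 + (rho - r - th ^+ 2 / 2) * n - rho.

(* u(c) for c >= 0, with u(0) read as the limit of u at 0+, possibly -oo. *)
Definition util_val (R : realType) (u : R -> R) (c : R) : \bar R :=
  if c == 0 then lim ((u x)%:E @[x --> 0^'+]) else (u c)%:E.

(* u'(0) = lim_(c -> 0+) u'(c), possibly +oo *)
Definition marginal0 (R : realType) (u : R -> R) : \bar R :=
  lim ((u^`()%classic c)%:E @[c --> 0^'+]).

Definition inv_marginal (R : realType) (u : R -> R) (y : R) : R :=
  if (y%:E < marginal0 u)%E
  then get [set c | 0 < c /\ u^`()%classic c = y] else 0.

Definition conjugate (R : realType) (u : R -> R) (y : R) : R :=
  fine (ereal_sup [set (util_val u c - (y * c)%:E)%E | c in `[0, +oo[]).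

(* The class Sigma, for functions with domain D: the values of u outside D
   play no role. u' may blow up at 0 even if 0 is in D. *)
Record class_Sigma (R : realType) (n2 : R) (D : set R) (u : R -> R) : Prop := {
  Sigma_dom : D = `[0, +oo[%classic \/ D = `]0, +oo[%classic;
  Sigma_incr : forall x y : R, D x -> D y -> x < y -> u x < u y;
  Sigma_concave : forall x y t : R, D x -> D y -> x != y -> 0 < t < 1 ->
    t * u x + (1 - t) * u y < u (t * x + (1 - t) * y);
  Sigma_derivable : forall c : R, 0 < c -> derivable u c 1;
  Sigma_C1 : {in `]0, +oo[, continuous (u^`()%classic)};
  Sigma_zero : D 0 -> u c @[c --> 0^'+] --> u 0;
  Sigma_marginal_pinfty : u^`()%classic c @[c --> +oo] --> (0 : R);
  Sigma_integrable : forall y : R, 0 < y ->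
    (\int[lebesgue_measure]_(eta in `]0%R, y[)
        (eta `^ (- n2) * inv_marginal u eta)%:E < +oo)%E
}.

Definition Psi (R : realType) (uB uA : R -> R) (eps y : R) : R :=
  y^-1 * (conjugate uB y - conjugate uA y) + eps.

Definition h (R : realType) (uB uA : R -> R) (eps y : R) : R :=
  y * Psi uB uA eps y.

Definition coef_D (R : realType) (th n1 n2 : R) (uB uA : R -> R)
    (eps zR : R) : R :=
  - (2 / (th ^+ 2 * (n1 - n2))) *
  \int[lebesgue_measure]_(nu in `]0, zR[)
     (nu `^ (- n2 - 1) * h uB uA eps nu).

Definition Xi (R : realType) (th n1 n2 : R) (f : R -> R) (y : R) : R :=
  2 / (th ^+ 2 * (n1 - n2)) *
  (y `^ n2 * \int[lebesgue_measure]_(nu in `]0, y[) (nu `^ (- n2 - 1) * f nu) +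
   y `^ n1 * \int[lebesgue_measure]_(nu in `]y, +oo[) (nu `^ (- n1 - 1) * f nu)).

Definition J_A (R : realType) (d : measure_display) (T : measurableType d)
    (P : probability T R) (B : R -> T -> R) (r rho th : R) (uA : R -> R)
    (y : R) : \bar R :=
  (\int[P]_w \int[lebesgue_measure]_(t in `[0%R, +oo[)
     (expR (- rho * t) * conjugate uA (dual_process r rho th B y t w))%:E)%E.

Definition stopping_payoff (R : realType) (d : measure_display)
    (T : measurableType d) (P : probability T R) (B : R -> T -> R)
    (r rho th eps : R) (uB uA : R -> R) (y : R) (tau : T -> \bar R) : \bar R :=
  (\int[P]_w \int[lebesgue_measure]_(t in [set t : R | 0 <= t%:E <= tau w])
     (let Y := dual_process r rho th B y t w in
      expR (- rho * t) * (conjugate uB Y - conjugate uA Y + Y * eps))%:E)%E.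

Definition dual_value (R : realType) (d : measure_display)
    (T : measurableType d) (P : probability T R) (B : R -> T -> R)
    (r rho th eps : R) (uB uA : R -> R) (y : R) : \bar R :=
  (J_A P B r rho th uA y +
   ereal_sup [set stopping_payoff P B r rho th eps uB uA y tau |
     tau in [set tau | is_stopping_time (augmented_filtration P B) tau]])%E.

(* Main.v *)
(* Write U f (z) = \int f(nu) G(z, nu) dnu over nu > 0, where the Green kernel G
   is the Laplace transform in time of the lognormal density of the dual
   process Y; U f is the Xi_f of the statement, and the independence of
   increments gives, at a deterministic time s,
     E[\int_s^oo e^(-rho t) f(Y_t) dt | F_s] = e^(-rho s) U f (Y_s).
   Put g = h on [zR, oo) and 0 below, and W = U g. The equation defining zR says
   that W = 0 on (0, zR], and the single sign change of h, at zbar > zR, gives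
   W >= 0 everywhere and h <= g. Hence for every stopping time tau
     E[\int_0^tau e^(-rho t) h(Y_t) dt] <= E[\int_0^tau e^(-rho t) g(Y_t) dt]
       = W(y) - E[e^(-rho tau) W(Y_tau)] <= W(y).
   The event {t > tau} is approximated from inside by grid times k / 2^n, so the
   identity above is only needed at deterministic times and neither the strong
   Markov property nor Ito's formula enters. For the first grid time at which
   Y <= zR the second inequality is an equality, and by continuity of the paths
   the loss in the first one vanishes as n grows. *)

(* The integrand h is unbounded and takes both signs. Exchanges of integrals are therefore made for
   nonnegative functions and carried over to h by its integrability against the Green kernel: near 0
   this rests on condition (ii) of the class Sigma, near infinity on the linear growth of the
   conjugates together with n1 > 1. Stopping is expressed on the product of the probability space
   with the time axis: the payoff of tau is the integral of one fixed integrable function over the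
   set t <= tau. Approximating tau becomes approximating this set by a monotone sequence of sets,
   and no limit of stopped random variables is taken. The candidate W is a kernel integral and not
   the solution of a free boundary problem, so no smoothness at zR has to be established. The roots
   n1 and n2 enter through their sum, their product and (1 - n1)(1 - n2), which the characteristic
   polynomial ties to the drift, to rho and to r. *)
Require Import Defs.
From HB Require Import structures.
From mathcomp Require Import all_boot all_order all_algebra.
From mathcomp Require Import all_classical all_reals all_analysis.
From mathcomp Require Import measurable_realfun ring lra.

Set Implicit Arguments.
Unset Strict Implicit.
Unset Printing Implicit Defensive.

Import Order.TTheory GRing.Theory Num.Theory.
Import numFieldNormedType.Exports.

Local Open Scope classical_set_scope.
Local Open Scope ring_scope.

(** * Gaussian and lognormal integrals *)

Section gauss_primitive.
Context {R : realType}.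
Notation mu := (@lebesgue_measure R).

Definition gauss_primitive (x : R) : R :=
  \int[mu]_(t in `]-oo, x]) gauss_fun t.

Lemma is_derive_gauss_primitive (x : R) :
  is_derive x 1 gauss_primitive (gauss_fun x).
Proof.
have xx1 : x < x + 1 by rewrite ltrDl.
have [] := @continuous_FTC1 R gauss_fun -oo%O x (x + 1) xx1.
- by apply: (integrableS _ _ (@subsetT _ _)) => //; exact: integrableT_gauss.
- exact: ltNyr.
- exact: continuous_gauss_fun.
move=> dG GE.
by apply: DeriveDef; [exact: dG|rewrite -derive1E; exact: GE].
Qed.

Let integrable_gauss (D : set R) : measurable D -> mu.-integrable D (EFin \o gauss_fun).
Proof.
by move=> mD; apply: (integrableS _ _ (@subsetT _ _)) => //; exact: integrableT_gauss.
Qed.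

Lemma gauss_primitiveE (x : R) : 0 <= x ->
  gauss_primitive x = Num.sqrt pi / 2 + gauss_integral_proof.integral0_gauss x.
Proof.
move=> x0; rewrite /gauss_primitive.
have /= := @Rintegral_itvB R gauss_fun -oo%O (BRight x) 0.
move=> /(_ (integrable_gauss (measurable_itv _)) isT).
rewrite bnd_simp => /(_ x0) => H.
rewrite -[LHS](subrK (\int[mu]_(t in `]-oo, 0]) gauss_fun t)) H addrC; congr (_ + _).
  rewrite /Rintegral.
  rewrite (_ : integral _ _ _ = (Num.sqrt pi / 2)%:E)//.
  rewrite -integral0y_gauss.
  rewrite ge0_integration_by_substitution0//.
  - by apply: eq_integral => y _; rewrite /gauss_fun sqrrN.
  - by apply/measurable_EFinP; exact: measurable_gauss_fun.
  - by move=> y; rewrite lee_fin gauss_fun_ge0.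
by rewrite Rintegral_itv_obnd_cbnd//; exact: integrable_gauss.
Qed.

(** The integrand is even, so G(y) + G(-y) has derivative 0 and keeps its value at 0, which is sqrt
    pi. This yields the limit at -oo from the one at +oo. *)
Lemma gauss_primitiveN (x : R) : gauss_primitive (- x) = Num.sqrt pi - gauss_primitive x.
Proof.
pose S := fun y : R => gauss_primitive y + gauss_primitive (- y).
have dS (y : R) : is_derive y 1 S 0.
  have d2 := is_derive1_comp (is_derive_gauss_primitive (- y)) (is_deriveNid y 1).
  apply: is_derive_eq (is_deriveD (is_derive_gauss_primitive y) d2) _.
  by rewrite /gauss_fun sqrrN mulrN mulr1 subrr.
have SE : S x = S 0 by exact: is_derive_0_is_cst.
have : S 0 = Num.sqrt pi.
  rewrite /S oppr0 gauss_primitiveE// /gauss_integral_proof.integral0_gauss.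
  by rewrite set_itv1 Rintegral_set1 addr0 -splitr.
by rewrite -SE /S => <-; rewrite addrAC subrr add0r.
Qed.

Lemma cvg_gauss_primitivey : gauss_primitive x @[x --> +oo] --> (Num.sqrt pi : R).
Proof.
have cvg_I : @gauss_integral_proof.integral0_gauss R x @[x --> +oo] --> Num.sqrt pi / 2.
  have : Num.sqrt (@gauss_integral_proof.integral0_gauss R x ^+ 2) @[x --> +oo]
      --> Num.sqrt (pi / 4).
    apply: continuous_cvg => //; first exact: sqrt_continuous.
    exact: gauss_integral_proof.cvg_integral0_gauss_sqr.
  rewrite sqrtrM ?pi_ge0// sqrtrV// (_ : 4 = 2 ^+ 2); last first.
    by rewrite expr2 -natrM.
  rewrite sqrtr_sqr ger0_norm//.
  rewrite (_ : (fun _ => Num.sqrt _) = @gauss_integral_proof.integral0_gauss R)//.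
  apply/funext => y; rewrite sqrtr_sqr// ger0_norm//.
  exact: gauss_integral_proof.integral0_gauss_ge0.
rewrite [X in _ --> X]splitr.
have : (Num.sqrt pi / 2 + gauss_integral_proof.integral0_gauss x) @[x --> +oo] -->
    (Num.sqrt pi / 2 + Num.sqrt pi / 2 : R).
  by apply: cvgD => //; exact: cvg_cst.
apply: cvg_trans; apply: near_eq_cvg; near=> y.
rewrite gauss_primitiveE//; near: y; exact: nbhs_pinfty_ge.
Unshelve. all: by end_near. Qed.

Lemma cvg_gauss_primitiveNy : gauss_primitive x @[x --> -oo] --> (0 : R).
Proof.
apply/cvgNy_compNP.
have -> : gauss_primitive \o -%R = fun x : R => Num.sqrt pi - gauss_primitive x.
  by apply/funext => x; rewrite /= gauss_primitiveN.
suff : (Num.sqrt pi - gauss_primitive x) @[x --> +oo] --> (Num.sqrt pi - Num.sqrt pi : R).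
  by rewrite subrr.
by apply: cvgB; [exact: cvg_cst|exact: cvg_gauss_primitivey].
Qed.

End gauss_primitive.

(** * Laplace transform of exp(-q^2 / t) / sqrt t *)

Section laplace.
Context {R : realType}.
Notation mu := (@lebesgue_measure R).
Local Notation G := (@gauss_primitive R).
Variables (p q : R).
Hypotheses (p0 : 0 < p) (q0 : 0 < q).

Let f (t : R) : R := (Num.sqrt t)^-1 * expR (- p ^+ 2 * t - q ^+ 2 / t).
Let A (t : R) : R := p^-1 *
  (expR (2 * p * q) * G (p * Num.sqrt t + q / Num.sqrt t) +
   expR (- (2 * p * q)) * G (p * Num.sqrt t - q / Num.sqrt t)).

(** The squares of p sqrt t + q / sqrt t and p sqrt t - q / sqrt t differ from p^2 t + q^2 / t by
    2pq and -2pq, which the prefactors of [A] compensate. Both terms then carry the same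
    exponential, and the parts in q of the inner derivatives cancel. *)
Lemma is_derive_laplace_primitive (t : R) : 0 < t -> is_derive t 1 A (f t).
Proof.
move=> t0.
have s0 : 0 < Num.sqrt t by rewrite sqrtr_gt0.
have sn0 := lt0r_neq0 s0.
have ds := is_derive1_sqrt t0.
have dV : is_derive t 1 (fun t => (Num.sqrt t)^-1) _ := is_deriveV sn0 ds.
have d1 : is_derive t 1 (fun t => p * Num.sqrt t + q / Num.sqrt t) _ :=
  is_deriveD (is_deriveZ p ds) (is_deriveZ q dV).
have d2 : is_derive t 1 (fun t => p * Num.sqrt t - q / Num.sqrt t) _ :=
  is_deriveB (is_deriveZ p ds) (is_deriveZ q dV).
have dG1 := is_derive1_comp (is_derive_gauss_primitive _) d1.
have dG2 := is_derive1_comp (is_derive_gauss_primitive _) d2.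
have dA : is_derive t 1 A _ :=
  is_deriveZ p^-1 (is_deriveD (is_deriveZ (expR (2 * p * q)) dG1) (is_deriveZ (expR (- (2 * p * q))) dG2)).
apply: is_derive_eq dA _.
rewrite /gauss_fun /GRing.scale /=.
have E1 : expR (2 * p * q) * expR (- (p * Num.sqrt t + q / Num.sqrt t) ^+ 2) =
    expR (- p ^+ 2 * t - q ^+ 2 / t).
  rewrite -expRD; congr expR.
  rewrite -{3 4}[t](sqr_sqrtr (ltW t0)).
  by field.
have E2 : expR (- (2 * p * q)) * expR (- (p * Num.sqrt t - q / Num.sqrt t) ^+ 2) =
    expR (- p ^+ 2 * t - q ^+ 2 / t).
  rewrite -expRD; congr expR.
  rewrite -{3 4}[t](sqr_sqrtr (ltW t0)).
  by field.
rewrite /f !mulrA E1 E2.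
by field; rewrite !gt_eqF// sqrtr_gt0.
Qed.

(** The value at 0 is 0 because [0^-1 = 0]. Since exp(-q^2 / t) <= t / q^2, the function is at most
    sqrt t / q^2 and tends to 0, so it is continuous up to the end point as the fundamental theorem
    of calculus requires. *)
Lemma continuous_laplace_integrand : {within `[0, +oo[, continuous f}.
Proof.
apply/continuous_within_itvcyP; split.
  move=> t; rewrite in_itv/= andbT => t0.
  have sn0 : Num.sqrt t != 0 by rewrite gt_eqF// sqrtr_gt0.
  apply: cvgM.
    by apply: cvgV => //; exact: sqrt_continuous.
  apply: (cvg_comp _ expR); last exact: continuous_expR.
  apply: cvgB; first by apply: cvgM; [exact: cvg_cst|exact: cvg_id].
  by apply: cvgM; [exact: cvg_cst|apply: cvgV; [rewrite gt_eqF|exact: cvg_id]].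
rewrite {2}/f sqrtr0 invr0 mul0r.
apply: (@squeeze_cvgr _ _ _ _ (fun=> 0) (fun t => Num.sqrt t / q ^+ 2)).
- near=> t.
  have t0 : 0 < t by near: t; exact: nbhs_right_gt.
  have s0 : 0 < Num.sqrt t by rewrite sqrtr_gt0.
  have q20 : 0 < q ^+ 2 by rewrite exprn_gt0.
  apply/andP; split; first by rewrite mulr_ge0 ?invr_ge0 ?expR_ge0 // ltW.
  have -> : Num.sqrt t / q ^+ 2 = (Num.sqrt t)^-1 * (t / q ^+ 2).
    by rewrite -{3}[t](sqr_sqrtr (ltW t0)); field; rewrite !gt_eqF.
  rewrite ler_pM2l ?invr_gt0// -[leRHS]invrK invf_div.
  rewrite -[leLHS]invrK -expRN lef_pV2 ?posrE ?expR_gt0 ?divr_gt0//.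
  apply: le_trans (expR_ge1Dx _).
  have : 0 <= p ^+ 2 * t by rewrite mulr_ge0 ?sqr_ge0// ltW.
  by rewrite mulNr; set a := q ^+ 2 / t; lra.
- exact: cvg_cst.
- suff : Num.sqrt t / q ^+ 2 @[t --> (0 : R)^'+] --> Num.sqrt (0 : R) / q ^+ 2.
    by rewrite sqrtr0 mul0r.
  apply: cvgM; last exact: cvg_cst.
  apply: cvg_at_right_filter.
  exact: sqrt_continuous.
Unshelve. all: by end_near. Qed.

Let cvg_Ay : A t @[t --> +oo] --> p^-1 * ((expR (2 * p * q) + expR (- (2 * p * q))) * Num.sqrt pi).
Proof.
rewrite mulrDl.
have key (M : R) : \forall t \near +oo, M <= p * Num.sqrt t - q / Num.sqrt t.
  near=> t.
  have t1 : 1 <= t by near: t; exact: nbhs_pinfty_ge.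
  have s1 : 1 <= Num.sqrt t by rewrite -[leLHS](sqrtr1 R) ler_wsqrtr.
  have tM : (`|(M + q) / p|) ^+ 2 <= t by near: t; exact: nbhs_pinfty_ge.
  have sM : (M + q) / p <= Num.sqrt t.
    apply: le_trans (ler_norm _) _.
    by rewrite -(ger0_norm (normr_ge0 _)) -sqrtr_sqr ler_wsqrtr.
  rewrite lerBrDr; apply: (@le_trans _ _ (M + q)).
    rewrite lerD2l ler_pdivrMr ?(lt_le_trans _ s1)//.
    by rewrite ler_peMr// ltW.
  by rewrite mulrC -ler_pdivrMr.
apply: cvgM; first exact: cvg_cst.
apply: cvgD; (apply: cvgM; first exact: cvg_cst).
  apply: (cvg_comp _ G); last exact: cvg_gauss_primitivey.
  apply/cvgryPge => M; have := key M; apply: filterS => t /le_trans; apply.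
  by rewrite lerD2l ge0_cp// divr_ge0// ltW.
apply: (cvg_comp _ G); last exact: cvg_gauss_primitivey.
exact/cvgryPge.
Unshelve. all: by end_near. Qed.

Let cvg_A0 : A t @[t --> 0^'+] --> p^-1 * (expR (2 * p * q) * Num.sqrt pi).
Proof.
(* The margin p absorbs p sqrt t, which is at most p for t < 1, so that p sqrt t - q / sqrt t <= -
   M. *)
have key (M : R) : \forall t \near 0^'+, M + p <= q / Num.sqrt t /\ 0 < t < 1.
  near=> t.
  have t0 : 0 < t by near: t; exact: nbhs_right_gt.
  have s0 : 0 < Num.sqrt t by rewrite sqrtr_gt0.
  have t1 : t < 1 by near: t; exact: nbhs_right_lt.
  split; last by rewrite t0.
  have M0 : 0 < `|M + p| + 1 by rewrite ltr_wpDl.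
  have tM : t <= (q / (`|M + p| + 1)) ^+ 2.
    by near: t; apply: nbhs_right_le; rewrite exprn_gt0// divr_gt0.
  rewrite ler_pdivlMr//.
  have : Num.sqrt t <= q / (`|M + p| + 1).
    have /ltW/ger0_norm <- : 0 < q / (`|M + p| + 1) by rewrite divr_gt0.
    by rewrite -sqrtr_sqr ler_wsqrtr.
  rewrite ler_pdivlMr// mulrC => /(le_trans _); apply.
  by rewrite ler_pM2r// (le_trans (ler_norm _))// lerDl.
suff : A t @[t --> 0^'+] -->
    p^-1 * (expR (2 * p * q) * Num.sqrt pi + expR (- (2 * p * q)) * 0).
  by rewrite mulr0 addr0.
apply: cvgM; first exact: cvg_cst.
apply: cvgD; (apply: cvgM; first exact: cvg_cst).
  apply: (cvg_comp _ G); last exact: cvg_gauss_primitivey.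
  apply/cvgryPge => M; have := key M; apply: filterS => t [H /andP[t0 t1]].
  have : 0 <= p * Num.sqrt t by rewrite mulr_ge0// ltW.
  by move: p0 H; clear; move: (p * _) (q / _) => a b; lra.
apply: (cvg_comp _ G); last exact: cvg_gauss_primitiveNy.
apply/cvgrNyPle => M; have := key (- M); apply: filterS => t [H /andP[t0 t1]].
have : p * Num.sqrt t <= p.
  by rewrite ler_piMr ?(ltW p0)// -[leRHS](sqrtr1 R) ler_wsqrtr// ltW.
by move: p0 H; clear; move: (p * _) (q / _) => a b; lra.
Unshelve. all: by end_near. Qed.

Lemma laplace_gauss :
  (\int[mu]_(t in `]0%R, +oo[) (f t)%:E)%E =
  (Num.sqrt pi / p * expR (- (2 * p * q)))%:E.
Proof.
pose L0 := p^-1 * (expR (2 * p * q) * Num.sqrt pi).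
(* At 0 the function [A] is computed with [q / 0 = 0], which does not give its limit; [A0] puts the
   limit there. *)
pose A0 (t : R) := if t <= 0 then L0 else A t.
have AA0 (t : R) : 0 < t -> {near t, A0 =1 A}.
  move=> t0; near=> u; rewrite /A0 ifF//; apply/negbTE; rewrite -ltNge.
  by near: u; exact: lt_nbhsr.
have dA0 (t : R) : 0 < t -> is_derive t 1 A0 (f t).
  move=> t0; have := is_derive_laplace_primitive t0; apply: near_eq_is_derive => //.
  by apply: filterS (AA0 _ t0) => ? ->.
rewrite integral_itv_obnd_cbnd.
rewrite (@ge0_continuous_FTC2y _ f A0 0 (p^-1 * ((expR (2 * p * q) + expR (- (2 * p * q))) * Num.sqrt pi))).
- rewrite /A0 lexx /L0 -EFinB; congr EFin.
  by field; rewrite gt_eqF.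
- by move=> t t0; rewrite mulr_ge0 ?invr_ge0 ?expR_ge0.
- exact: continuous_laplace_integrand.
- apply: cvg_trans cvg_Ay; apply: near_eq_cvg; near=> t.
  by rewrite /A0 ifF//; apply/negbTE; rewrite -ltNge; near: t; exact: nbhs_pinfty_gt.
- by move=> t t0; have [] := dA0 _ t0.
- rewrite {2}/A0 lexx /L0.
  apply: cvg_trans cvg_A0; apply: near_eq_cvg; near=> t.
  by rewrite /A0 ifF//; apply/negbTE; rewrite -ltNge; near: t; exact: nbhs_right_gt.
- by move=> t; rewrite in_itv/= andbT => /dA0 []; rewrite derive1E.
- apply/measurable_EFinP; apply: open_continuous_measurable_fun.
    exact: interval_open.
  by have /continuous_within_itvcyP[/in_continuous_mksetP] := continuous_laplace_integrand.
Unshelve. all: by end_near. Qed.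

End laplace.

(** * Images of measures with density *)

Section image_density.
Local Open Scope ereal_scope.
Context d1 d2 (X : measurableType d1) (Y : measurableType d2) (R : realType).
Variables (mu : {measure set X -> \bar R}) (phi : X -> Y) (p : X -> R).
Hypotheses (mphi : measurable_fun [set: X] phi) (mp : measurable_fun [set: X] p)
  (p0 : forall x, (0 <= p x)%R).

Import HBNNSimple.

(** The usual passage from indicators to simple functions and monotone limits. Image and density are
    treated at once because the statement serves several purposes: a Gaussian density, the
    restriction of a measure (the density is then an indicator), the substitution by an exponential,
    and a joint law restricted to an event. *)
Lemma ge0_integral_image_density (nu : {measure set Y -> \bar R}) (f : Y -> \bar R) :
  (forall A, measurable A -> nu A = \int[mu]_x ((\1_A (phi x))%:E * (p x)%:E)) ->
  measurable_fun [set: Y] f -> (forall y, 0 <= f y) ->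
  \int[nu]_y f y = \int[mu]_x (f (phi x) * (p x)%:E).
Proof.
move=> nuE mf f0; pose f_ := nnsfun_approx measurableT mf.
have mfphi n : measurable_fun [set: X] (fun x => (f_ n (phi x))%:E * (p x)%:E).
  apply: emeasurable_funM; apply/measurable_EFinP => //.
  exact: measurableT_comp.
transitivity (limn (fun n => \int[nu]_y (f_ n y)%:E)).
  rewrite -monotone_convergence//=.
  - by apply: eq_integral => y _; apply/esym/cvg_lim => //; exact: cvg_nnsfun_approx.
  - by move=> n; apply: measurableT_comp.
  - by move=> n y _; rewrite lee_fin.
  - by move=> y _ a b ab; rewrite lee_fin; exact/lefP/nd_nnsfun_approx.
transitivity (limn (fun n => \int[mu]_x ((f_ n (phi x))%:E * (p x)%:E))); last first.
  rewrite -monotone_convergence//=.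
  - apply: eq_integral => x _; apply/cvg_lim => //.
    rewrite muleC; under eq_fun do rewrite muleC.
    by apply: cvgeZl => //; exact: cvg_nnsfun_approx.
  - by move=> n x _; rewrite mule_ge0// lee_fin.
  - by move=> x _ a b ab; apply: lee_wpmul2r; rewrite lee_fin//; exact/lefP/nd_nnsfun_approx.
congr (limn _); apply/funext => n.
under eq_integral do rewrite fimfunE -fsumEFin//.
rewrite ge0_integral_fsum//; last 2 first.
- by move=> r; exact/measurable_EFinP/measurableT_comp.
- by move=> r x _; rewrite nnfun_muleindic_ge0.
under [RHS]eq_integral.
  move=> x xD; rewrite fimfunE -fsumEFin// muleC ge0_mule_fsumr; last first.
    by move=> r; rewrite nnfun_muleindic_ge0.
  over.
rewrite [RHS]ge0_integral_fsum//; last 2 first.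
- move=> r; apply: emeasurable_funM; apply/measurable_EFinP => //.
  by apply: measurable_funM => //; exact: measurableT_comp.
- by move=> r x _; rewrite mule_ge0 ?lee_fin// -lee_fin EFinM nnfun_muleindic_ge0.
apply: eq_fsbigr => r rr.
have r0 : (0 <= r)%R.
  by move: rr; rewrite inE => -[y _ <-].
rewrite integralZl_indic_nnsfun//= integral_indic// setIT nuE//.
rewrite -ge0_integralZl//=.
- by apply: eq_integral => x _; rewrite muleA -EFinM muleC.
- apply: emeasurable_funM; apply/measurable_EFinP => //.
  exact: measurableT_comp.
- by move=> x _; rewrite mule_ge0// lee_fin.
Qed.

(** The proofs are phantom arguments, so that the measure structure declared below can be inferred
    from the term alone. *)
Definition image_density of measurable_fun [set: X] phi & measurable_fun [set: X] p
  & (forall x, 0 <= p x)%R := fun A : set Y =>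
  \int[mu]_x ((\1_A (phi x))%:E * (p x)%:E).

Let m := image_density mphi mp p0.

Let m0 : m set0 = 0.
Proof.
rewrite /m /image_density integral0_eq// => x _.
by rewrite indic0 mul0e.
Qed.

Let m_ge0 A : 0 <= m A.
Proof. by apply: integral_ge0 => x _; rewrite mule_ge0 ?lee_fin. Qed.

Let m_sigma_additive : semi_sigma_additive m.
Proof.
move=> F mF tF mUF.
have mpre A : measurable A -> measurable (phi @^-1` A).
  by move=> mA; rewrite -[_ @^-1` _]setTI; exact: mphi.
have mE A : measurable A -> m A = \int[mu]_(x in phi @^-1` A) (p x)%:E.
  move=> mA; rewrite integral_mkcond; apply: eq_integral => x _.
  rewrite patchE indicE; have -> : (x \in phi @^-1` A) = (phi x \in A) by [].
  by case: ifPn => _; rewrite ?mul1e ?mul0e.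
rewrite mE// preimage_bigcup ge0_integral_bigcup//=.
- under eq_fun do under eq_bigr do rewrite mE//.
  by apply: is_cvg_nneseries => n _ _; apply: integral_ge0 => x _; rewrite lee_fin.
- by move=> i; exact: mpre.
- by apply: measurable_funTS; exact/measurable_EFinP.
- by move=> x _; rewrite lee_fin.
- by move=> i j _ _ [x [/= Fix Fjx]]; apply: tF => //; exists (phi x).
Qed.

HB.instance Definition _ := isMeasure.Build _ _ _ m m0 m_ge0 m_sigma_additive.

End image_density.

Section exp_affine_image.
Local Open Scope ereal_scope.
Context {R : realType}.
Notation mu := (@lebesgue_measure R).
Variables (a b : R).
Hypothesis b0 : (0 < b)%R.

Let psi (x : R) : R := expR (a + b * x).
Let p (x : R) : R := b * psi x.

Let psi_gt0 x : (0 < psi x)%R. Proof. exact: expR_gt0. Qed.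

Let is_derive_psi (x : R) : is_derive x 1%R psi (p x).
Proof.
have d : is_derive x 1%R (fun x : R => a + b * x)%R _ :=
  is_deriveD (is_derive_cst a x 1%R) (is_deriveZ b (is_derive_id x 1%R)).
apply: is_derive_eq (is_derive1_comp (is_derive_expR _) d) _.
by rewrite /GRing.scale/= add0r mulr1 mulrC.
Qed.

Let cp : continuous p.
Proof.
move=> x; apply: cvgM; first exact: cvg_cst.
apply: (cvg_comp _ expR); last exact: continuous_expR.
apply: cvgD; first exact: cvg_cst.
by apply: cvgM; [exact: cvg_cst|exact: cvg_id].
Qed.

Let cpsi : continuous psi.
Proof.
move=> x; have [+ _] := is_derive_psi x.
by move=> /derivable1_diffP/differentiable_continuous.
Qed.

Let mp : measurable_fun [set: R] p. Proof. exact: continuous_measurable_fun. Qed.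
Let p0 x : (0 <= p x)%R. Proof. by rewrite mulr_ge0 ?expR_ge0// ltW. Qed.
Let mpsi : measurable_fun [set: R] psi.
Proof.
by apply: measurableT_comp => //; apply: measurable_funD.
Qed.

Let m := @image_density _ _ (measurableTypeR R) (measurableTypeR R) R mu psi p mpsi mp p0.

(* Adding Lebesgue measure on the nonpositive half-line to [m] gives back
   Lebesgue measure, which need only be checked on intervals. *)
Let m_itv_gt0 (c e : R) : (0 < c)%R -> (c < e)%R -> m `]c, e]%classic = (e - c)%:E.
Proof.
move=> c0 ce; have e0 := lt_trans c0 ce.
have psiK (x : R) : (0 < x)%R -> psi ((ln x - a) / b)%R = x.
  by move=> x0; rewrite /psi mulrC divfK ?gt_eqF// addrC subrK lnK.
pose al := ((ln c - a) / b)%R; pose be := ((ln e - a) / b)%R.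
have albe : (al < be)%R by rewrite /al /be ltr_pM2r ?invr_gt0// ltrD2r ltr_ln.
transitivity (\int[mu]_(x in `]al, be]) (p x)%:E).
  rewrite [RHS]integral_mkcond; apply: eq_integral => x _.
  rewrite patchE indicE.
  have -> : (psi x \in `]c, e]%classic) = (x \in `]al, be]%classic).
    apply/idP/idP; rewrite !inE/= !in_itv/= -{1}(psiK c)// -{1}(psiK e)//.
      rewrite /psi ltr_expR ler_expR ltrD2l lerD2l ltr_pM2l// ler_pM2l//.
    rewrite /psi ltr_expR ler_expR ltrD2l lerD2l ltr_pM2l// ler_pM2l//.
  by case: ifPn => _; rewrite ?mul1e ?mul0e.
rewrite integral_itv_obnd_cbnd//; last first.
  by apply: measurable_funTS; exact/measurable_EFinP.
rewrite (@continuous_FTC2 _ p psi)//.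
- by rewrite !psiK.
- exact: continuous_subspaceT.
- split.
  + by move=> x _; have [] := is_derive_psi x.
  + by apply: cvg_at_right_filter; exact: cpsi.
  + by apply: cvg_at_left_filter; exact: cpsi.
- by move=> x _; have [] := is_derive_psi x; rewrite derive1E.
Qed.

Let m_itv_ge0 (e : R) : (0 < e)%R -> m `]0%R, e]%classic = e%:E.
Proof.
move=> e0.
(* These intervals have positive left end points and increase to []0, e]]; the factor 1/2 keeps the
   left end point strictly below e already for n = 0. *)
pose F n := `]e / 2 / n.+1%:R, e]%classic%R : set R.
have F0 n : (0 < e / 2 / n.+1%:R)%R by rewrite !divr_gt0.
have UF : \bigcup_n F n = `]0%R, e]%classic.
  apply/seteqP; split => [x [n _]|x]; rewrite /F/= !in_itv/=.
    by move=> /andP[/(lt_trans (F0 n)) -> ->].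
  move=> /andP[x0 xe]; exists (Num.truncn (e / 2 / x)) => //=; rewrite in_itv/= xe andbT.
  rewrite ltr_pdivrMr// [ltRHS]mulrC -ltr_pdivrMr//.
  exact: truncnS_gt.
have : m (F n) @[n --> \oo] --> m `]0%R, e]%classic.
  rewrite -UF; apply: nondecreasing_cvg_mu.
  - by move=> n; exact: measurable_itv.
  - by apply: bigcupT_measurable => n; exact: measurable_itv.
  - move=> i j ij; apply/subsetPset/subset_itvr; rewrite bnd_simp.
    by rewrite ler_pM2l ?divr_gt0// lef_pV2 ?posrE// ler_nat.
move=> /cvg_unique; apply => //.
have mF n : m (F n) = (e - e / 2 * harmonic n)%:E.
  rewrite m_itv_gt0// ltr_pdivrMr// ltr_pdivrMr//.
  by rewrite -[ltLHS]mulr1 -mulrA ltr_pM2l// -natrM ltr1n muln2.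
have -> : (fun n => m (F n)) = fun n => (e - e / 2 * harmonic n)%:E by exact/funext.
apply: cvg_EFin; first exact: nearW.
suff : (e - e / 2 * harmonic n)%R @[n --> \oo] --> (e - e / 2 * 0)%R.
  by rewrite mulr0 subr0.
by apply: cvgB; [exact: cvg_cst|apply: cvgM; [exact: cvg_cst|exact: cvg_harmonic]].
Qed.

Lemma lebesgue_measure_exp_affine (A : set R) : measurable A ->
  mu (A `&` `]0%R, +oo[) = \int[mu]_x ((\1_A (psi x))%:E * (p x)%:E).
Proof.
move=> mA.
have mNy : measurable (`]-oo, 0%R]%classic : set (measurableTypeR R)) by exact: measurable_itv.
have addE B : measure_add m (mrestr mu mNy) B = m B + mu (B `&` `]-oo, 0%R]%classic).
  exact: measure_addE.
have mE : forall B, measurable B -> mu B = measure_add m (mrestr mu mNy) B.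
  apply: lebesgue_measure_unique => _ [[c e] _ <-].
  rewrite [RHS](addE) [(c, e).1]/= [(c, e).2]/=.
  have [ec|ce] := leP e c.
    by rewrite set_itv_ge ?bnd_simp -?leNgt// set0I !measure0 adde0.
  have [c0|c0] := ltP 0%R c.
    rewrite (_ : _ `&` _ = set0); last first.
      apply/seteqP; split => x //=; rewrite !in_itv/= => -[/andP[cx _]].
      by rewrite leNgt (lt_trans c0 cx).
    by rewrite measure0 adde0 m_itv_gt0// lebesgue_measure_itv/= lte_fin ce EFinB.
  have [e0|e0] := leP e 0%R.
    rewrite setIidl; last first.
      by move=> x/=; rewrite !in_itv/= => /andP[_ /le_trans]; apply.
    rewrite (_ : m _ = 0) ?add0e//; apply: integral0_eq => x _.
    rewrite indicE memNset ?mul0e//= in_itv/= => /andP[_].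
    by rewrite leNgt (le_lt_trans e0).
  have -> : m `]c, e]%classic = m `]0%R, e]%classic.
    apply: eq_integral => x _; congr (_%:E * _).
    rewrite !indicE (_ : (_ \in _) = (psi x \in `]0%R, e]%classic))//.
    apply/idP/idP; rewrite !inE/= !in_itv/= => /andP[_ ->]; rewrite andbT//.
    exact: le_lt_trans (psi_gt0 x).
  rewrite m_itv_ge0//.
  have -> : `]c, e]%classic `&` `]-oo, 0%R]%classic = `]c, 0%R]%classic.
    apply/seteqP; split => x /=; rewrite !in_itv/=.
      by move=> [/andP[-> _] ->].
    by move=> /andP[-> x0]; rewrite x0 (le_trans x0)// ltW.
  rewrite !lebesgue_measure_itv/= !lte_fin ce.
  move: c0; rewrite le_eqVlt => /predU1P[->|->].
    by rewrite ltxx adde0 oppr0 adde0.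
  by rewrite add0e.
rewrite mE; last by apply: measurableI => //; exact: measurable_itv.
rewrite [LHS](addE) (_ : _ `&` _ `&` _ = set0) ?measure0 ?adde0; last first.
  apply/seteqP; split => x //=; rewrite !in_itv/= andbT => -[[_ x0] ].
  by rewrite leNgt x0.
apply: eq_integral => x _; rewrite indicI/=; congr (_%:E * _).
by rewrite [X in (_ * X)%R]indicE mem_set ?mulr1//= in_itv/= andbT.
Qed.

Lemma ge0_integral_expR_affine (f : R -> \bar R) :
  measurable_fun [set: R] f -> (forall x, 0 <= f x) ->
  \int[mu]_(x in `]0%R, +oo[) f x =
  \int[mu]_x (f (expR (a + b * x)) * (b * expR (a + b * x))%:E).
Proof.
move=> mf f0.
have mD : measurable (`]0%R, +oo[%classic : set (measurableTypeR R)) by exact: measurable_itv.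
pose TR := measurableTypeR R.
rewrite -(@ge0_integral_image_density _ _ TR TR R mu psi p mpsi mp p0 (mrestr mu mD) f)//; last first.
  by move=> A mA; rewrite -lebesgue_measure_exp_affine.
rewrite (@ge0_integral_image_density _ _ TR TR R mu id (\1_(`]0%R, +oo[%classic)) _ _ _
  (mrestr mu mD) f)//=.
- rewrite [LHS]integral_mkcond; apply: eq_integral => x _.
  by rewrite patchE indicE; case: ifPn => _; rewrite ?mule1 ?mule0.
- move=> A mA; transitivity (mu (A `&` `]0%R, +oo[%classic)); first by [].
  rewrite -(setIT (_ `&` _)) -integral_indic//; last exact: measurableI.
  by apply: eq_integral => x _; rewrite indicI EFinM.
Qed.

End exp_affine_image.

Lemma integral_normal_probE {R : realType} (m s : R) (f : R -> \bar R) :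
  measurable_fun [set: R] f -> (forall x, (0 <= f x)%E) ->
  (\int[normal_prob m s]_x f x = \int[lebesgue_measure]_x (f x * (normal_pdf m s x)%:E))%E.
Proof.
move=> mf f0.
apply: (@ge0_integral_image_density _ _ (measurableTypeR R) (measurableTypeR R) R
  lebesgue_measure id (normal_pdf m s)) => //.
- exact: measurable_normal_pdf.
- exact: normal_pdf_ge0.
- move=> A mA.
  transitivity (\int[lebesgue_measure]_(x in A) (normal_pdf m s x)%:E)%E; first by [].
  rewrite [LHS]integral_mkcond; apply: eq_integral => x _.
  by rewrite patchE indicE; case: ifPn => _; rewrite ?mul1e ?mul0e.
Qed.

(** The product of x with the power -1 of x^2 equals x^-1, also at 0, and powers are measurable. *)
Lemma measurable_invr {R : realType} : measurable_fun [set: R] (fun x : R => x^-1).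
Proof.
have -> : (fun x : R => x^-1) = fun x => x * (x ^+ 2) `^ (-1).
  apply/funext => x; have [->|x0] := eqVneq x 0; first by rewrite invr0 mul0r.
  by rewrite powR_inv1 ?sqr_ge0// expr2 invfM mulrA divff// mul1r.
apply: measurable_funM => //.
apply: (measurableT_comp (measurable_powR (-1))).
exact: measurable_funX.
Qed.

Lemma measurable_sqrtr {R : realType} : measurable_fun [set: R] (Num.sqrt : R -> R).
Proof. exact: continuous_measurable_fun (@sqrt_continuous R). Qed.

Lemma ge0_integral_oppr {R : realType} (f : R -> \bar R) :
  measurable_fun [set: R] f -> (forall x, (0 <= f x)%E) ->
  (\int[@lebesgue_measure R]_x f x = \int[@lebesgue_measure R]_x f (- x)%R)%E.
Proof.
move=> mf f0.
have := @ge0_integral_pushforward _ _ (measurableTypeR R) (measurableTypeR R) R -%R _ lebesgue_measure setT f.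
move=> /(_ (@oppr_measurable _ _) measurableT mf (fun y _ => f0 y)) <-.
apply: eq_measure_integral => A mA _.
exact/esym/lebesgue_measureN.
Qed.

Section exp_change_of_variables.
Local Open Scope ereal_scope.
Context {R : realType}.
Notation mu := (@lebesgue_measure R).
Variables (a b : R) (f : R -> \bar R).
Hypothesis b0 : (b != 0)%R.

Lemma ge0_integral_expR_affine_neq0 :
  measurable_fun [set: R] f -> (forall x, 0 <= f x) ->
  \int[mu]_(x in `]0%R, +oo[) f x =
  \int[mu]_x (f (expR (a + b * x)) * (`|b| * expR (a + b * x))%:E).
Proof.
move=> mf f0; move: b0; rewrite neq_lt => /orP[bn|bp]; last first.
  by rewrite (ge0_integral_expR_affine a bp mf f0) (gtr0_norm bp).
have bN : (0 < - b)%R by rewrite oppr_gt0.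
rewrite (ge0_integral_expR_affine a bN mf f0) (ltr0_norm bn).
rewrite [LHS]ge0_integral_oppr.
- by apply: eq_integral => x _; rewrite mulrNN.
- apply: emeasurable_funM; [apply: measurableT_comp => //|apply/measurable_EFinP/measurable_funM => //].
    by apply: measurableT_comp => //; apply: measurable_funD.
  by apply: measurableT_comp => //; apply: measurable_funD.
- by move=> x; rewrite mule_ge0// lee_fin mulr_ge0 ?expR_ge0// oppr_ge0 ltW.
Qed.

End exp_change_of_variables.

(** * The resolvent of a geometric Brownian motion *)

Section resolvent.
Context {R : realType}.
Notation mu := (@lebesgue_measure R).
Variables (rho a b n1 n2 : R).
Hypotheses (b0 : b != 0) (n12 : n2 < n1)
  (n1D2 : n1 + n2 = - (2 * a / b ^+ 2)) (n1M2 : n1 * n2 = - (2 * rho / b ^+ 2)).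

(** Up to the constant this is (nu / y)^(-n) / nu, with n = n2 for nu < y and n = n1 otherwise. The
    exponential form is the one in which the Laplace integral delivers it. *)
Definition green (y nu : R) : R :=
  2 / (b ^+ 2 * (n1 - n2)) *
  (expR (- (if nu < y then n2 else n1) * (ln nu - ln y)) / nu).

(* The density at [nu > 0] of [y * expR (a * t - b * x)] for x ~ N(0, t). *)
Definition lognormal_kernel (y t nu : R) : R :=
  (Num.sqrt t)^-1 * (Num.sqrt (2 * pi))^-1 *
  expR (- ((ln nu - ln y - a * t) / b) ^+ 2 / (2 * t)) / (`|b| * nu).
Local Notation gk := lognormal_kernel.

Lemma lognormal_kernel_ge0 (y t nu : R) : 0 < nu -> 0 <= gk y t nu.
Proof.
move=> nu0; rewrite mulr_ge0 ?invr_ge0 ?mulr_ge0 ?invr_ge0 ?sqrtr_ge0 ?expR_ge0//.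
exact: ltW.
Qed.

Lemma measurable_lognormal_kernel d (X : measurableType d) (f g h : X -> R) :
  measurable_fun [set: X] f -> measurable_fun [set: X] g -> measurable_fun [set: X] h ->
  measurable_fun [set: X] (fun x => gk (f x) (g x) (h x)).
Proof.
move=> mf mg mh.
rewrite /lognormal_kernel; apply: measurable_funM; last first.
  apply: (measurableT_comp measurable_invr).
  by apply: measurable_funM.
apply: measurable_funM.
  apply: measurable_funM => //.
  apply: (measurableT_comp measurable_invr).
  exact: (measurableT_comp measurable_sqrtr mg).
apply: measurableT_comp => //; apply: measurable_funM.
  apply: (measurableT_comp (f := fun x : R => - x ^+ 2)) => //.
    by apply: measurableT_comp => //; exact: measurable_funX.
  apply: measurable_funM => //.
  apply: measurable_funB; last by apply: measurable_funM.
  by apply: measurable_funB; exact: (measurableT_comp (@measurable_ln R)).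
apply: (measurableT_comp measurable_invr).
exact: measurable_funM.
Qed.

Lemma integral_normal_exp (f : R -> R) (y t : R) :
  measurable_fun [set: R] f -> (forall x, 0 <= f x) -> 0 < y -> 0 < t ->
  (\int[normal_prob 0 (Num.sqrt t)]_x (f (y * expR (a * t - b * x)))%:E =
   \int[mu]_(nu in `]0%R, +oo[) (f nu * gk y t nu)%:E)%E.
Proof.
move=> mf f0 y0 t0.
have st0 : 0 < Num.sqrt t by rewrite sqrtr_gt0.
have mF : measurable_fun [set: R] (fun x => f (y * expR (a * t - b * x))).
  apply: measurableT_comp => //; apply: measurable_funM => //.
  apply: measurableT_comp => //; apply: measurable_funB => //.
have gk0 nu : 0 < nu -> 0 <= gk y t nu by exact: lognormal_kernel_ge0.
rewrite integral_normal_probE; last 2 first.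
- exact/measurable_EFinP.
- by move=> x; rewrite lee_fin.
have mg : measurable_fun [set: R] (gk y t) by exact: measurable_lognormal_kernel.
(* The kernel is negative at negative [nu], and the substitution asks for a function that is
   nonnegative on the whole line; hence the indicator. *)
pose H nu := ((f nu * gk y t nu) * \1_(`]0, +oo[%classic) nu)%:E.
transitivity (\int[mu]_(nu in `]0%R, +oo[) H nu)%E; last first.
  apply: eq_integral => nu; rewrite inE /H => nu0.
  by rewrite indicE mem_set// mulr1.
rewrite (@ge0_integral_expR_affine_neq0 _ (ln y + a * t) (- b)) ?oppr_eq0//; last 2 first.
- apply/measurable_EFinP; apply: measurable_funM => //; exact: measurable_funM.
- move=> nu; rewrite /H lee_fin indicE; case: (boolP (nu \in _)); rewrite ?mulr0//.
  by rewrite inE/= in_itv/= andbT mulr1 => /gk0 ?; rewrite mulr_ge0.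
apply: eq_integral => x _; rewrite /H -!EFinM; congr EFin.
have -> : expR (ln y + a * t + - b * x) = y * expR (a * t - b * x).
  by rewrite -addrA expRD lnK// mulNr.
rewrite indicE mem_set ?mulr1; last first.
  by rewrite /= in_itv/= andbT mulr_gt0 ?expR_gt0.
rewrite -mulrA; congr *%R.
rewrite /lognormal_kernel lnM ?posrE ?expR_gt0// expRK normrN.
rewrite divfK; last by rewrite !mulf_neq0 ?normr_eq0 ?(gt_eqF y0) ?(gt_eqF (expR_gt0 _)).
have t20 : 0 < t * 2 by rewrite mulr_gt0.
rewrite normal_pdfE ?gt_eqF//= /normal_peak /normal_fun subr0 sqr_sqrtr ?(ltW t0)//.
have -> : (ln y + (a * t - b * x) - ln y - a * t) / b = - x by field.
rewrite sqrrN -mulrnAr -(mulr_natl pi) -(mulr_natl t).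
by rewrite sqrtrM ?(ltW t0)// invfM.
Qed.

(** With z = ln nu - ln y, expanding the square gives the exponent a z / b^2 - p^2 t - q^2 / t,
    where p^2 = rho + a^2 / (2 b^2) and q^2 = z^2 / (2 b^2). By the relations between roots and
    coefficients p^2 is b^2 (n1 - n2)^2 / 8, so the transform contributes exp(- (n1 - n2) |z| / 2),
    and the sign of z selects n1 or n2. The case nu = y is left out because q must be positive. *)
Lemma integral_lognormal_kernel (y nu : R) : 0 < y -> 0 < nu -> nu != y ->
  (\int[mu]_(t in `]0%R, +oo[) (expR (- rho * t) * gk y t nu)%:E = (green y nu)%:E)%E.
Proof.
move=> y0 nu0 nuy.
pose z := ln nu - ln y.
have z0 : z != 0.
  by rewrite subr_eq0; apply: contra nuy => /eqP/ln_inj; rewrite !posrE => ->.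
pose s2 : R := Num.sqrt 2.
have s20 : 0 < s2 by rewrite sqrtr_gt0.
have s2E : s2 ^+ 2 = 2 by rewrite sqr_sqrtr.
have nb0 : 0 < `|b| by rewrite normr_gt0.
have nbE : `|b| ^+ 2 = b ^+ 2 by rewrite real_normK ?num_real.
have n12p : 0 < n1 - n2 by rewrite subr_gt0.
have bn0 : b ^+ 2 != 0 by rewrite sqrf_eq0.
pose p := `|b| * (n1 - n2) / (2 * s2).
pose q := `|z| / (s2 * `|b|).
have p0 : 0 < p by rewrite divr_gt0 ?mulr_gt0.
have q0 : 0 < q by rewrite divr_gt0 ?mulr_gt0// normr_gt0.
have aE : a = - (b ^+ 2 * (n1 + n2) / 2) by rewrite n1D2; field.
have rE : rho = - (b ^+ 2 * (n1 * n2) / 2) by rewrite n1M2; field.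
have p2 : p ^+ 2 = b ^+ 2 * (n1 - n2) ^+ 2 / 8.
  by rewrite /p !exprMn exprVn exprMn nbE s2E; field.
have q2 : q ^+ 2 = z ^+ 2 / (2 * b ^+ 2).
  by rewrite /q !exprMn exprVn exprMn nbE s2E real_normK ?num_real.
pose C := (Num.sqrt (2 * pi))^-1 / (`|b| * nu) * expR (a * z / b ^+ 2).
have C0 : 0 <= C by rewrite !mulr_ge0 ?invr_ge0 ?mulr_ge0 ?expR_ge0// ltW.
transitivity (\int[mu]_(t in `]0%R, +oo[) (C%:E * ((Num.sqrt t)^-1 * expR (- p ^+ 2 * t - q ^+ 2 / t))%:E))%E.
  apply: eq_integral => t; rewrite inE/= in_itv/= andbT => t0.
  rewrite -EFinM; congr EFin.
  have -> : C * ((Num.sqrt t)^-1 * expR (- p ^+ 2 * t - q ^+ 2 / t)) =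
     (Num.sqrt t)^-1 * (Num.sqrt (2 * pi))^-1 * (expR (a * z / b ^+ 2) * expR (- p ^+ 2 * t - q ^+ 2 / t)) / (`|b| * nu).
    by rewrite /C; ring.
  rewrite /lognormal_kernel -expRD -/z.
  have -> : a * z / b ^+ 2 + (- p ^+ 2 * t - q ^+ 2 / t) = - rho * t + (- ((z - a * t) / b) ^+ 2 / (2 * t)).
    by rewrite p2 q2 rE aE; field; rewrite b0 gt_eqF.
  by rewrite expRD; ring.
have mK : measurable_fun [set: R] (fun t => (Num.sqrt t)^-1 * expR (- p ^+ 2 * t - q ^+ 2 / t)).
  apply: measurable_funM.
    exact: (measurableT_comp measurable_invr measurable_sqrtr).
  apply: measurableT_comp => //; apply: measurable_funB; apply: measurable_funM => //.
  exact: measurable_invr.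
rewrite ge0_integralZl//; last first.
  by apply: measurable_funTS; exact/measurable_EFinP.
rewrite laplace_gauss// -EFinM; congr EFin.
rewrite /C /green -/z sqrtrM// -/s2.
have pi0 : 0 < Num.sqrt pi :> R by rewrite sqrtr_gt0 pi_gt0.
have pqE : 2 * p * q = (n1 - n2) * `|z| / 2.
  have -> : 2 * p * q = (n1 - n2) * `|z| / (s2 ^+ 2) * (`|b| / `|b|).
    by rewrite /p /q; field; rewrite !gt_eqF.
  by rewrite s2E divff ?mulr1// gt_eqF.
rewrite pqE.
have eE : expR (a * z / b ^+ 2) * expR (- ((n1 - n2) * `|z| / 2)) =
   expR (- (if nu < y then n2 else n1) * z).
  rewrite -expRD; congr expR; rewrite aE.
  have [nuy'|nuy'] := ltP nu y.
    have /ltr0_norm -> : z < 0 by rewrite subr_lt0 ltr_ln.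
    by field.
  have /gtr0_norm -> : 0 < z by rewrite subr_gt0 ltr_ln ?posrE// lt_neqAle eq_sym nuy.
  by field.
rewrite -eE -nbE /p.
by field; rewrite !gt_eqF.
Qed.

Lemma measurable_green (y : R) : measurable_fun [set: R] (green y).
Proof.
have -> : green y = fun nu => 2 / (b ^+ 2 * (n1 - n2)) *
    (expR (- (if nu < y then n2 else n1) * (ln nu - ln y)) * nu^-1) by [].
apply: measurable_funM => //; apply: measurable_funM; last exact: measurable_invr.
apply: measurableT_comp => //; apply: measurable_funM.
  apply: measurableT_comp => //.
  by apply: measurable_fun_ifT => //; exact: measurable_fun_ltr.
by apply: measurable_funB.
Qed.

Lemma resolvent_green (f : R -> R) (y : R) :
  measurable_fun [set: R] f -> (forall x, 0 <= f x) -> 0 < y ->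
  (\int[mu]_(t in `]0%R, +oo[) ((expR (- rho * t))%:E *
     \int[normal_prob 0 (Num.sqrt t)]_x (f (y * expR (a * t - b * x)))%:E) =
   \int[mu]_(nu in `]0%R, +oo[) (f nu * green y nu)%:E)%E.
Proof.
move=> mf f0 y0.
pose D : set R := `]0, +oo[%classic.
have mD : measurable (D : set (measurableTypeR R)) by exact: measurable_itv.
have DE x : (x \in D) = (0 < x) by apply/idP/idP; rewrite inE /D/= in_itv/= andbT.
have gk0 t nu : 0 < nu -> 0 <= gk y t nu by exact: lognormal_kernel_ge0.
pose F (tn : measurableTypeR R * measurableTypeR R) : \bar R :=
  ((\1_D tn.1 * \1_D tn.2) * (expR (- rho * tn.1) * (f tn.2 * gk y tn.1 tn.2)))%:E.
have F0 tn : (0 <= F tn)%E.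
  rewrite lee_fin !indicE !DE; case: ltP; rewrite ?mul0r// => _.
  case: ltP => [t20|]; rewrite ?mulr0 ?mul0r// !mul1r.
  by rewrite mulr_ge0 ?expR_ge0// mulr_ge0 ?gk0.
have mF : measurable_fun [set: measurableTypeR R * measurableTypeR R] F.
  have m1 := @measurable_fst _ _ (measurableTypeR R) (measurableTypeR R).
  have m2 := @measurable_snd _ _ (measurableTypeR R) (measurableTypeR R).
  have mDi : measurable_fun [set: measurableTypeR R] (\1_D : _ -> R) by exact: measurable_indic.
  apply/measurable_EFinP; apply: measurable_funM.
    apply: measurable_funM; first exact: (measurableT_comp mDi m1).
    exact: (measurableT_comp mDi m2).
  apply: measurable_funM.
    apply: measurableT_comp => //; apply: measurable_funM => //.
  apply: measurable_funM; first exact: (measurableT_comp mf m2).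
  by apply: measurable_lognormal_kernel.
transitivity (\int[mu]_t \int[mu]_nu F (t, nu))%E.
  rewrite [LHS]integral_mkcond; apply: eq_integral => t _.
  rewrite patchE DE; case: ifPn => t0; last first.
    rewrite integral0_eq// => nu _.
    by rewrite /F/= !indicE !DE (negbTE t0) !mul0r.
  rewrite integral_normal_exp//.
  have mfg : measurable_fun [set: R] (fun nu => f nu * gk y t nu).
    apply: measurable_funM => //; exact: measurable_lognormal_kernel.
  rewrite -ge0_integralZl//; last first.
    by move=> nu; rewrite /= in_itv/= andbT => nu0; rewrite lee_fin mulr_ge0// gk0.
    by apply: measurable_funTS; exact/measurable_EFinP.
  rewrite [LHS]integral_mkcond; apply: eq_integral => nu _.
  rewrite patchE DE /F/= !indicE !DE t0 mul1r.
  by case: ifPn => _; rewrite ?mul0r// mul1r -EFinM.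
rewrite (@fubini_tonelli _ _ (measurableTypeR R) (measurableTypeR R) R mu mu F)//.
have mDy : measurable (D `\ y : set (measurableTypeR R)) by exact: measurableD.
transitivity (\int[mu]_(nu in D) \int[mu]_t F (t, nu))%E.
  rewrite [RHS]integral_mkcond; apply: eq_integral => nu _.
  rewrite patchE DE; case: ifPn => // nu0; apply: integral0_eq => t _.
  by rewrite /F/= !indicE !DE (negbTE nu0) mulr0 mul0r.
(* The time integral is known off the diagonal, so the null point nu = y is removed on both
   sides. *)
rewrite -(@integral_setD1 _ _ y)//; last first.
  apply: measurable_funTS.
  exact: (measurable_fun_fubini_tonelli_G (m1 := mu) F).
rewrite -[RHS](@integral_setD1 _ _ y)//; last first.
  apply: measurable_funTS; apply/measurable_EFinP/measurable_funM => //.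
  exact: measurable_green.
apply: eq_integral => nu; rewrite inE => -[/mem_set + /eqP nuy].
rewrite DE => nu0.
have mtg : measurable_fun [set: R] (fun t => expR (- rho * t) * gk y t nu).
  apply: measurable_funM; last exact: measurable_lognormal_kernel.
  by apply: measurableT_comp => //; apply: measurable_funM.
rewrite [RHS]EFinM -(integral_lognormal_kernel y0 nu0 nuy).
rewrite -ge0_integralZl//; last first.
- by rewrite lee_fin.
- by move=> t _; rewrite lee_fin mulr_ge0 ?expR_ge0 ?gk0.
- by apply: measurable_funTS; exact/measurable_EFinP.
rewrite [RHS]integral_mkcond; apply: eq_integral => t _.
rewrite patchE DE /F/= !indicE !DE nu0 mulr1.
by case: ifPn => _; rewrite ?mul0r// mul1r -EFinM mulrCA.
Qed.

End resolvent.

(** * The augmented Brownian filtration *)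

Section shift.
Context {R : realType}.
Notation mu := (@lebesgue_measure R).

Lemma ge0_integral_lebesgue_shift (f : R -> \bar R) (s : R) :
  measurable_fun [set: R] f -> (forall x, (0 <= f x)%E) ->
  (\int[mu]_x f x = \int[mu]_x f (x + s)%R)%E.
Proof.
move=> mf f0.
have ms : measurable_fun [set: measurableTypeR R] (fun x : measurableTypeR R => x + s : measurableTypeR R).
  by apply: measurable_funD.
have := @ge0_integral_pushforward _ _ (measurableTypeR R) (measurableTypeR R) R _ ms mu setT f.
move=> /(_ measurableT mf (fun y _ => f0 y)) <-.
apply: eq_measure_integral => A mA _.
apply: lebesgue_measure_unique => // _ [[c e] _ <-].
have cE : (fun x => x + s) @^-1` `]c, e]%classic = `]c - s, e - s]%classic.
  by apply/seteqP; split => x /=; rewrite !in_itv/= ltrBlDr lerBrDr.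
transitivity (mu ((fun x => x + s) @^-1` `]c, e]%classic)); last by [].
rewrite cE !lebesgue_measure_itv/= !lte_fin ltrD2r.
by case: ifPn => // _; rewrite -!EFinB opprB addrA subrK.
Qed.

End shift.

Section brownian.
Context {R : realType} {d : measure_display} {T : measurableType d}.
Variables (P : probability T R) (B : R -> T -> R).
Hypothesis hB : is_standard_brownian_motion P B.
Notation mu := (@lebesgue_measure R).
Local Notation aug := (augmented_filtration P B).

Lemma natural_filtration_measurable (s : R) :
  natural_filtration B s `<=` measurable.
Proof.
apply: smallest_sub; first exact: sigma_algebra_measurable.
move=> _ [u [V [/andP[u0 _] mV ->]]].
by rewrite -[X in measurable X]setTI; exact: (bm_measurable hB).
Qed.

Lemma augmented_filtration_measurable (s : R) : aug s `<=` measurable.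
Proof.
apply: smallest_sub; first exact: sigma_algebra_measurable.
move=> E [/natural_filtration_measurable//|[]//].
Qed.

Lemma augmented_filtrationW (s t : R) : s <= t -> aug s `<=` aug t.
Proof.
move=> st; apply: smallest_sub; first exact: smallest_sigma_algebra.
move=> E [nE|nE]; last by apply: sub_sigma_algebra; right.
apply: sub_sigma_algebra; left.
move: E nE; apply: smallest_sub; first exact: smallest_sigma_algebra.
move=> E [u [V [/andP[u0 us] mV EE]]]; apply: sub_sigma_algebra.
by exists u; exists V => //; split => //; rewrite u0 (le_trans us).
Qed.

Lemma augmented_filtration_preimage (s t : R) (V : set R) : 0 <= s -> s <= t ->
  measurable V -> aug t (B s @^-1` V).
Proof.
move=> s0 st mV; apply: sub_sigma_algebra; left.
by apply: sub_sigma_algebra; exists s; exists V => //; rewrite s0.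
Qed.

(** For fixed V both sides are finite measures in E. They are compared on a generating family stable
    under intersection: events of the natural filtration, where independence is given, and null
    events, where both sides vanish. *)
Lemma augmented_filtration_independent (s t : R) (E : set T) (V : set R) :
  0 <= s -> s < t -> aug s E -> measurable V ->
  P (E `&` (B t \- B s) @^-1` V) = (P E * normal_prob 0%R (Num.sqrt (t - s)) V)%E.
Proof.
move=> s0 st sE mV; rewrite -(bm_gaussian hB s0 st mV).
pose X := (B t \- B s) @^-1` V.
have mX : measurable X.
  rewrite -[X in measurable X]setTI.
  apply: measurable_funB => //; apply: (bm_measurable hB) => //.
  exact: le_trans (ltW st).
have pX : 0 <= fine (P X) by rewrite fine_ge0.
pose m1 := mrestr P mX.
pose m2 := mscale (NngNum pX) P.
rewrite -/X.
suff : m1 E = m2 E.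
  rewrite /m1 /m2 /mrestr /mscale/= => ->.
  by rewrite muleC fineK ?fin_num_measure.
pose G := natural_filtration B s `|` [set N : set T | measurable N /\ P N = 0%E].
pose G0 := [set F : set T | exists u : R, exists2 V : set R,
  0 <= u <= s /\ measurable V & F = B u @^-1` V].
have NM := @natural_filtration_measurable s.
have GM : G `<=` measurable by move=> F [/NM//|[]].
apply: (@g_sigma_algebra_measure_unique _ _ _ G GM (fun=> setT)) => //.
- by left; exact: (@measurableT _ (g_sigma_algebraType G0)).
- by rewrite bigcup_const.
- move=> C D [nC|[mC C0]] [nD|[mD D0]].
  + by left; exact: (@measurableI _ (g_sigma_algebraType G0)).
  + right; split; first by apply: measurableI => //; exact: NM.
    apply: (subset_measure0 _ mD) => //; first by apply: measurableI => //; exact: NM.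
  + right; split; first by apply: measurableI => //; exact: NM.
    apply: (subset_measure0 _ mC) => //; first by apply: measurableI => //; exact: NM.
  + right; split; first exact: measurableI.
    apply: (subset_measure0 _ mC) => //; first exact: measurableI.
- move=> F [nF|[mF F0]]; rewrite /= /mrestr /mscale/=.
    by rewrite (bm_independent hB)// muleC fineK ?fin_num_measure.
  rewrite F0 mule0; apply: (subset_measure0 _ mF) => //; first exact: measurableI.
- by move=> _; rewrite /= /mrestr setTI; rewrite ltey_eq fin_num_measure.
Qed.

(* By continuity of the paths, B is the limit of its values along left grid
   points, each of which is jointly measurable. *)
Let grid (n : nat) (t : R) : R := (Num.truncn (n.+1%:R * Num.max t 0))%:R / n.+1%:R.

Let cvg_grid (t : R) : grid ^~ t n @[n --> \oo] --> Num.max t 0.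
Proof.
apply: (@squeeze_cvgr _ _ _ _ (fun n => Num.max t 0 - harmonic n) (fun=> Num.max t 0)).
- near=> n; rewrite /grid /harmonic.
  have m0 : 0 <= n.+1%:R * Num.max t 0 by rewrite mulr_ge0// le_max lexx orbT.
  rewrite ler_pdivrMr// ler_pdivlMr// mulrBl mulVf ?pnatr_eq0// [X in _ && (_ <= X)]mulrC.
  have /andP[t1 t2] := truncn_itv m0.
  rewrite t1 andbT [X in X - _]mulrC lerBlDr.
  by rewrite -[X in _ + X]/(1%:R) -natrD addn1 ltW.
- suff : (Num.max t 0 - harmonic n) @[n --> \oo] --> (Num.max t 0 - 0) by rewrite subr0.
  by apply: cvgB; [exact: cvg_cst|exact: cvg_harmonic].
- exact: cvg_cst.
Unshelve. all: by end_near. Qed.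

Lemma measurable_brownian_joint :
  measurable_fun [set: T * measurableTypeR R] (fun wt => B (Num.max wt.2 0) wt.1).
Proof.
apply: (@measurable_fun_cvg _ _ _ setT (fun n wt => B (grid n wt.2) wt.1)).
  move=> n _ A mA; rewrite setTI.
  (* On each cell of the grid the rounded time is constant, so the preimage is a countable union of
     rectangles. *)
  have -> : (fun wt : T * measurableTypeR R => B (grid n wt.2) wt.1) @^-1` A =
    \bigcup_k ((B (k%:R / n.+1%:R) @^-1` A) `*`
      ((fun t : R => n.+1%:R * Num.max t 0) @^-1` `[k%:R, k.+1%:R[%classic)).
    apply/seteqP; split => [[w t]/= At|[w t]/= [k _ [/= Ak]]].
      exists (Num.truncn (n.+1%:R * Num.max t 0)) => //; split => //=.
      by rewrite in_itv/=; apply: truncn_itv; rewrite mulr_ge0// le_max lexx orbT.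
    rewrite in_itv/= -truncn_eq; last by rewrite mulr_ge0// le_max lexx orbT.
    by move=> /eqP kE; rewrite /grid kE.
  apply: bigcupT_measurable => k; apply: measurableX.
    by rewrite -[X in measurable X]setTI; apply: (bm_measurable hB) => //; rewrite divr_ge0.
  rewrite -[X in measurable X]setTI.
  have : measurable_fun [set: R] (fun t : R => n.+1%:R * Num.max t 0).
    apply: measurable_funM => //; exact: measurable_maxr.
  by apply => //.
move=> [w t] _ /=.
have := @bm_continuous _ _ _ _ _ hB w.
rewrite continuous_subspace_in => /(_ (Num.max t 0)).
have t0 : (Num.max t 0 : R) \in (`[0, +oo[%classic : set R).
  by rewrite inE/= in_itv/= andbT le_max lexx orbT.
move=> /(_ t0) H.
have {}H : B x w @[x --> within (`[0, +oo[%classic) (nbhs (Num.max t 0))] --> B (Num.max t 0) w.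
  by rewrite nbhs_subspace_in//; rewrite inE in t0.
apply: cvg_comp H.
move=> A; rewrite /within/= => HA.
have H2 : \forall n \near \oo, `[0, +oo[%classic (grid n t) -> A (grid n t) := @cvg_grid t _ HA.
change (\forall n \near \oo, A (grid n t)); apply: filterS H2 => n; apply.
by rewrite /= in_itv/= andbT divr_ge0.
Qed.

(** The joint law of the present value and the increment, restricted to E, is compared with the
    corresponding image of the product of P and the normal law. Two finite measures that agree on
    rectangles are equal, and a rectangle reduces to the independence lemma because E met with an
    event of [B s] is again an event at time s. *)
Lemma augmented_filtration_law (s t : R) (E : set T) (phi : R * R -> \bar R) :
  0 <= s -> s < t -> aug s E ->
  measurable_fun [set: measurableTypeR R * measurableTypeR R] phi -> (forall x, (0 <= phi x)%E) ->
  (\int[P]_(w in E) phi (B s w, B t w - B s w)%R =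
   \int[P]_(w in E) \int[normal_prob 0%R (Num.sqrt (t - s))]_x phi (B s w, x))%E.
Proof.
move=> s0 st sE mphi phi0.
have mE : measurable E by exact: augmented_filtration_measurable sE.
pose RR := (measurableTypeR R * measurableTypeR R)%type.
pose N := normal_prob 0%R (Num.sqrt (t - s)).
have mBs : measurable_fun [set: T] (B s) by exact: (bm_measurable hB).
have mBt : measurable_fun [set: T] (B t).
  by apply: (bm_measurable hB); exact: le_trans (ltW st).
pose psi1 (w : T) : RR := (B s w, B t w - B s w).
pose psi2 (wx : T * measurableTypeR R) : RR := (B s wx.1, wx.2).
have mpsi1 : measurable_fun [set: T] psi1.
  by apply/measurable_fun_pairP; split => //; exact: measurable_funB.
have mpsi2 : measurable_fun [set: T * measurableTypeR R] psi2.
  apply/measurable_fun_pairP; split; last exact: measurable_snd.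
  exact: (measurableT_comp mBs measurable_fst).
pose p1 : T -> R := \1_E.
pose p2 : T * measurableTypeR R -> R := \1_E \o fst.
have mp1 : measurable_fun [set: T] p1 by exact: measurable_indic.
have mp2 : measurable_fun [set: T * measurableTypeR R] p2 by exact: (measurableT_comp mp1 measurable_fst).
have p10 w : 0 <= p1 w by [].
have p20 wx : 0 <= p2 wx by [].
pose m1 := @image_density _ _ T RR R P psi1 p1 mpsi1 mp1 p10.
pose m2 := @image_density _ _ _ RR R (P \x N)%E psi2 p2 mpsi2 mp2 p20.
have m12 : forall A, measurable A -> m1 A = m2 A.
  have mEA A : measurable A -> measurable (E `&` B s @^-1` A).
    move=> mA; apply: measurableI => //.
    by rewrite -[X in measurable X]setTI; exact: mBs.
  have rect1 A V : measurable A -> measurable V ->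
      m1 (A `*` V) = (P (E `&` B s @^-1` A) * N V)%E.
    move=> mA mV.
    have sEA : aug s (E `&` B s @^-1` A).
      apply: (@measurableI _ (g_sigma_algebraType (natural_filtration B s `|`
        [set N : set T | measurable N /\ P N = 0%E]))) => //.
      exact: augmented_filtration_preimage.
    have mX : measurable ((B t \- B s) @^-1` V).
      by rewrite -[X in measurable X]setTI; apply: measurable_funB.
    rewrite -(augmented_filtration_independent s0 st sEA mV).
    rewrite -(setIT (_ `&` _)) -integral_indic//; last by apply: measurableI => //; exact: mEA.
    apply: eq_integral => w _; rewrite -EFinM; congr EFin.
    rewrite /p1 !indicE -natrM mulnb; congr (_%:R); congr nat_of_bool.
    apply/idP/idP => [/andP[/set_mem [/= ? ?] /set_mem ?]|/set_mem [[? ?] ?]].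
      exact/mem_set.
    by apply/andP; split; apply/mem_set.
  have rect2 A V : measurable A -> measurable V ->
      m2 (A `*` V) = (P (E `&` B s @^-1` A) * N V)%E.
    move=> mA mV; rewrite -product_measure1E//; last exact: mEA.
    rewrite -(setIT ((_ `&` _) `*` _)) -integral_indic//; last first.
      by apply: measurableX => //; exact: mEA.
    apply: eq_integral => -[w x] _; rewrite -EFinM; congr EFin.
    rewrite /p2/= !indicE -natrM mulnb; congr (_%:R); congr nat_of_bool.
    apply/idP/idP => [/andP[/set_mem [/= ? ?] /set_mem ?]|/set_mem [[/= ? ?] /= ?]].
      exact/mem_set.
    by apply/andP; split; apply/mem_set.
  apply: (measure_unique [set A `*` V | A in measurable & V in measurable] (fun=> setT)).
  - exact: measurable_prod_measurableType.
  - move=> _ _ [A1 mA1 [A2 mA2 <-]] [B1 mB1 [B2 mB2 <-]].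
    exists (A1 `&` B1); first exact: measurableI.
    exists (A2 `&` B2); first exact: measurableI.
    by rewrite setXI.
  - by move=> _; exists setT => //; exists setT => //; rewrite setXTT.
  - by rewrite bigcup_const.
  - by move=> _ [A mA [V mV <-]]; rewrite [LHS]rect1// [RHS]rect2.
  - move=> _; rewrite -setXTT [ltLHS]rect1// ltey_eq fin_numM// fin_num_measure//.
    exact: mEA.
transitivity (\int[m1]_x phi x)%E.
  rewrite (@ge0_integral_image_density _ _ T RR R P psi1 p1 mpsi1 mp1 p10 m1)//.
  rewrite [LHS]integral_mkcond; apply: eq_integral => w _.
  by rewrite patchE /p1 indicE; case: ifPn => _; rewrite ?mule1 ?mule0.
rewrite (@ge0_integral_image_density _ _ _ RR R (P \x N)%E psi2 p2 mpsi2 mp2 p20 m1)//.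
have mF : measurable_fun [set: T * measurableTypeR R] (fun wx => phi (psi2 wx) * (p2 wx)%:E)%E.
  apply: emeasurable_funM; first exact: (measurableT_comp mphi mpsi2).
  exact/measurable_EFinP.
have F0 wx : (0 <= phi (psi2 wx) * (p2 wx)%:E)%E by rewrite mule_ge0// lee_fin.
rewrite (@fubini_tonelli1 _ _ _ _ _ P N _ mF F0).
rewrite [RHS]integral_mkcond; apply: eq_integral => w _.
rewrite patchE /fubini_F /p2/= indicE; case: ifPn => _.
  by apply: eq_integral => x _; rewrite mule1.
by apply: integral0_eq => x _; rewrite mule0.
Qed.

(** * The Markov property of the dual process at fixed times *)

Section markov.
Variables (r rho th n1 n2 y : R).
Let a := rho - r - th ^+ 2 / 2.
Hypotheses (th0 : th != 0) (n12 : n2 < n1)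
  (n1D2 : n1 + n2 = - (2 * a / th ^+ 2)) (n1M2 : n1 * n2 = - (2 * rho / th ^+ 2))
  (y0 : 0 < y).
Local Notation Y := (dual_process r rho th B y).

Lemma dual_process_gt0 (t : R) (w : T) : 0 < Y t w.
Proof. by rewrite /dual_process /state_price !mulr_gt0 ?expR_gt0. Qed.

Lemma dual_processE (t : R) (w : T) : Y t w = y * expR (a * t - th * B t w).
Proof.
rewrite /dual_process /state_price -mulrA -expRD; congr (_ * expR _).
by rewrite /a; ring.
Qed.

Lemma dual_process_shift (s t : R) (w : T) :
  Y t w = Y s w * expR (a * (t - s) - th * (B t w - B s w)).
Proof.
rewrite !dual_processE -mulrA -expRD; congr (_ * expR _); ring.
Qed.

Lemma measurable_dual_process_joint : measurable_fun [set: T * measurableTypeR R]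
  (fun wt => Y (Num.max wt.2 0) wt.1).
Proof.
under eq_fun do rewrite dual_processE.
apply: measurable_funM => //; apply: measurableT_comp => //.
apply: measurable_funB; last first.
  by apply: measurable_funM => //; exact: measurable_brownian_joint.
apply: measurable_funM => //.
apply: (@measurable_maxr _ _ _ _ (fun x : T * measurableTypeR R => x.2) (fun=> 0)).
  exact: measurable_snd.
exact: measurable_cst.
Qed.

Lemma measurable_dual_process (t : R) : 0 <= t -> measurable_fun [set: T] (Y t).
Proof.
move=> t0.
have -> : Y t = fun w => y * expR (a * t - th * B t w) by apply/funext => w; exact: dual_processE.
apply: measurable_funM => //; apply: measurableT_comp => //.
by apply: measurable_funB => //; apply: measurable_funM => //; exact: (bm_measurable hB).
Qed.

(** A conditional expectation tested on events of the augmented filtration, which avoids conditional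
    expectations as objects. Tonelli brings time outside, the law of the increment is used for each
    t > s, and a shift of time by s leaves the resolvent started from [Y s w]. *)
Lemma dual_process_markov (f : R -> R) (s : R) (E : set T) :
  measurable_fun [set: R] f -> (forall x, 0 <= f x) -> 0 <= s -> aug s E ->
  (\int[P]_(w in E) \int[mu]_(t in `]s, +oo[) (expR (- rho * t) * f (Y t w))%:E =
   \int[P]_(w in E) ((expR (- rho * s))%:E *
     \int[mu]_(nu in `]0%R, +oo[) (f nu * green th n1 n2 (Y s w) nu)%:E))%E.
Proof.
move=> mf f0 s0 sE.
have mE : measurable E by exact: augmented_filtration_measurable sE.
pose S : set R := `]s, +oo[%classic.
have SE t : (t \in S) = (s < t) by apply/idP/idP; rewrite inE /S/= in_itv/= andbT.
pose D : set R := `]0, +oo[%classic.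
have DE t : (t \in D) = (0 < t) by apply/idP/idP; rewrite inE /D/= in_itv/= andbT.
have mSi : measurable_fun [set: measurableTypeR R] (\1_S : _ -> R) by apply: measurable_indic; exact: measurable_itv.
have mDi : measurable_fun [set: measurableTypeR R] (\1_D : _ -> R) by apply: measurable_indic; exact: measurable_itv.
have mEi : measurable_fun [set: T] (\1_E : _ -> R) by exact: measurable_indic.
have m1 := @measurable_fst _ _ T (measurableTypeR R).
have m2 := @measurable_snd _ _ T (measurableTypeR R).
pose F (wt : T * measurableTypeR R) : \bar R :=
  (\1_E wt.1 * \1_S wt.2 * (expR (- rho * wt.2) * f (Y (Num.max wt.2 0) wt.1)))%:E.
have F0 wt : (0 <= F wt)%E by rewrite lee_fin !mulr_ge0 ?expR_ge0.
have mES : measurable_fun [set: T * measurableTypeR R] (fun wt => \1_E wt.1 * \1_S wt.2 : R).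
  by apply: measurable_funM; [exact: (measurableT_comp mEi m1)|exact: (measurableT_comp mSi m2)].
have mexp : measurable_fun [set: T * measurableTypeR R] (fun wt => expR (- rho * wt.2)).
  by apply: measurableT_comp => //; apply: measurable_funM.
have mF : measurable_fun [set: T * measurableTypeR R] F.
  apply/measurable_EFinP; apply: measurable_funM => //.
  apply: measurable_funM => //.
  exact: (measurableT_comp mf measurable_dual_process_joint).
(* The normal law to be integrated against varies with t. As an integral of [H] over the fixed
   Lebesgue measure, the inner integral is jointly measurable in path and time, which Tonelli
   needs. *)
pose H (wtn : (T * measurableTypeR R) * measurableTypeR R) : \bar R :=
  (\1_E wtn.1.1 * \1_S wtn.1.2 * expR (- rho * wtn.1.2) *
   (\1_D wtn.2 * f wtn.2 * lognormal_kernel a th (Y s wtn.1.1) (wtn.1.2 - s) wtn.2))%:E.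
have H0 wtn : (0 <= H wtn)%E.
  rewrite lee_fin; apply: mulr_ge0; first by rewrite !mulr_ge0 ?expR_ge0.
  rewrite indicE DE; case: (ltP 0 wtn.2) => n0; last by rewrite !mul0r.
  by rewrite mul1r mulr_ge0// lognormal_kernel_ge0.
have mH : measurable_fun [set: (T * measurableTypeR R) * measurableTypeR R] H.
  have mfst := @measurable_fst _ _ (T * measurableTypeR R)%type (measurableTypeR R).
  have msnd := @measurable_snd _ _ (T * measurableTypeR R)%type (measurableTypeR R).
  apply/measurable_EFinP; apply: measurable_funM.
    by apply: measurable_funM; [exact: (measurableT_comp mES)|exact: (measurableT_comp mexp)].
  apply: measurable_funM.
    by apply: measurable_funM; [exact: (measurableT_comp mDi)|exact: (measurableT_comp mf)].
  apply: measurable_lognormal_kernel => //.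
    exact: (measurableT_comp (measurable_dual_process s0) (measurableT_comp m1 mfst)).
  by apply: measurable_funB => //; exact: (measurableT_comp m2 mfst).
pose G := fubini_F mu H.
have mG : measurable_fun [set: T * measurableTypeR R] G by exact: measurable_fun_fubini_tonelli_F.
have G0 wt : (0 <= G wt)%E by exact: integral_ge0.
have G_S w t : t \notin S -> G (w, t) = 0%E.
  move=> tS; apply: integral0_eq => nu _.
  by rewrite /H/= [X in _ * X * _ * _]indicE (negbTE tS) mulr0 !mul0r.
have G_E w t : w \notin E -> G (w, t) = 0%E.
  move=> wE; apply: integral0_eq => nu _.
  by rewrite /H/= [X in X * _ * _ * _]indicE (negbTE wE) !mul0r.
pose N t := normal_prob 0 (Num.sqrt (t - s)).
have GE w t : w \in E -> s < t -> G (w, t) = ((expR (- rho * t))%:E *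
   \int[N t]_x (f (Y s w * expR (a * (t - s) - th * x)))%:E)%E.
  move=> wE st; have ts0 : 0 < t - s by rewrite subr_gt0.
  rewrite (integral_normal_exp a th0 mf f0 (dual_process_gt0 s w) ts0).
  have mfg : measurable_fun [set: R] (fun nu => f nu * lognormal_kernel a th (Y s w) (t - s) nu).
    by apply: measurable_funM => //; exact: measurable_lognormal_kernel.
  rewrite -ge0_integralZl//; last first.
  - by move=> nu; rewrite /= in_itv/= andbT => nu0; rewrite lee_fin mulr_ge0// lognormal_kernel_ge0.
  - by apply: measurable_funTS; exact/measurable_EFinP.
  rewrite [RHS]integral_mkcond; apply: eq_integral => nu _.
  rewrite patchE DE /H/= !indicE wE SE st DE !mul1r.
  by case: ifPn => _; [rewrite !mul1r EFinM|rewrite !mul0r mulr0].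
transitivity (\int[P]_w \int[mu]_t F (w, t))%E.
  rewrite [LHS]integral_mkcond; apply: eq_integral => w _.
  rewrite patchE; case: ifPn => wE; last first.
    by rewrite integral0_eq// => t _; rewrite /F/= !indicE (negbTE wE) !mul0r.
  rewrite [LHS]integral_mkcond; apply: eq_integral => t _.
  rewrite patchE /F/= !indicE wE; case: ifPn => tS; last by rewrite mulr0 mul0r.
  rewrite !mul1r max_l//; apply: le_trans s0 _.
  by rewrite SE in tS; exact: ltW.
rewrite (@fubini_tonelli _ _ _ _ _ P mu F mF F0).
transitivity (\int[mu]_t \int[P]_w G (w, t))%E.
  apply: eq_integral => t _.
  have [tS|tS] := boolP (t \in S); last first.
    rewrite !integral0_eq// => w _; first by rewrite G_S.
    by rewrite /F/= [X in _ * X * _]indicE (negbTE tS) mulr0 mul0r.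
  have st : s < t by rewrite -SE.
  pose phi (bx : R * R) : \bar R := (expR (- rho * t) *
    f (y * expR (a * s - th * bx.1) * expR (a * (t - s) - th * bx.2)))%:E.
  transitivity (\int[P]_(w in E) phi (B s w, B t w - B s w)%R)%E.
    rewrite [RHS]integral_mkcond; apply: eq_integral => w _.
    rewrite patchE /F/= !indicE tS mulr1; case: ifPn => wE; last by rewrite mul0r.
    rewrite mul1r max_l; last exact: le_trans (ltW st).
    by rewrite /phi/= -dual_processE -dual_process_shift.
  rewrite (augmented_filtration_law s0 st sE); last 2 first.
  - apply/measurable_EFinP; apply: measurable_funM => //; apply: measurableT_comp => //.
    by apply: measurable_funM; [apply: measurable_funM => //|];
      apply: measurableT_comp => //; apply: measurable_funB => //; apply: measurable_funM.
  - by move=> bx; rewrite lee_fin mulr_ge0 ?expR_ge0.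
  rewrite [LHS]integral_mkcond; apply: eq_integral => w _.
  rewrite patchE; case: ifPn => wE; last by rewrite G_E.
  rewrite (GE w t wE st) -ge0_integralZl.
  - by apply: eq_integral => x _; rewrite /phi/= -dual_processE -EFinM.
  - by [].
  - apply/measurable_EFinP; apply: measurableT_comp => //; apply: measurable_funM => //.
    apply: measurableT_comp => //; apply: measurable_funB => //.
  - by move=> x _; rewrite lee_fin.
  - by rewrite lee_fin expR_ge0.
rewrite -(@fubini_tonelli _ _ _ _ _ P mu G mG G0).
rewrite [RHS]integral_mkcond; apply: eq_integral => w _.
rewrite patchE; case: ifPn => wE; last first.
  by apply: integral0_eq => t _; rewrite G_E.
rewrite -(resolvent_green th0 n12 n1D2 n1M2 mf f0 (dual_process_gt0 s w)).
rewrite (@ge0_integral_lebesgue_shift _ _ s)//; last first.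
  exact: (measurableT_comp mG (pair1_measurable w)).
rewrite -ge0_integralZl//.
- rewrite [RHS]integral_mkcond; apply: eq_integral => t _.
  rewrite patchE DE; case: ifPn => t0; last by rewrite G_S// SE ltrDr.
  rewrite GE// ?ltrDr// /N addrK muleA -EFinM -expRD.
  by congr ((expR _)%:E * _)%E; ring.
(* Measurability in t is again read off from [G], after the discount up to time s is undone by
   [expR (rho * s)]. *)
- have : measurable_fun (D : set (measurableTypeR R))
      (fun t : measurableTypeR R => (expR (rho * s))%:E * G (w, (t + s)%R))%E.
    apply: measurable_funTS; apply: emeasurable_funM => //.
    apply: (measurableT_comp mG); apply/measurable_fun_pairP; split.
      exact: measurable_cst.
    exact: measurable_funD.
  apply: eq_measurable_fun => t; rewrite DE => t0.
  rewrite GE// ?ltrDr// /N addrK muleA -EFinM -expRD.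
  by congr ((expR _)%:E * _)%E; ring.
- move=> t _; apply: mule_ge0; first by rewrite lee_fin expR_ge0.
  by apply: integral_ge0 => x _; rewrite lee_fin.
Qed.

End markov.

End brownian.

(** * Conjugates of utility functions *)

Section conjugate.
Context {R : realType}.
Variables (n2 : R) (D : set R) (u : R -> R).
Hypothesis hu : class_Sigma n2 D u.
Local Notation du := (u^`()%classic).

Let D_gt0 (x : R) : 0 < x -> D x.
Proof. by move=> x0; case: (Sigma_dom hu) => ->; rewrite /= in_itv/= andbT// ltW. Qed.

Let u_homo (x y : R) : 0 < x -> x <= y -> u x <= u y.
Proof.
move=> x0; rewrite le_eqVlt => /predU1P[->//|xy].
by apply/ltW/(Sigma_incr hu) => //; apply: D_gt0 => //; exact: lt_trans xy.
Qed.

Let u_slope (c x t : R) : 0 < c -> 0 < x -> 0 < t < 1 ->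
  t * (u x - u c) <= u (c + t * (x - c)) - u c.
Proof.
move=> c0 x0 t01; have [->|xc] := eqVneq x c; first by rewrite !subrr !mulr0 addr0 subrr.
have := Sigma_concave hu (D_gt0 x0) (D_gt0 c0) xc t01 => /ltW.
have -> : c + t * (x - c) = t * x + (1 - t) * c by ring.
lra.
Qed.

(** Concavity compares the slope of the chord from c to x with the difference quotients at c on the
    side of x, and these converge to u'(c). *)
Lemma Sigma_tangent (c x : R) : 0 < c -> 0 < x -> u x <= u c + du c * (x - c).
Proof.
move=> c0 x0; rewrite addrC -lerBlDr.
pose q (h : R) : R := h^-1 *: (u (h + c) - u c).
have cq : cvg (q h @[h --> 0^']).
  have := Sigma_derivable hu c0; rewrite /derivable.
  by under eq_fun do rewrite /= [_ *: 1]mulr1.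
have [cx|xc|->] := ltgtP c x; last by rewrite !subrr mulr0.
- have cq' := cvg_dnbhs_at_right cq.
  have duE : du c = lim (q h @[h --> 0^'+]) by apply/esym/cvg_lim.
  rewrite -ler_pdivrMr ?subr_gt0// duE.
  apply: limr_ge; first exact: (cvgP _ cq').
  near=> h.
  have h0 : 0 < h by near: h; exact: nbhs_right_gt.
  have hxc : h < x - c by near: h; apply: nbhs_right_lt; rewrite subr_gt0.
  have xc0 : 0 < x - c by rewrite subr_gt0.
  have := @u_slope c x (h / (x - c)) c0 x0.
  rewrite divr_gt0//= ltr_pdivrMr// mul1r => /(_ hxc).
  rewrite divfK ?gt_eqF// [c + h]addrC => H.
  by rewrite /q /GRing.scale/= ler_pdivlMl// mulrA; move: H; rewrite mulrAC.
- have cq' := cvg_dnbhs_at_left cq.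
  have duE : du c = lim (q h @[h --> 0^'-]) by apply/esym/cvg_lim.
  have xc0 : x - c < 0 by rewrite subr_lt0.
  rewrite -ler_ndivlMr// duE.
  apply: limr_le; first exact: (cvgP _ cq').
  near=> h.
  have h0 : h < 0 by near: h; exact: nbhs_left_lt.
  have hxc : x - c < h by near: h; apply: nbhs_left_gt.
  have := @u_slope c x (h / (x - c)) c0 x0.
  rewrite ltr_ndivrMr// mul1r hxc andbT nmulr_rgt0// invr_lt0 => /(_ xc0).
  rewrite divfK ?lt_eqF// [c + h]addrC => H.
  by rewrite /q /GRing.scale/= ler_ndivrMl// mulrA; move: H; rewrite mulrAC.
Unshelve. all: by end_near. Qed.

Lemma Sigma_marginal_homo (c x : R) : 0 < c -> c <= x -> du x <= du c.
Proof.
move=> c0; rewrite le_eqVlt => /predU1P[->//|cx].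
have x0 := lt_trans c0 cx.
have := Sigma_tangent c0 x0; have := Sigma_tangent x0 c0 => h1 h2.
have : (du x - du c) * (x - c) <= 0 by lra.
by rewrite pmulr_lle0 ?subr_gt0// subr_le0.
Qed.

(** Monotonicity makes the limits at 0+ of u' and of u a supremum and an infimum, so that they can
    be compared with pointwise values. *)
Lemma marginal0E : marginal0 u = ereal_sup [set (du c)%:E | c in `]0, +oo[].
Proof.
apply/cvg_lim => //.
apply: (nonincreasing_at_right_cvge (f := EFin \o du) +oo%O) => //.
move=> c x; rewrite !in_itv/= !andbT => c0 x0 cx; rewrite lee_fin.
exact: Sigma_marginal_homo.
Qed.

Lemma util_val0E : util_val u 0 = ereal_inf [set (u c)%:E | c in `]0, +oo[].
Proof.
rewrite /util_val eqxx; apply/cvg_lim => //.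
apply: (nondecreasing_at_right_cvge (f := EFin \o u) +oo%O) => //.
move=> c x; rewrite !in_itv/= !andbT => c0 x0 cx; rewrite lee_fin.
exact: u_homo.
Qed.

Lemma util_valE (c : R) : 0 < c -> util_val u c = (u c)%:E.
Proof. by move=> c0; rewrite /util_val gt_eqF. Qed.

(** The supremum provides a point where u' > y, the limit at infinity a later one where u' <= y, and
    the intermediate value theorem a point between. *)
Lemma inv_marginal_gt0 (y : R) : 0 < y -> (y%:E < marginal0 u)%E ->
  0 < inv_marginal u y /\ du (inv_marginal u y) = y.
Proof.
move=> y0 ym; rewrite /inv_marginal ym.
suff : exists c, 0 < c /\ du c = y by move=> [c]; apply: (@getI _ [set c | 0 < c /\ du c = y]).
move: ym; rewrite marginal0E => /ereal_sup_gt[_ [c1 /= + <-]].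
rewrite in_itv/= andbT lte_fin => c10 yc1.
have [c2 [c12 c2y]] : exists c2, c1 <= c2 /\ du c2 <= y.
  have := Sigma_marginal_pinfty hu => /cvgrPdist_lt /(_ _ y0) H.
  near (+oo%R : set_system R) => c2; exists c2; split.
    by near: c2; apply: nbhs_pinfty_ge; exact: num_real.
  have : `|0 - du c2| < y by near: c2.
  by rewrite sub0r normrN => /ltW; apply: le_trans; exact: ler_norm.
have [] := @IVT R du c1 c2 y c12.
- apply: continuous_in_subspaceT => c; rewrite inE/= in_itv/= => /andP[c1c _].
  by apply: (Sigma_C1 hu); rewrite in_itv/= andbT (lt_le_trans c10).
- by rewrite ge_min le_max c2y (ltW yc1) orbT.
move=> c; rewrite in_itv/= => /andP[c1c _] dc; exists c; split => //.
exact: lt_le_trans c1c.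
Unshelve. all: by end_near. Qed.

(** If y < u'(0), the tangent at the inverse marginal bounds every competitor. Otherwise u' <= y
    everywhere, the function u(c) - y c is nonincreasing and its supremum is u(0). The second
    conclusion excludes the value -oo, so that [fine] loses nothing. *)
Lemma conjugate_sup (y : R) : 0 < y ->
  [/\ 0 <= inv_marginal u y,
    util_val u (inv_marginal u y) = (fine (util_val u (inv_marginal u y)))%:E &
    ereal_sup [set (util_val u c - (y * c)%:E)%E | c in `[0, +oo[] =
    (fine (util_val u (inv_marginal u y)) - y * inv_marginal u y)%:E].
Proof.
move=> y0.
have [ym|ym] := ltP y%:E (marginal0 u).
  have [I0 dI] := inv_marginal_gt0 y0 ym.
  rewrite !util_valE//=; split => //; first exact: ltW.
  apply/eqP; rewrite eq_le; apply/andP; split; last first.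
    apply: ereal_sup_ubound; exists (inv_marginal u y); last by rewrite util_valE.
    by rewrite /= in_itv/= andbT ltW.
  apply: ge_ereal_sup => _ [c /= + <-]; rewrite in_itv/= andbT le_eqVlt => /predU1P[<-|c0].
    (* For c = 0 the value is the infimum of u, hence at most u(e / y), and the tangent bound there
       exceeds the maximum by exactly e. *)
    rewrite mulr0 sube0 util_val0E.
    apply/lee_addgt0Pr => e e0.
    apply: (@le_trans _ _ (u (e / y))%:E).
      by apply: ereal_inf_lbound; exists (e / y) => //; rewrite /= in_itv/= andbT divr_gt0.
    rewrite lee_fin; have := Sigma_tangent I0 (divr_gt0 e0 y0).
    have ey : y * (e / y) = e by rewrite mulrC divfK ?gt_eqF.
    rewrite dI mulrBr ey; lra.
  rewrite util_valE// lee_fin; have := Sigma_tangent I0 c0; rewrite dI; lra.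
have I0 : inv_marginal u y = 0 by rewrite /inv_marginal ltNge ym.
have dy c : 0 < c -> du c <= y.
  move=> c0; rewrite -lee_fin (le_trans _ ym)// marginal0E.
  by apply: ereal_sup_ubound; exists c => //; rewrite /= in_itv/= andbT.
(* As u' <= y, u cannot fall by more than y between 1 and 0. *)
have u0fin : util_val u 0 \is a fin_num.
  rewrite fin_numElt; apply/andP; split.
    apply: (@lt_le_trans _ _ (u 1 - y)%:E); first exact: ltNyr.
    rewrite util_val0E; apply: le_ereal_inf_tmp => _ [x /= + <-].
    rewrite in_itv/= andbT => x0; rewrite lee_fin.
    have [x1|x1] := leP 1 x.
      by apply: le_trans (u_homo ltr01 x1); rewrite lerBlDr lerDl ltW.
    have := Sigma_tangent x0 ltr01.
    have : du x * (1 - x) <= y * (1 - x) by rewrite ler_wpM2r ?subr_ge0 ?(ltW x1)// dy.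
    have : 0 < y * x by rewrite mulr_gt0.
    lra.
  apply: (@le_lt_trans _ _ (u 1)%:E); last exact: ltry.
  by rewrite util_val0E; apply: ereal_inf_lbound; exists 1 => //; rewrite /= in_itv/= andbT.
rewrite I0; split => //; first by rewrite fineK.
rewrite mulr0 subr0 fineK//.
apply/eqP; rewrite eq_le; apply/andP; split; last first.
  apply: ereal_sup_ubound; exists 0; last by rewrite mulr0 sube0.
  by rewrite /= in_itv/= lexx.
apply: ge_ereal_sup => _ [c /= + <-]; rewrite in_itv/= andbT le_eqVlt => /predU1P[<-|c0].
  by rewrite mulr0 sube0.
rewrite util_val0E util_valE//; apply: le_ereal_inf_tmp => _ [x /= + <-].
rewrite in_itv/= andbT => x0; rewrite lee_fin.
have [cx|xc] := leP c x.
  by rewrite lerBlDr (le_trans (u_homo c0 cx))// lerDl mulr_ge0// ltW.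
have := Sigma_tangent x0 c0.
have : du x * (c - x) <= y * (c - x) by rewrite ler_wpM2r ?subr_ge0 ?(ltW xc)// dy.
have : 0 < y * x by rewrite mulr_gt0.
lra.
Qed.

Lemma conjugateE (y : R) : 0 < y ->
  conjugate u y = fine (util_val u (inv_marginal u y)) - y * inv_marginal u y.
Proof. by move=> y0; rewrite /conjugate; have [_ _ ->] := conjugate_sup y0. Qed.

Lemma conjugate_ge (y z : R) : 0 < y -> 0 < z ->
  fine (util_val u (inv_marginal u y)) - z * inv_marginal u y <= conjugate u z.
Proof.
move=> y0 z0; have [I0 vE _] := conjugate_sup y0.
have [_ _ sE] := conjugate_sup z0.
rewrite -lee_fin /conjugate sE/= -sE; apply: ereal_sup_ubound.
exists (inv_marginal u y); first by rewrite /= in_itv/= I0.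
by rewrite vE EFinB.
Qed.

End conjugate.

(* Subgradient inequalities at both end points stand in for the derivative of
   [phi]: over n equal steps their errors telescope to
   [(s p - s q) * (q - p) / n]. *)
Lemma ler_telescope_vanishing {R : realType} (phi s : R -> R) (p q : R) : p <= q ->
  (forall a b, p <= a -> a < b -> b <= q -> phi b - phi a <= (s a - s b) * (b - a)) ->
  phi q <= phi p.
Proof.
rewrite le_eqVlt => /predU1P[->//|pq H].
have key (n : nat) : phi q - phi p <= (s p - s q) * (q - p) / n.+1%:R.
  pose dl := (q - p) / n.+1%:R.
  have dl0 : 0 < dl by rewrite divr_gt0// subr_gt0.
  pose x (i : nat) : R := p + i%:R * dl.
  have xS i : x i.+1 = x i + dl by rewrite /x -addn1 natrD mulrDl mul1r addrA.
  have x0 : x 0%N = p by rewrite /x mul0r addr0.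
  have xn : x n.+1 = q by rewrite /x /dl mulrC divfK ?pnatr_eq0// addrC subrK.
  have px i : p <= x i by rewrite /x lerDl mulr_ge0// ltW.
  have xq i : (i < n.+1)%N -> x i.+1 <= q.
    by move=> ?; rewrite -xn /x lerD2l ler_pM2r// ler_nat.
  have -> : phi q - phi p = \sum_(0 <= i < n.+1) (phi (x i.+1) - phi (x i)).
    by rewrite (telescope_sumr (phi \o x)) //= xn x0.
  have -> : (s p - s q) * (q - p) / n.+1%:R =
      \sum_(0 <= i < n.+1) ((s (x i) - s (x i.+1)) * dl).
    rewrite -mulr_suml -mulrA -/dl; congr (_ * _).
    rewrite -[LHS]opprB -x0 -xn -(telescope_sumr (s \o x))//= -sumrN.
    by apply: eq_bigr => i _; rewrite opprB.
  rewrite !big_mkord; apply: ler_sum => i _.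
  have -> : dl = x i.+1 - x i by rewrite xS addrC addKr.
  by apply: H => //; [rewrite xS ltrDl|exact: xq].
rewrite -subr_le0.
set C := (s p - s q) * (q - p) in key.
have cvg0 : C / n.+1%:R @[n --> \oo] --> 0.
  suff : C * harmonic n @[n --> \oo] --> C * 0 by rewrite mulr0.
  by apply: cvgM; [exact: cvg_cst|exact: cvg_harmonic].
rewrite -(cvg_lim _ cvg0)//; apply: limr_ge; first exact: cvgP cvg0.
exact: nearW.
Qed.

(** * Integrals of powers near 0 and near infinity *)

Section power_integrals.
Context {R : realType}.
Notation mu := (@lebesgue_measure R).

Lemma integral_expR_yo (a c : R) : 0 < a ->
  (\int[mu]_(x in `]c, +oo[) (expR (- a * x))%:E = (expR (- a * c) / a)%:E)%E.
Proof.
move=> a0.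
have dE (x : R) : is_derive x 1 (fun x => expR (- a * x)) (- a * expR (- a * x)).
  have d := is_derive1_comp (is_derive_expR _) (is_deriveZ (- a) (is_derive_id x 1)).
  by apply: is_derive_eq d _; rewrite /GRing.scale/= mulr1 mulrC.
pose F (x : R) := - a^-1 * expR (- a * x).
have dF (x : R) : is_derive x 1 F (expR (- a * x)).
  apply: is_derive_eq (is_deriveZ (- a^-1) (dE x)) _.
  by rewrite /GRing.scale/= mulrA mulrNN mulVf ?mul1r// gt_eqF.
have cE : continuous (fun x => expR (- a * x)).
  by move=> x; have [/derivable1_diffP/differentiable_continuous] := dE x.
have cF : continuous F.
  by move=> x; have [/derivable1_diffP/differentiable_continuous] := dF x.
rewrite integral_itv_obnd_cbnd; last first.
  apply/measurable_EFinP; apply: measurable_funTS.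
  exact: continuous_measurable_fun cE.
rewrite (@ge0_continuous_FTC2y _ _ F c 0).
- by rewrite sub0e /F -EFinN; congr EFin; rewrite mulNr opprK mulrC.
- by move=> x _; rewrite expR_ge0.
- exact: continuous_subspaceT.
- suff : F x @[x --> +oo] --> - a^-1 * 0 by rewrite mulr0.
  apply: cvgM; first exact: cvg_cst.
  have -> : (fun x => expR (- a * x)) = (fun x => expR (- x)) \o (fun x => x * a).
    by apply/funext => x /=; congr expR; ring.
  apply: (cvg_comp _ (fun x => expR (- x))); last exact: cvgr_expR.
  by apply: gt0_cvgMly => //; exact: cvg_id.
- by move=> x _; have [] := dF x.
- by apply: cvg_at_right_filter; exact: cF.
- by move=> x _; have [] := dF x; rewrite derive1E.
Qed.

Lemma integral_powR_yo (a y : R) : 0 < a -> 0 < y ->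
  (\int[mu]_(x in `]y, +oo[) (x `^ (- a - 1))%:E = (y `^ (- a) / a)%:E)%E.
Proof.
move=> a0 y0.
pose f (x : R) := (\1_(`]y, +oo[%classic) x * x `^ (- a - 1))%:E.
have mf : measurable_fun [set: R] f.
  apply/measurable_EFinP/measurable_funM; last exact: measurable_powR.
  by apply: measurable_indic; exact: measurable_itv.
have f0 x : (0 <= f x)%E by rewrite lee_fin mulr_ge0// powR_ge0.
have one0 : 1 != 0 :> R by [].
transitivity (\int[mu]_(x in `]0%R, +oo[) f x)%E.
  rewrite [LHS]integral_mkcond [RHS]integral_mkcond; apply: eq_integral => x _.
  rewrite !patchE /f indicE; case: ifPn => [xy|_]; last by rewrite mul0r; case: ifP.
  rewrite ifT ?mul1r//; move: xy; rewrite !inE/= !in_itv/= !andbT; exact: lt_trans.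
rewrite (ge0_integral_expR_affine_neq0 0 one0 mf f0).
have -> : y `^ (- a) = expR (- a * ln y) by rewrite /powR gt_eqF.
rewrite -integral_expR_yo// [RHS]integral_mkcond; apply: eq_integral => x _.
rewrite patchE /f add0r mul1r normr1 mul1r.
have -> : (x \in `]ln y, +oo[%classic) = (expR x \in `]y, +oo[%classic).
  have xy : (ln y < x) = (y < expR x) by rewrite -{2}(lnK y0) ltr_expR.
  by apply/idP/idP; rewrite !inE/= !in_itv/= !andbT xy.
rewrite indicE; case: ifPn => _; last by rewrite mul0r mul0e.
rewrite mul1r -EFinM /powR gt_eqF ?expR_gt0// expRK -expRD; congr (expR _)%:E; ring.
Qed.

Lemma integral_powR_0o (a y : R) : 0 < a -> 0 < y ->
  (\int[mu]_(x in `]0%R, y[) (x `^ (a - 1))%:E = (y `^ a / a)%:E)%E.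
Proof.
move=> a0 y0.
pose f (x : R) := (\1_(`]0, y[%classic) x * x `^ (a - 1))%:E.
have mf : measurable_fun [set: R] f.
  apply/measurable_EFinP/measurable_funM; last exact: measurable_powR.
  by apply: measurable_indic; exact: measurable_itv.
have f0 x : (0 <= f x)%E by rewrite lee_fin mulr_ge0// powR_ge0.
(* With x = exp(-s) the interval []0, y[] becomes a half-line in s, and the exponential integral
   used near infinity applies again. *)
have one0 : -1 != 0 :> R by rewrite oppr_eq0.
transitivity (\int[mu]_(x in `]0%R, +oo[) f x)%E.
  rewrite [LHS]integral_mkcond [RHS]integral_mkcond; apply: eq_integral => x _.
  rewrite !patchE /f indicE; case: ifPn => [xy|_]; last by rewrite mul0r; case: ifP.
  by rewrite ifT ?mul1r//; move: xy; rewrite !inE/= !in_itv/= => /andP[->].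
rewrite (ge0_integral_expR_affine_neq0 0 one0 mf f0).
have -> : y `^ a = expR (- a * - ln y) by rewrite mulrNN /powR gt_eqF.
rewrite -integral_expR_yo// [RHS]integral_mkcond; apply: eq_integral => x _.
rewrite patchE /f add0r mulN1r normrN normr1 mul1r.
have -> : (x \in `](- ln y), +oo[%classic) = (expR (- x) \in `]0, y[%classic).
  have xy : (- ln y < x) = (expR (- x) < y) by rewrite -{2}(lnK y0) ltr_expR ltrNl.
  by apply/idP/idP; rewrite !inE/= !in_itv/= expR_gt0 !andbT xy.
rewrite indicE; case: ifPn => _; last by rewrite mul0r mul0e.
rewrite mul1r -EFinM /powR gt_eqF ?expR_gt0// expRK -expRD; congr (expR _)%:E; ring.
Qed.

End power_integrals.

Lemma measurable_fun_restrict d1 d2 (T1 : measurableType d1) (T2 : measurableType d2)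
    (D : set T1) (f : T1 -> T2) :
  measurable D -> measurable_fun D f -> measurable_fun [set: T1] (f \_ D).
Proof. by move=> mD; have [] := measurable_restrictT f mD. Qed.

(** Composing with exp turns monotonicity on the half-line into monotonicity on the whole line. *)
Lemma nonincreasing_gt0_measurable {R : realType} (f : R -> R) :
  (forall x y, 0 < x -> x <= y -> f y <= f x) ->
  measurable_fun (`]0, +oo[%classic : set R) f.
Proof.
move=> fH.
have : measurable_fun (`]0, +oo[%classic : set R) ((f \o expR) \o (@ln R)).
  apply: measurable_funTS; apply: measurableT_comp => //.
  apply: nonincreasing_measurable => // x y xy /=.
  by apply: fH; [exact: expR_gt0|rewrite ler_expR].
apply: eq_measurable_fun => x; rewrite inE/= in_itv/= andbT => x0.
by rewrite lnK.
Qed.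

(** * Integrability of the conjugates *)

Section conjugate_integrable.
Context {R : realType}.
Notation mu := (@lebesgue_measure R).
Variables (n2 : R) (D : set R) (u : R -> R).
Hypothesis hu : class_Sigma n2 D u.
Local Notation I := (inv_marginal u).
Local Notation c := (conjugate u).

Lemma inv_marginal_ge0 (y : R) : 0 < y -> 0 <= I y.
Proof. by move=> /(conjugate_sup hu)[]. Qed.

(** The point [I y] is a competitor in the supremum at z, so [- I y] is a subgradient at y. This
    replaces the derivative of the conjugate; the monotonicity of [c] and of [I] follows. *)
Lemma conjugate_subgradient (y z : R) : 0 < y -> 0 < z ->
  c y - (z - y) * I y <= c z.
Proof.
by move=> y0 z0; have := conjugate_ge hu y0 z0; rewrite (conjugateE hu y0); lra.
Qed.

Lemma conjugate_homo (y z : R) : 0 < y -> y <= z -> c z <= c y.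
Proof.
move=> y0 yz; have z0 := lt_le_trans y0 yz.
apply: le_trans (conjugate_subgradient z0 y0).
by rewrite lerBrDr gerDl mulr_le0_ge0 ?subr_le0// inv_marginal_ge0.
Qed.

Lemma inv_marginal_homo (y z : R) : 0 < y -> y <= z -> I z <= I y.
Proof.
move=> y0; rewrite le_eqVlt => /predU1P[->//|yz]; have z0 := lt_trans y0 yz.
have := conjugate_subgradient y0 z0; have := conjugate_subgradient z0 y0 => h1 h2.
have : 0 <= (z - y) * (I y - I z) by lra.
by rewrite pmulr_rge0 ?subr_gt0// subr_ge0.
Qed.

(** A lower bound affine in z: with the upper bound from monotonicity it controls the growth of the
    conjugate at infinity. *)
Lemma conjugate_lb (y z : R) : 0 < y -> 0 < z -> - (`|c y + y * I y| + z * I y) <= c z.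
Proof.
move=> y0 z0; apply: le_trans (conjugate_subgradient y0 z0).
have := ler_norm (- (c y + y * I y)); rewrite normrN; lra.
Qed.

Lemma measurable_conjugate : measurable_fun (`]0, +oo[%classic : set R) c.
Proof. exact: nonincreasing_gt0_measurable conjugate_homo. Qed.

Lemma measurable_inv_marginal : measurable_fun (`]0, +oo[%classic : set R) I.
Proof. exact: nonincreasing_gt0_measurable inv_marginal_homo. Qed.

(** Integrated form of the subgradient inequality, by the vanishing of the telescoped errors for
    [W - c]: on [a, b] monotonicity bounds the integral of [I] below by I(b) (b - a), and the
    subgradient at a bounds c(a) - c(b) above by I(a) (b - a). *)
Lemma conjugate_le_integral (nu y : R) : 0 < nu -> nu <= y ->
  ((c nu - c y)%:E <= \int[mu]_(x in `]nu, y]) (I x)%:E)%E.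
Proof.
move=> nu0 nuy.
have iI a : nu <= a -> mu.-integrable `]a, y]%classic (EFin \o I).
  move=> nua; apply/integrableP; split.
    apply/measurable_EFinP; apply: measurable_funS measurable_inv_marginal => //.
    by move=> x /=; rewrite !in_itv/= andbT => /andP[ax _]; exact: lt_trans (lt_le_trans nu0 nua) ax.
  have sub : `]a, y]%classic `<=` `]0, +oo[%classic.
    by move=> x /=; rewrite !in_itv/= andbT => /andP[ax _]; exact: lt_trans (lt_le_trans nu0 nua) ax.
  apply: (@le_lt_trans _ _ (\int[mu]_(x in `]a, y]) (I nu)%:E)%E).
    apply: ge0_le_integral => //.
    - apply/measurable_EFinP; apply: measurableT_comp => //.
      exact: measurable_funS measurable_inv_marginal.
    - move=> x /= xa; have x0 : 0 < x by have := sub _ xa; rewrite /= in_itv/= andbT.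
      rewrite lee_fin ger0_norm ?inv_marginal_ge0// inv_marginal_homo//.
      by move: xa; rewrite in_itv/= => /andP[/ltW + _]; exact: le_trans.
  rewrite integral_cst//= lebesgue_measure_itv/= lte_fin.
  by case: ifP => _; rewrite ?mule0// -EFinB -EFinM ltry.
pose W (b : R) : R := \int[mu]_(x in `]b, y]) I x.
have := @ler_telescope_vanishing R (fun b => W b - c b) I nu y nuy.
have Wy : W y = 0 by rewrite /W set_itv_ge ?Rintegral_set0// bnd_simp ltxx.
rewrite Wy sub0r => H.
suff : c nu - c y <= W nu.
  by rewrite -lee_fin /W /Rintegral fineK//; apply: integrable_fin_num => //; exact: iI.
suff /H : forall a b, nu <= a -> a < b -> b <= y ->
   W b - c b - (W a - c a) <= (I a - I b) * (b - a) by lra.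
move=> a b nua ab b_y.
have a0 := lt_le_trans nu0 nua.
have b0 := lt_trans a0 ab.
have := conjugate_subgradient a0 b0.
suff : I b * (b - a) <= W a - W b by lra.
have HW : W a - \int[mu]_(t in `]a, b]) I t = W b.
  by apply: (Rintegral_itvB (iI a nua)); rewrite bnd_simp ?(ltW ab).
have -> : W a - W b = \int[mu]_(t in `]a, b]) I t by rewrite -HW; lra.
have -> : I b * (b - a) = \int[mu]_(x in `]a, b]) cst (I b) x.
  rewrite Rintegral_cst//= lebesgue_measure_itv/= lte_fin ab; congr (_ * _).
apply: le_Rintegral => //.
- apply/integrableP; split; first by apply/measurable_EFinP; exact: measurable_cst.
  by rewrite /= integral_cst//= lebesgue_measure_itv/= lte_fin ab -EFinB -EFinM ltry.
- apply: integrableS (iI a nua) => //.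
  by apply: subset_itvl; rewrite bnd_simp.
- move=> x; rewrite /= in_itv/= => /andP[ax xb].
  by apply: inv_marginal_homo => //; exact: lt_trans ax.
Qed.

Hypothesis n20 : n2 < 0.

Lemma integrable_powR_0o (a y : R) : 0 < a -> 0 < y ->
  mu.-integrable (`]0, y[%classic : set R) (EFin \o (fun nu : R => nu `^ (a - 1))).
Proof.
move=> a0 y0; apply/integrableP; split.
  apply/measurable_EFinP; apply: measurable_funTS; exact: measurable_powR.
under eq_integral do rewrite /= ger0_norm ?powR_ge0//.
by rewrite integral_powR_0o// ltry.
Qed.

Lemma integrable_powR_yo (a y : R) : 0 < a -> 0 < y ->
  mu.-integrable (`]y, +oo[%classic : set R) (EFin \o (fun nu : R => nu `^ (- a - 1))).
Proof.
move=> a0 y0; apply/integrableP; split.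
  apply/measurable_EFinP; apply: measurable_funTS; exact: measurable_powR.
under eq_integral do rewrite /= ger0_norm ?powR_ge0//.
by rewrite integral_powR_yo// ltry.
Qed.

(** The constant [c y] is split off. What remains is nonnegative and at most the integral of [I]
    over []nu, y]]; after an exchange of integrals nu^(-n2-1) integrates to eta^(-n2) / (-n2), and
    condition (ii) of the class Sigma appears. *)
Lemma integrable_conjugate_0o (y : R) : 0 < y ->
  mu.-integrable (`]0, y[%classic : set R) (EFin \o (fun nu : R => nu `^ (- n2 - 1) * c nu)).
Proof.
move=> y0.
have k0 : 0 < - n2 by rewrite oppr_gt0.
have sub : (`]0, y[%classic : set R) `<=` `]0, +oo[%classic.
  by move=> x /=; rewrite !in_itv/= => /andP[->].
have mpw a (A : set (measurableTypeR R)) : measurable_fun A (fun x : R => x `^ a).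
  by apply: measurable_funTS; exact: measurable_powR.
have -> : EFin \o (fun nu : R => nu `^ (- n2 - 1) * c nu) =
    (fun nu : R => (nu `^ (- n2 - 1) * (c nu - c y))%:E) \+ (fun nu => (c y)%:E * (nu `^ (- n2 - 1))%:E)%E.
  by apply/funext => nu; rewrite /= -EFinM -EFinD; congr EFin; ring.
apply: integrableD => //; last by apply: integrableZl => //; exact: integrable_powR_0o.
apply/integrableP; split.
  apply/measurable_EFinP; apply: measurable_funM => //; apply: measurable_funB => //.
  exact: measurable_funS measurable_conjugate.
pose DI : set R := `]0, +oo[%classic.
have mDI : measurable (DI : set (measurableTypeR R)) by exact: measurable_itv.
have DIE (x : R) : (x \in DI) = (0 < x) by apply/idP/idP; rewrite inE /DI/= in_itv/= andbT.
pose Ip : measurableTypeR R -> R := I \_ DI.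
have mIp : measurable_fun [set: measurableTypeR R] Ip.
  exact: measurable_fun_restrict mDI measurable_inv_marginal.
have Ip0 x : 0 <= Ip x.
  rewrite /Ip patchE DIE; case: ifPn => //.
  exact: inv_marginal_ge0.
(* The three indicators describe the triangle 0 < nu < eta < y. *)
pose F (ne : measurableTypeR R * measurableTypeR R) : \bar R :=
  (\1_DI ne.1 * \1_DI (ne.2 - ne.1) * \1_DI (y - ne.2) * (ne.1 `^ (- n2 - 1) * Ip ne.2))%:E.
have F0 ne : (0 <= F ne)%E by rewrite lee_fin !mulr_ge0 ?powR_ge0.
have m1 := @measurable_fst _ _ (measurableTypeR R) (measurableTypeR R).
have m2 := @measurable_snd _ _ (measurableTypeR R) (measurableTypeR R).
have mF : measurable_fun [set: measurableTypeR R * measurableTypeR R] F.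
  apply/measurable_EFinP; apply: measurable_funM; last first.
    apply: measurable_funM; first exact: (measurableT_comp (measurable_powR _) m1).
    exact: (measurableT_comp mIp m2).
  have mi : measurable_fun [set: measurableTypeR R] (\1_DI : _ -> R) by exact: measurable_indic.
  apply: measurable_funM; first apply: measurable_funM.
  - exact: (measurableT_comp mi m1).
  - by apply: (measurableT_comp mi); apply: measurable_funB.
  - by apply: (measurableT_comp mi); apply: measurable_funB.
apply: (@le_lt_trans _ _ (\int[mu]_nu \int[mu]_eta F (nu, eta))%E).
  rewrite integral_mkcond; apply: ge0_le_integral => //.
  - by move=> nu _; rewrite patchE; case: ifP.
  - apply: measurable_fun_restrict; first exact: measurable_itv.
    apply/measurable_EFinP; apply: measurableT_comp => //.
    apply: measurable_funM => //; apply: measurable_funB => //.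
    exact: measurable_funS measurable_conjugate.
  - exact: measurable_fun_fubini_tonelli_F.
  - move=> nu _; rewrite patchE; case: ifPn; last first.
      by move=> _; apply: integral_ge0 => eta _.
    rewrite inE/= in_itv/= => /andP[nu0 nuy].
    rewrite ger0_norm; last first.
      by rewrite mulr_ge0 ?powR_ge0// subr_ge0 conjugate_homo// ltW.
    have sub2 : (`]nu, y[%classic : set R) `<=` `]0, +oo[%classic.
      by move=> x /=; rewrite !in_itv/= andbT => /andP[+ _]; exact: lt_trans.
    have mI2 : measurable_fun (`]nu, y[%classic : set R) (fun x => (I x)%:E).
      by apply/measurable_EFinP; exact: measurable_funS measurable_inv_marginal.
    rewrite EFinM.
    apply: (@le_trans _ _ ((nu `^ (- n2 - 1))%:E * \int[mu]_(x in `]nu, y[) (I x)%:E)%E).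
      rewrite integral_itv_bndo_bndc//.
      by apply: lee_wpmul2l; [rewrite lee_fin powR_ge0|rewrite conjugate_le_integral// ltW].
    rewrite -ge0_integralZl//; last first.
    - by rewrite lee_fin powR_ge0.
    - move=> x; rewrite /= in_itv/= => /andP[nux _]; rewrite lee_fin inv_marginal_ge0//.
      exact: lt_trans nux.
    rewrite integral_mkcond; apply: ge0_le_integral => //.
    - move=> x _; rewrite patchE; case: ifPn => //.
      rewrite inE/= in_itv/= => /andP[nux _]; rewrite -EFinM lee_fin mulr_ge0 ?powR_ge0//.
      by rewrite inv_marginal_ge0//; exact: lt_trans nux.
    - apply: measurable_fun_restrict; first exact: measurable_itv.
      exact: emeasurable_funM.
    - exact: (measurableT_comp mF (pair1_measurable (nu : measurableTypeR R))).
    - move=> x _; rewrite patchE; case: ifPn => // xin.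
      have := xin; rewrite inE/= in_itv/= => /andP[nux xy].
      rewrite /F /= !indicE !DIE nu0 !subr_gt0 nux xy !mul1r /Ip patchE DIE.
      by rewrite (lt_trans nu0 nux) EFinM.
rewrite (@fubini_tonelli _ _ (measurableTypeR R) (measurableTypeR R) R mu mu F)//.
have Sy := Sigma_integrable hu y0.
have k00 : 0 <= (- n2)^-1 by rewrite invr_ge0 ltW.
apply: (@le_lt_trans _ _ ((- n2)^-1%:E * \int[mu]_(eta in `]0%R, y[) (eta `^ (- n2) * I eta)%:E)%E); last first.
  have : (0 <= \int[mu]_(eta in `]0%R, y[) (eta `^ (- n2) * I eta)%:E)%E.
    apply: integral_ge0 => x; rewrite /= in_itv/= => /andP[x0 _].
    by rewrite lee_fin mulr_ge0 ?powR_ge0 ?inv_marginal_ge0.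
  by move=> S0; apply: lte_mul_pinfty.
have mkI : measurable_fun (`]0, y[%classic : set R) (fun x => (x `^ (- n2) * I x)%:E).
  apply/measurable_EFinP; apply: measurable_funM.
    by apply: measurable_funTS; exact: measurable_powR.
  exact: measurable_funS measurable_inv_marginal.
rewrite -ge0_integralZl//; last first.
  move=> x; rewrite /= in_itv/= => /andP[x0 _].
  by rewrite lee_fin mulr_ge0 ?powR_ge0 ?inv_marginal_ge0.
rewrite [leRHS]integral_mkcond; apply: ge0_le_integral => //.
- by move=> x _; exact: integral_ge0.
- exact: measurable_fun_fubini_tonelli_G.
- apply: measurable_fun_restrict; first exact: measurable_itv.
  exact: emeasurable_funM.
- move=> eta _; rewrite patchE.
  have [|etaN] := boolP (eta \in `]0%R, y[%classic); last first.
    rewrite integral0_eq// => x _; rewrite /F/= !indicE !DIE !subr_gt0.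
    have [x0|x0] := ltP 0 x; last by rewrite !mul0r.
    have [xe|xe] := ltP x eta; last by rewrite mulr0 !mul0r.
    have [ey|ey] := ltP eta y; last by rewrite mulr0 mul0r.
    by move: etaN; rewrite notin_setE/= in_itv/= (lt_trans x0 xe) ey.
  rewrite inE/= in_itv/= => /andP[e0 ey].
  apply: (@le_trans _ _ ((I eta)%:E * \int[mu]_(x in `]0%R, eta[) (x `^ (- n2 - 1))%:E)%E).
    rewrite -ge0_integralZl//; last first.
    - by rewrite lee_fin inv_marginal_ge0.
    - by move=> x _; rewrite lee_fin powR_ge0.
    - by apply/measurable_EFinP.
    rewrite [leRHS]integral_mkcond; apply: ge0_le_integral => //.
    - exact: (measurableT_comp mF (pair2_measurable (eta : measurableTypeR R))).
    - apply: measurable_fun_restrict; first exact: measurable_itv.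
      by apply: emeasurable_funM => //; apply/measurable_EFinP.
    - move=> x _; rewrite patchE /F/= !indicE !DIE !subr_gt0 ey mulr1.
      have [x0|x0] := ltP 0 x; last by rewrite !mul0r; case: ifP => // _; rewrite -EFinM lee_fin mulr_ge0 ?powR_ge0// inv_marginal_ge0.
      have [xe|xe] := ltP x eta; last by rewrite mulr0 !mul0r; case: ifP => // _; rewrite -EFinM lee_fin mulr_ge0 ?powR_ge0// inv_marginal_ge0.
      rewrite mem_set/= ?in_itv/= ?x0// !mul1r /Ip patchE DIE e0 mulrC EFinM; exact: lexx.
  rewrite integral_powR_0o// -!EFinM lee_fin.
  by rewrite mulrC -mulrA mulrCA [leRHS]mulrCA mulrA; lra.
Qed.

(** Beyond y the conjugate is at most affine in absolute value. Its linear part contributes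
    nu^(-n1), which is why n1 must exceed 1. *)
Lemma integrable_conjugate_yo (n1 y : R) : 1 < n1 -> 0 < y ->
  mu.-integrable (`]y, +oo[%classic : set R) (EFin \o (fun nu : R => nu `^ (- n1 - 1) * c nu)).
Proof.
move=> n11 y0.
have n10 : 0 < n1 by exact: lt_trans n11.
have n1p : 0 < n1 - 1 by rewrite subr_gt0.
have sub : (`]y, +oo[%classic : set R) `<=` `]0, +oo[%classic.
  by move=> x /=; rewrite !in_itv/= !andbT; exact: lt_trans.
pose C := `|c y| + `|c y + y * I y|.
apply: (@le_integrable _ _ _ mu _ (measurable_itv _) _
   ((fun nu => C%:E * (nu `^ (- n1 - 1))%:E) \+ (fun nu => (I y)%:E * (nu `^ (- (n1 - 1) - 1))%:E))%E).
- apply/measurable_EFinP; apply: measurable_funM.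
    by apply: measurable_funTS; exact: measurable_powR.
  exact: measurable_funS measurable_conjugate.
- move=> nu; rewrite /= in_itv/= andbT => ynu; have nu0 := lt_trans y0 ynu.
  have Iy0 := inv_marginal_ge0 y0.
  rewrite /= lee_fin [leRHS]ger0_norm; last first.
    by rewrite addr_ge0// mulr_ge0 ?powR_ge0// addr_ge0.
  have -> : nu `^ (- (n1 - 1) - 1) = nu * nu `^ (- n1 - 1).
    rewrite -{2}(powRr1 (ltW nu0)) -powRD; last by rewrite (gt_eqF nu0) implybT.
    by congr (_ `^ _); ring.
  rewrite normrM (ger0_norm (powR_ge0 _ _)) [leRHS](_ : _ = nu `^ (- n1 - 1) * (C + nu * I y)); last by ring.
  rewrite ler_wpM2l ?powR_ge0//.
  have h1 := conjugate_homo y0 (ltW ynu).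
  have h2 := conjugate_lb y0 nu0.
  rewrite ler_norml /C; apply/andP; split.
    have := normr_ge0 (c y); move: h2; lra.
  have := ler_norm (c y); have := normr_ge0 (c y + y * I y).
  have : 0 <= nu * I y by rewrite mulr_ge0// ltW.
  move: h1; lra.
- apply: integrableD => //; apply: integrableZl => //; exact: integrable_powR_yo.
Qed.

End conjugate_integrable.

(** * Green kernel and continuation value *)

Lemma integrable_disjoint_setU d (T : measurableType d) (R : realType)
    (mu : {measure set T -> \bar R}) (A B : set T) (f : T -> \bar R) :
  measurable A -> measurable B -> [disjoint A & B] ->
  mu.-integrable A f -> mu.-integrable B f -> mu.-integrable (A `|` B) f.
Proof.
move=> mA mB AB /integrableP[mfA iA] /integrableP[mfB iB].
have mf : measurable_fun (A `|` B) f by apply/measurable_funU.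
apply/integrableP; split => //.
rewrite ge0_integral_setU//; first exact: lte_add_pinfty.
exact: measurableT_comp.
Qed.

Section green_integrals.
Context {R : realType}.
Notation mu := (@lebesgue_measure R).
Variables (th n1 n2 : R).
Hypotheses (th0 : th != 0) (n12 : n2 < n1).
Let K := 2 / (th ^+ 2 * (n1 - n2)).
Local Notation G := (green th n1 n2).

Lemma green_coef_gt0 : 0 < K.
Proof. by rewrite divr_gt0// mulr_gt0 ?subr_gt0// exprn_even_gt0. Qed.

Let powRE (x a : R) : 0 < x -> x `^ a = expR (a * ln x).
Proof. by move=> x0; rewrite /powR gt_eqF. Qed.

Let powRB1 (x a : R) : 0 < x -> x `^ (- a - 1) = expR (- a * ln x) / x.
Proof.
by move=> x0; rewrite powRE// mulrBl mul1r expRD expRN lnK.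
Qed.

Lemma green_ge (y nu : R) : 0 < y -> y <= nu -> G y nu = K * y `^ n1 * nu `^ (- n1 - 1).
Proof.
move=> y0 ynu; have nu0 := lt_le_trans y0 ynu.
rewrite /green ltNge ynu/= -/K powRB1// powRE// -mulrA; congr (K * _).
by rewrite mulrA -expRD; congr (expR _ / _); ring.
Qed.

Lemma green_le (y nu : R) : 0 < nu -> nu <= y -> G y nu = K * y `^ n2 * nu `^ (- n2 - 1).
Proof.
move=> nu0 nuy; have y0 := lt_le_trans nu0 nuy.
move: nuy; rewrite le_eqVlt => /predU1P[->|nuy].
  (* On the diagonal [green] takes the n1 branch; both branches have the same value there because
     the powers of y cancel. *)
  rewrite green_ge// -!(mulrA K); congr (K * _).
  by rewrite !powRB1// !powRE// !mulrA -!expRD; congr (expR _ / _); ring.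
rewrite /green nuy -/K powRB1// powRE// -mulrA; congr (K * _).
by rewrite mulrA -expRD; congr (expR _ / _); ring.
Qed.

Lemma green_nonneg (y nu : R) : 0 < nu -> 0 <= G y nu.
Proof.
by move=> nu0; rewrite mulr_ge0 ?(ltW green_coef_gt0)// divr_ge0 ?expR_ge0// ltW.
Qed.

Section integrable_green.
Variables (f : R -> R) (y : R).
Hypotheses (y0 : 0 < y) (mf : measurable_fun (`]0, +oo[%classic : set R) f)
  (f0y : mu.-integrable (`]0, y[%classic : set R) (EFin \o (fun nu => nu `^ (- n2 - 1) * f nu)))
  (fyo : mu.-integrable (`]y, +oo[%classic : set R) (EFin \o (fun nu => nu `^ (- n1 - 1) * f nu))).

Let mfG (A : set R) : measurable A -> A `<=` `]0, +oo[ ->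
  measurable_fun A (fun nu => f nu * G y nu).
Proof.
move=> mA AD; apply: measurable_funM; first exact: measurable_funS mf.
by apply: measurable_funTS; exact: measurable_green.
Qed.

Lemma integrable_green : mu.-integrable (`]0, +oo[%classic : set R) (EFin \o (fun nu => f nu * G y nu)).
Proof.
have sub1 : (`]0, y]%classic : set R) `<=` `]0, +oo[ by apply: subset_itvl; rewrite bnd_simp.
have sub2 : (`]y, +oo[%classic : set R) `<=` `]0, +oo[.
  by apply: subset_itvr; rewrite bnd_simp ltW.
have i1 : mu.-integrable (`]0, y]%classic : set R) (EFin \o (fun nu => f nu * G y nu)).
  have : mu.-integrable (`]0, y[%classic : set R)
      (fun nu => ((K * y `^ n2)%:E * (nu `^ (- n2 - 1) * f nu)%:E)%E).
    exact: integrableZl.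
  move=> /integrableP[_ H]; apply/integrableP; split.
    by apply/measurable_EFinP; exact: mfG.
  rewrite -integral_itv_bndo_bndc; last first.
    apply/measurable_EFinP; apply: measurableT_comp => //; apply: mfG => //.
    by apply: subset_trans sub1; exact: subset_itvW.
  move: H; congr (_ < _)%E; apply: eq_integral => nu; rewrite inE/= in_itv/= => /andP[nu0 nuy].
  by rewrite green_le ?(ltW nuy)//=; congr (`| _ |%:E); ring.
have i2 : mu.-integrable (`]y, +oo[%classic : set R) (EFin \o (fun nu => f nu * G y nu)).
  have : mu.-integrable (`]y, +oo[%classic : set R)
      (fun nu => ((K * y `^ n1)%:E * (nu `^ (- n1 - 1) * f nu)%:E)%E).
    exact: integrableZl.
  apply: eq_integrable => // nu; rewrite inE/= in_itv/= andbT => ynu.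
  by rewrite green_ge ?(ltW ynu)//= -EFinM; congr EFin; ring.
rewrite (@itv_bndbnd_setU _ _ _ (BRight y))// ?bnd_simp ?(ltW y0)//.
apply: integrable_disjoint_setU => //.
apply/disj_setPS => x [/=]; rewrite !in_itv/= andbT => /andP[_ xy] yx.
by move: (lt_le_trans yx xy); rewrite ltxx.
Qed.

Lemma Xi_green : Xi th n1 n2 f y = \int[mu]_(nu in `]0, +oo[) (f nu * G y nu).
Proof.
have -> : \int[mu]_(nu in `]0, +oo[) (f nu * G y nu) =
   \int[mu]_(nu in `]0, y]) (f nu * G y nu) + \int[mu]_(nu in `]y, +oo[) (f nu * G y nu).
  have := @Rintegral_itvB R (fun nu => f nu * G y nu) (BRight 0) +oo%O y integrable_green.
  rewrite !bnd_simp => /(_ (ltW y0) isT) <-; ring.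
rewrite /Xi -/K mulrDr !mulrA; congr (_ + _).
- rewrite -Rintegral_itv_bndo_bndc; last first.
    by apply: integrableS integrable_green => //; apply: subset_itvl; rewrite bnd_simp.
  rewrite -RintegralZl//; apply: eq_Rintegral => nu; rewrite inE/= in_itv/= => /andP[nu0 nuy].
  by rewrite green_le ?(ltW nuy)//; ring.
- rewrite -RintegralZl//; apply: eq_Rintegral => nu; rewrite inE/= in_itv/= andbT => ynu.
  by rewrite green_ge ?(ltW ynu)//; ring.
Qed.

End integrable_green.

End green_integrals.

(** * The sign of h and the candidate W *)

Section optimal_stopping_function.
Context {R : realType}.
Notation mu := (@lebesgue_measure R).
Variables (uB uA : R -> R) (dB dA : set R) (r rho th n1 n2 eps : R).
Hypotheses (huB : class_Sigma n2 dB uB) (huA : class_Sigma n2 dA uA).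
Hypothesis huBA : forall y : R, 0 < y ->
  (util_val uB (inv_marginal uB y) < util_val uA (inv_marginal uA y))%E.
Local Notation H := (h uB uA eps).

(** In the variable x = 1/y, x times the conjugate at 1/x is sup_c (x u(c) - c), convex in x with
    subgradient u(I(1/x)). The difference for u_B and u_A thus has slope u_B(I_B) - u_A(I_A) < 0 in
    x, and decreasing in 1/y means increasing in y. *)
Lemma Psi_homo (y z : R) : 0 < y -> y <= z -> Psi uB uA eps y <= Psi uB uA eps z.
Proof.
move=> y0 yz; have z0 := lt_le_trans y0 yz.
pose vB (y : R) := fine (util_val uB (inv_marginal uB y)).
pose vA (y : R) := fine (util_val uA (inv_marginal uA y)).
have vBA (x : R) : 0 < x -> vB x < vA x.
  move=> x0; rewrite -lte_fin; have := huBA x0.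
  by have [_ -> _] := conjugate_sup huB x0; have [_ -> _] := conjugate_sup huA x0.
rewrite /Psi lerD2r.
have zy : z^-1 <= y^-1 by rewrite lef_pV2.
have := @ler_telescope_vanishing R
  (fun x => x * (conjugate uB x^-1 - conjugate uA x^-1)) (fun x => - vB x^-1) _ _ zy.
rewrite !invrK; apply => a b za ab by_.
have a0 : 0 < a by apply: lt_le_trans za; rewrite invr_gt0.
have b0 := lt_trans a0 ab.
have ia0 : 0 < a^-1 by rewrite invr_gt0.
have ib0 : 0 < b^-1 by rewrite invr_gt0.
have hB1 : b * conjugate uB b^-1 = b * vB b^-1 - inv_marginal uB b^-1.
  by rewrite (conjugateE huB ib0) mulrBr mulrA divff ?mul1r ?gt_eqF.
have hA1 : a * conjugate uA a^-1 = a * vA a^-1 - inv_marginal uA a^-1.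
  by rewrite (conjugateE huA ia0) mulrBr mulrA divff ?mul1r ?gt_eqF.
have hB2 : a * vB b^-1 - inv_marginal uB b^-1 <= a * conjugate uB a^-1.
  have := ler_wpM2l (ltW a0) (conjugate_ge huB ib0 ia0).
  by rewrite mulrBr mulrA divff ?mul1r ?gt_eqF.
have hA2 : b * vA a^-1 - inv_marginal uA a^-1 <= b * conjugate uA b^-1.
  have := ler_wpM2l (ltW b0) (conjugate_ge huA ia0 ib0).
  by rewrite mulrBr mulrA divff ?mul1r ?gt_eqF.
have ba0 : 0 <= b - a by rewrite subr_ge0 ltW.
have := ler_wpM2r ba0 (ltW (vBA _ ia0)).
rewrite !mulrBr hB1 hA1.
move: (vB a^-1) (vA a^-1) (vB b^-1) hB2 hA2 => ? ? ? ? ?; lra.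
Qed.

Variables (zbar zR : R).
Hypotheses (hzbar : 0 < zbar) (hzbar0 : Psi uB uA eps zbar = 0).

Lemma h_le0 (y : R) : 0 < y -> y <= zbar -> H y <= 0.
Proof.
move=> y0 yz; rewrite /h mulr_ge0_le0 ?(ltW y0)//.
by rewrite -hzbar0 Psi_homo.
Qed.

Lemma h_ge0 (y : R) : zbar <= y -> 0 <= H y.
Proof.
move=> yz; rewrite /h mulr_ge0//; first exact: le_trans (ltW hzbar) yz.
by rewrite -hzbar0 Psi_homo.
Qed.

Lemma hE (y : R) : 0 < y -> H y = conjugate uB y - conjugate uA y + eps * y.
Proof. by move=> y0; rewrite /h /Psi; field; rewrite gt_eqF. Qed.

Lemma measurable_h : measurable_fun (`]0, +oo[%classic : set R) H.
Proof.
have : measurable_fun (`]0, +oo[%classic : set R) (fun y => conjugate uB y - conjugate uA y + eps * y).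
  apply: measurable_funD; last by apply: measurable_funM.
  by apply: measurable_funB; [exact: measurable_conjugate huB|exact: measurable_conjugate huA].
by apply: eq_measurable_fun => y; rewrite inE/= in_itv/= andbT => /hE ->.
Qed.

Hypotheses (th0 : th != 0) (n20 : n2 < 0) (n11 : 1 < n1).

Let n12 : n2 < n1. Proof. exact: lt_trans (lt_trans n20 ltr01) n11. Qed.

Lemma integrable_id_0o (y : R) : 0 < y ->
  mu.-integrable (`]0, y[%classic : set R) (EFin \o (fun nu : R => nu `^ (- n2 - 1) * nu)).
Proof.
move=> y0; have k0 : 0 < 1 - n2 by rewrite subr_gt0 (lt_trans n20).
have := integrable_powR_0o k0 y0; apply: eq_integrable => // nu.
rewrite inE/= in_itv/= => /andP[nu0 _]; congr EFin.
rewrite -{3}(powRr1 (ltW nu0)) -powRD; last by rewrite (gt_eqF nu0) implybT.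
by congr (_ `^ _); ring.
Qed.

Lemma integrable_id_yo (y : R) : 0 < y ->
  mu.-integrable (`]y, +oo[%classic : set R) (EFin \o (fun nu : R => nu `^ (- n1 - 1) * nu)).
Proof.
move=> y0; have k0 : 0 < n1 - 1 by rewrite subr_gt0.
have := integrable_powR_yo k0 y0; apply: eq_integrable => // nu.
rewrite inE/= in_itv/= andbT => ynu; have nu0 := lt_trans y0 ynu; congr EFin.
rewrite -{3}(powRr1 (ltW nu0)) -powRD; last by rewrite (gt_eqF nu0) implybT.
by congr (_ `^ _); ring.
Qed.

Lemma integrable_h_0o (y : R) : 0 < y ->
  mu.-integrable (`]0, y[%classic : set R) (EFin \o (fun nu : R => nu `^ (- n2 - 1) * H nu)).
Proof.
move=> y0.
have : mu.-integrable (`]0, y[%classic : set R)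
   ((EFin \o (fun nu : R => nu `^ (- n2 - 1) * conjugate uB nu)%R) \-
    (EFin \o (fun nu : R => nu `^ (- n2 - 1) * conjugate uA nu)%R) \+
    (fun nu => eps%:E * (nu `^ (- n2 - 1) * nu)%R%:E))%E.
  apply: integrableD => //; last by apply: integrableZl => //; exact: integrable_id_0o.
  apply: integrableB => //; first exact: integrable_conjugate_0o huB _ _ _.
  exact: integrable_conjugate_0o huA _ _ _.
apply: eq_integrable => // nu; rewrite inE/= in_itv/= => /andP[nu0 _].
by rewrite hE// -EFinM -EFinB -EFinD; congr EFin; ring.
Qed.

Lemma integrable_h_0c (x y : R) : 0 <= x -> 0 < y ->
  mu.-integrable (`]x, y]%classic : set R) (EFin \o (fun nu : R => nu `^ (- n2 - 1) * H nu)).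
Proof.
move=> x0 y0; have y10 : 0 < y + 1 by rewrite addr_gt0.
apply: integrableS (integrable_h_0o y10) => //.
move=> z /=; rewrite !in_itv/= => /andP[xz zy].
by rewrite (le_lt_trans x0)//= (le_lt_trans zy)// ltrDl.
Qed.

Lemma integrable_h_yo (y : R) : 0 < y ->
  mu.-integrable (`]y, +oo[%classic : set R) (EFin \o (fun nu : R => nu `^ (- n1 - 1) * H nu)).
Proof.
move=> y0.
have : mu.-integrable (`]y, +oo[%classic : set R)
   ((EFin \o (fun nu : R => nu `^ (- n1 - 1) * conjugate uB nu)%R) \-
    (EFin \o (fun nu : R => nu `^ (- n1 - 1) * conjugate uA nu)%R) \+
    (fun nu => eps%:E * (nu `^ (- n1 - 1) * nu)%R%:E))%E.
  apply: integrableD => //; last by apply: integrableZl => //; exact: integrable_id_yo.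
  apply: integrableB => //; first exact: (integrable_conjugate_yo huB).
  exact: (integrable_conjugate_yo huA).
apply: eq_integrable => // nu; rewrite inE/= in_itv/= andbT => ynu.
by rewrite hE ?(lt_trans y0)// -EFinM -EFinB -EFinD; congr EFin; ring.
Qed.

Local Notation G := (green th n1 n2).
Let K := 2 / (th ^+ 2 * (n1 - n2)).

Let K0 : 0 < K. Proof. exact: green_coef_gt0. Qed.

Lemma integrable_h_green (y : R) : 0 < y ->
  mu.-integrable (`]0, +oo[%classic : set R) (EFin \o (fun nu => H nu * G y nu)).
Proof.
move=> y0; apply: integrable_green => //.
- exact: measurable_h.
- exact: integrable_h_0o.
- exact: integrable_h_yo.
Qed.

Hypotheses (hzR : 0 < zR < zbar)
  (hzR0 : (\int[mu]_(nu in `]zR, +oo[) (nu `^ (- n1 - 1) * H nu)%:E = 0)%E).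

Let zR0 : 0 < zR. Proof. by case/andP: hzR. Qed.

Let W (y : R) : R := \int[mu]_(nu in `]zR, +oo[) (H nu * G y nu).

Lemma continuation_value_eq0 (y : R) : 0 < y -> y <= zR -> W y = 0.
Proof.
move=> y0 yz.
(* For y <= zR every nu in the domain lies above y, so the n1 branch applies throughout and y^n1
   factors out of the equation for zR. *)
transitivity (\int[mu]_(nu in `]zR, +oo[) (K * y `^ n1 * (nu `^ (- n1 - 1) * H nu))).
  apply: eq_Rintegral => nu; rewrite inE/= in_itv/= andbT => znu.
  by rewrite green_ge// ?(le_trans yz (ltW znu))// -/K; ring.
rewrite RintegralZl//; last exact: integrable_h_yo.
by rewrite /Rintegral hzR0/= mulr0.
Qed.

Let sub_zR (y : R) : (`]zR, y]%classic : set R) `<=` `]zR, +oo[.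
Proof. by apply: subset_itvl; rewrite bnd_simp. Qed.

Let W_split (y : R) : zR <= y -> W y =
  K * y `^ n2 * \int[mu]_(nu in `]zR, y]) (nu `^ (- n2 - 1) * H nu) +
  K * y `^ n1 * \int[mu]_(nu in `]y, +oo[) (nu `^ (- n1 - 1) * H nu).
Proof.
move=> zy; have y0 := lt_le_trans zR0 zy.
have iW : mu.-integrable (`]zR, +oo[%classic : set R) (EFin \o (fun nu => H nu * G y nu)).
  apply: integrableS (integrable_h_green y0) => //.
  by apply: subset_itvr; rewrite bnd_simp ltW.
have -> : W y = \int[mu]_(nu in `]zR, y]) (H nu * G y nu) + \int[mu]_(nu in `]y, +oo[) (H nu * G y nu).
  have <- : W y - \int[mu]_(nu in `]zR, y]) (H nu * G y nu) = \int[mu]_(nu in `]y, +oo[) (H nu * G y nu).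
    by apply: (Rintegral_itvB iW); rewrite bnd_simp.
  ring.
congr (_ + _); rewrite -RintegralZl//.
- apply: eq_Rintegral => nu; rewrite inE/= in_itv/= => /andP[znu nuy].
  by rewrite green_le// ?(lt_trans zR0 znu)// -/K; ring.
- by apply: integrable_h_0c => //; exact: ltW.
- apply: eq_Rintegral => nu; rewrite inE/= in_itv/= andbT => ynu.
  by rewrite green_ge// ?(ltW ynu)// -/K; ring.
- exact: integrable_h_yo.
Qed.

(* Since h changes sign only at zbar, replacing the weight [nu `^ (n1 - n2)] by
   its value at [Num.min y zbar] reduces the claim to the equation for zR. *)
Lemma continuation_value_ge0 (y : R) : 0 < y -> 0 <= W y.
Proof.
move=> y0; have [yz|zy] := leP y zR; first by rewrite continuation_value_eq0.
rewrite W_split ?(ltW zy)//.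
set X1 := \int[mu]_(nu in `]zR, y]) _; set A := \int[mu]_(nu in `]y, +oo[) _.
pose w := n1 - n2; pose m := Num.min y zbar.
have w0 : 0 <= w by rewrite subr_ge0 ltW.
have m0 : 0 < m by rewrite lt_min y0.
have iA := integrable_h_yo zR0.
have AE : \int[mu]_(nu in `]zR, y]) (nu `^ (- n1 - 1) * H nu) = - A.
  have : (\int[mu]_(nu in `]zR, +oo[) (nu `^ (- n1 - 1) * H nu)) -
         \int[mu]_(nu in `]zR, y]) (nu `^ (- n1 - 1) * H nu) = A.
    by apply: (Rintegral_itvB iA); rewrite bnd_simp ?(ltW zy).
  by rewrite {1}/Rintegral hzR0 /= sub0r => <-; rewrite opprK.
(* On []zR, y]] the product of h and nu^w - m^w is nonnegative: for nu <= zbar, h <= 0 and nu <= m;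
   for nu > zbar, h >= 0 and m < nu. *)
have X1A : - (m `^ w * A) <= X1.
  rewrite -mulrN -AE -RintegralZl//; last exact: integrableS iA.
  apply: le_Rintegral => //.
  - have : mu.-integrable (`]zR, y]%classic : set R)
        (fun nu => ((m `^ w)%:E * (nu `^ (- n1 - 1) * H nu)%R%:E)%E).
      by apply: integrableZl => //; exact: integrableS iA.
    exact: eq_integrable.
  - by apply: integrable_h_0c => //; exact: ltW.
  - move=> nu; rewrite /= in_itv/= => /andP[znu nuy].
    have nu0 := lt_trans zR0 znu.
    have -> : nu `^ (- n2 - 1) = nu `^ w * nu `^ (- n1 - 1).
      rewrite -powRD; last by rewrite (gt_eqF nu0) implybT.
      by congr (_ `^ _); rewrite /w; ring.
    rewrite -mulrA.
    have [nz|zn] := leP nu zbar.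
      apply: ler_wnM2r; first by rewrite mulr_ge0_le0 ?powR_ge0// h_le0.
      by rewrite ge0_ler_powR// ?nnegrE ?(ltW nu0) ?(ltW m0)// le_min nuy nz.
    apply: ler_wpM2r; first by rewrite mulr_ge0 ?powR_ge0// h_ge0// ltW.
    rewrite ge0_ler_powR// ?nnegrE ?(ltW nu0) ?(ltW m0)//.
    by rewrite ge_min (ltW zn) orbT.
(* Either y <= zbar and m = y, or y > zbar and the tail integral [A] only sees the region where h >=
   0. *)
have key : 0 <= A * (y `^ w - m `^ w).
  have [yzb|zby] := leP y zbar; first by rewrite /m min_l// subrr mulr0.
  apply: mulr_ge0.
    apply: Rintegral_ge0 => nu; rewrite /= in_itv/= andbT => ynu.
    by rewrite mulr_ge0 ?powR_ge0// h_ge0// ltW// (lt_trans zby).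
  by rewrite subr_ge0 ge0_ler_powR// ?nnegrE ?(ltW y0) ?(ltW m0)// ge_min lexx.
have -> : y `^ n1 = y `^ n2 * y `^ w.
  rewrite -powRD; last by rewrite (gt_eqF y0) implybT.
  by congr (_ `^ _); rewrite /w; ring.
have -> : K * y `^ n2 * X1 + K * (y `^ n2 * y `^ w) * A = K * y `^ n2 * (X1 + y `^ w * A) by ring.
apply: mulr_ge0; first by rewrite mulr_ge0 ?powR_ge0// ltW.
have -> : X1 + y `^ w * A = (X1 + m `^ w * A) + A * (y `^ w - m `^ w) by ring.
by rewrite addr_ge0// -lerBlDr sub0r.
Qed.

(** W lacks the mass of h on []0, zR]]. Below y the kernel takes its n2 branch, so the missing part
    is a multiple of y^n2, and that multiple is -D. *)
Lemma continuation_valueE (y : R) : zR <= y ->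
  W y = coef_D th n1 n2 uB uA eps zR * y `^ n2 + Xi th n1 n2 H y.
Proof.
move=> zy; have y0 := lt_le_trans zR0 zy.
rewrite Xi_green//; last 3 first.
- exact: measurable_h.
- exact: integrable_h_0o.
- exact: integrable_h_yo.
have <- : \int[mu]_(nu in `]0, +oo[) (H nu * G y nu) - \int[mu]_(nu in `]0, zR]) (H nu * G y nu) = W y.
  by apply: (Rintegral_itvB (integrable_h_green y0)); rewrite bnd_simp ?ltW.
rewrite addrC; congr (_ + _).
rewrite /coef_D -/K mulNr mulNr; congr (- _).
rewrite Rintegral_itv_bndo_bndc; last exact: integrable_h_0o.
rewrite mulrAC -RintegralZl//; last by exact: integrable_h_0c.
apply: eq_Rintegral => nu; rewrite inE/= in_itv/= => /andP[nu0 nuz].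
by rewrite green_le// ?(le_trans nuz)// -/K; ring.
Qed.

(** The characteristic polynomial equals -r at 1, which is the hypothesis on (1 - n1)(1 - n2) and
    the origin of eps / r in the theorem. *)
Lemma Xi_idE (y : R) (r0 : 0 < r) : 0 < y ->
  (1 - n1) * (1 - n2) = - (2 * r / th ^+ 2) -> Xi th n1 n2 id y = y / r.
Proof.
move=> y0 nE; rewrite /Xi -/K.
have k1 : 0 < 1 - n2 by rewrite subr_gt0 (lt_trans n20).
have k2 : 0 < n1 - 1 by rewrite subr_gt0.
have -> : \int[mu]_(nu in `]0, y[) (nu `^ (- n2 - 1) * id nu) = y `^ (1 - n2) / (1 - n2).
  rewrite -[RHS]/(fine (y `^ (1 - n2) / (1 - n2))%:E) -integral_powR_0o//.
  apply: eq_Rintegral => nu; rewrite inE/= in_itv/= => /andP[nu0 _].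
  rewrite -{2}(powRr1 (ltW nu0)) -powRD; last by rewrite (gt_eqF nu0) implybT.
  by congr (_ `^ _); ring.
have -> : \int[mu]_(nu in `]y, +oo[) (nu `^ (- n1 - 1) * id nu) = y `^ (- (n1 - 1)) / (n1 - 1).
  rewrite -[RHS]/(fine (y `^ (- (n1 - 1)) / (n1 - 1))%:E) -integral_powR_yo//.
  apply: eq_Rintegral => nu; rewrite inE/= in_itv/= andbT => ynu; have nu0 := lt_trans y0 ynu.
  rewrite -{2}(powRr1 (ltW nu0)) -powRD; last by rewrite (gt_eqF nu0) implybT.
  by congr (_ `^ _); ring.
have p1 : y `^ n2 * y `^ (1 - n2) = y.
  rewrite -powRD; last by rewrite (gt_eqF y0) implybT.
  by rewrite addrC subrK powRr1// ltW.
have p2 : y `^ n1 * y `^ (- (n1 - 1)) = y.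
  rewrite -powRD; last by rewrite (gt_eqF y0) implybT.
  by rewrite opprB addrC subrK powRr1// ltW.
rewrite !mulrA p1 p2.
have rE : r = - ((1 - n1) * (1 - n2) * th ^+ 2 / 2) by rewrite nE; field.
rewrite rE /K; field.
by rewrite th0 (gt_eqF k1) (gt_eqF k2) -opprB oppr_eq0 (gt_eqF k2) gt_eqF// subr_gt0.
Qed.

Lemma Xi_hE (y : R) (r0 : 0 < r) : 0 < y ->
  (1 - n1) * (1 - n2) = - (2 * r / th ^+ 2) ->
  Xi th n1 n2 H y = Xi th n1 n2 (conjugate uB) y - Xi th n1 n2 (conjugate uA) y + eps / r * y.
Proof.
move=> y0 nE; have mid : measurable_fun (`]0, +oo[%classic : set R) (@id R) by [].
have iB := integrable_green th y0 (measurable_conjugate huB)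
  (integrable_conjugate_0o huB n20 y0) (integrable_conjugate_yo huB n11 y0).
have iA := integrable_green th y0 (measurable_conjugate huA)
  (integrable_conjugate_0o huA n20 y0) (integrable_conjugate_yo huA n11 y0).
have ii := integrable_green th y0 mid (integrable_id_0o y0) (integrable_id_yo y0).
rewrite (_ : eps / r * y = eps * Xi th n1 n2 id y); last first.
  by rewrite Xi_idE//; ring.
rewrite (Xi_green th y0 measurable_h (integrable_h_0o y0) (integrable_h_yo y0)).
rewrite (Xi_green th y0 (measurable_conjugate huB)
  (integrable_conjugate_0o huB n20 y0) (integrable_conjugate_yo huB n11 y0)).
rewrite (Xi_green th y0 (measurable_conjugate huA)
  (integrable_conjugate_0o huA n20 y0) (integrable_conjugate_yo huA n11 y0)).
rewrite (Xi_green th y0 mid (integrable_id_0o y0) (integrable_id_yo y0)).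
have iBA : mu.-integrable (`]0, +oo[%classic : set R)
    (EFin \o (fun nu => conjugate uB nu * G y nu - conjugate uA nu * G y nu)).
  exact: (integrableB _ iB iA).
have ie : mu.-integrable (`]0, +oo[%classic : set R) (EFin \o (fun nu => eps * (id nu * G y nu))).
  exact: (integrableZl _ _ ii).
rewrite -RintegralB// -RintegralZl// -RintegralD//.
apply: eq_Rintegral => nu; rewrite inE/= in_itv/= andbT => nu0.
by rewrite hE//; ring.
Qed.

End optimal_stopping_function.

(** * Discounted occupation integrals *)

Section discounted_occupation.
Context {R : realType} {d : measure_display} {T : measurableType d}.
Variables (P : probability T R) (B : R -> T -> R).
Hypothesis hB : is_standard_brownian_motion P B.
Notation mu := (@lebesgue_measure R).
Local Notation aug := (augmented_filtration P B).
Variables (r rho th n1 n2 y : R).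
Let a := rho - r - th ^+ 2 / 2.
Hypotheses (th0 : th != 0) (n12 : n2 < n1)
  (n1D2 : n1 + n2 = - (2 * a / th ^+ 2)) (n1M2 : n1 * n2 = - (2 * rho / th ^+ 2))
  (y0 : 0 < y).
Local Notation Y := (dual_process r rho th B y).
Local Notation G := (green th n1 n2).
Local Notation M := (P \x mu)%E.
Local Notation TR := (T * measurableTypeR R)%type.

(* The product measure charges all real times: [Num.max] keeps the process
   jointly measurable there and the indicator discards [t <= 0]. *)
Definition discounted (f : R -> R) (wt : TR) : R :=
  \1_(`]0, +oo[%classic) wt.2 * (expR (- rho * wt.2) * f (Y (Num.max wt.2 0) wt.1)).
Local Notation Z := discounted.

Definition green_potential (f : R -> R) (z : R) : \bar R :=
  (\int[mu]_(nu in `]0%R, +oo[) (f nu * G z nu)%:E)%E.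
Local Notation U := green_potential.

Let mD : measurable (`]0, +oo[%classic : set (measurableTypeR R)).
Proof. exact: measurable_itv. Qed.

Lemma measurable_discounted (f : R -> R) : measurable_fun [set: R] f ->
  measurable_fun [set: TR] (Z f).
Proof.
move=> mf; apply: measurable_funM.
  exact: (measurableT_comp (measurable_indic mD) measurable_snd).
apply: measurable_funM.
  by apply: measurableT_comp => //; apply: measurable_funM.
exact: (measurableT_comp mf (measurable_dual_process_joint hB r rho th y)).
Qed.

Lemma discounted_ge0 (f : R -> R) (wt : TR) : (forall x, 0 <= f x) -> 0 <= Z f wt.
Proof. by move=> f0; rewrite !mulr_ge0 ?expR_ge0. Qed.

Lemma discounted_gt0E (f : R -> R) (w : T) (t : R) : 0 < t ->
  Z f (w, t) = expR (- rho * t) * f (Y t w).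
Proof.
by move=> t0; rewrite /Z indicE mem_set/= ?in_itv/= ?t0// mul1r max_l// ltW.
Qed.

Lemma discounted_le0E (f : R -> R) (w : T) (t : R) : t <= 0 -> Z f (w, t) = 0.
Proof.
move=> t0; rewrite /Z indicE memNset ?mul0r//= in_itv/= andbT.
by apply/negP; rewrite -leNgt.
Qed.

Lemma green_potential_ge0 (f : R -> R) (z : R) : (forall x, 0 <= f x) -> (0 <= U f z)%E.
Proof.
move=> f0; apply: integral_ge0 => nu/=; rewrite in_itv/= andbT => nu0.
by rewrite lee_fin mulr_ge0// (green_nonneg th0 n12).
Qed.

Lemma measurable_green_potential (f : R -> R) :
  measurable_fun [set: R] f -> (forall x, 0 <= f x) -> measurable_fun [set: R] (U f).
Proof.
move=> mf f0.
pose F (zn : measurableTypeR R * measurableTypeR R) : \bar R :=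
  (((fun zn => (f zn.2 * G zn.1 zn.2)%:E) \_ ([set: measurableTypeR R] `*` `]0%R, +oo[%classic)) zn)%E.
have mF : measurable_fun [set: measurableTypeR R * measurableTypeR R] F.
  apply: measurable_fun_restrict; first exact: measurableX.
  apply: measurable_funTS; apply/measurable_EFinP; apply: measurable_funM.
    exact: (measurableT_comp mf measurable_snd).
  rewrite /green; apply: measurable_funM => //; apply: measurable_funM.
    apply: measurableT_comp => //; apply: measurable_funM.
      apply: measurableT_comp => //.
      apply: measurable_fun_ifT => //.
      exact: measurable_fun_ltr.
    apply: measurable_funB.
      exact: (measurableT_comp (@measurable_ln R) measurable_snd).
    exact: (measurableT_comp (@measurable_ln R) measurable_fst).
  exact: (measurableT_comp (@measurable_invr R) measurable_snd).
have F0 x : (0 <= F x)%E.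
  rewrite /F patchE; case: ifPn => //; rewrite inE => -[_]/=; rewrite in_itv/= andbT => x0.
  by rewrite lee_fin mulr_ge0// (green_nonneg th0 n12).
have := @measurable_fun_fubini_tonelli_F _ _ (measurableTypeR R) (measurableTypeR R) R mu F mF F0.
congr measurable_fun; apply/funext => z.
rewrite /fubini_F /U [RHS]integral_mkcond; apply: eq_integral => nu _.
by rewrite /F !patchE in_setX in_setT.
Qed.

Lemma ge0_integral_discounted_rect (f : R -> R) (s : R) (E : set T) :
  measurable_fun [set: R] f -> (forall x, 0 <= f x) -> 0 <= s -> aug s E ->
  (\int[M]_(x in E `*` (`]s, +oo[%classic : set (measurableTypeR R))) (Z f x)%:E =
   \int[P]_(w in E) ((expR (- rho * s))%:E * U f (Y s w)))%E.
Proof.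
move=> mf f0 s0 sE.
have mE : measurable E by exact: (augmented_filtration_measurable hB sE).
rewrite /U -(dual_process_markov hB th0 n12 n1D2 n1M2 y0 mf f0 s0 sE).
have mR : measurable (E `*` (`]s, +oo[%classic : set (measurableTypeR R))).
  by apply: measurableX => //; exact: measurable_itv.
rewrite integral_mkcond fubini_tonelli1; last 2 first.
- apply: measurable_fun_restrict => //; apply: measurable_funTS.
  by apply/measurable_EFinP; exact: measurable_discounted.
- by move=> x; rewrite patchE; case: ifPn => // _; rewrite lee_fin discounted_ge0.
rewrite [RHS]integral_mkcond; apply: eq_integral => w _.
rewrite /fubini_F patchE; case: ifPn => wE; last first.
  apply: integral0_eq => t _; rewrite patchE memNset// => -[/= /mem_set].
  by rewrite (negbTE wE).
rewrite [RHS]integral_mkcond; apply: eq_integral => t _.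
rewrite !patchE.
have -> : ((w, t) \in E `*` (`]s, +oo[%classic : set (measurableTypeR R))) = (t \in (`]s, +oo[%classic : set R)).
  by rewrite in_setX wE.
case: ifPn => //; rewrite inE/= in_itv/= andbT => st.
by rewrite discounted_gt0E// (le_lt_trans s0).
Qed.

Lemma ge0_integral_discounted (f : R -> R) : measurable_fun [set: R] f -> (forall x : R, 0 <= f x) ->
  (\int[M]_x (Z f x)%:E = U f y)%E.
Proof.
move=> mf f0.
transitivity (\int[M]_(x in setT `*` (`]0%R, +oo[%classic : set (measurableTypeR R))) (Z f x)%:E)%E.
  rewrite [RHS]integral_mkcond; apply: eq_integral => -[w t] _.
  rewrite patchE; case: ifPn => // /negP H.
  rewrite discounted_le0E// leNgt; apply/negP => t0; apply: H.
  by rewrite inE; split => //=; rewrite in_itv/= t0.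
rewrite ge0_integral_discounted_rect//; last first.
  by exact: (@measurableT _ (g_sigma_algebraType (natural_filtration B 0 `|`
        [set N : set T | measurable N /\ P N = 0%E]))).
transitivity (\int[P]_w cst (U f y) w)%E; last first.
  rewrite (integral_cst P measurableT) -[RHS]mule1; congr (_ * _)%E.
  exact: probability_setT.
(* [B 0] vanishes only almost surely, so the process starts at y only almost surely. *)
apply: ae_eq_integral => //.
  apply: emeasurable_funM => //.
  apply: (measurableT_comp (measurable_green_potential mf f0)).
  exact: (measurable_dual_process hB).
move: (bm_start hB); apply: filterS => w Bw _.
by rewrite /= mulr0 expR0 mul1e /dual_process /state_price Bw !mulr0 !subr0 expR0 !mulr1.
Qed.

(* [C k] stands for the paths stopped by the time [k * dl]. *)
Definition strip (C : (set T)^nat) (dl : R) : set TR :=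
  \bigcup_k (C k `*` (`]k%:R * dl, +oo[%classic : set (measurableTypeR R))).

Section strip.
Variables (C : (set T)^nat) (dl : R).
Hypotheses (dl0 : 0 < dl) (sC : forall k, aug (k%:R * dl) (C k)).

Let kdl_ge0 (k : nat) : 0 <= k%:R * dl. Proof. by rewrite mulr_ge0// ltW. Qed.

Lemma measurable_strip : measurable (strip C dl).
Proof.
apply: bigcupT_measurable => k; apply: measurableX; last exact: measurable_itv.
exact: (augmented_filtration_measurable hB (@sC k)).
Qed.

Let sE (k : nat) : aug (k%:R * dl) (seqDU C k).
Proof.
rewrite /seqDU.
pose GT := g_sigma_algebraType (natural_filtration B (k%:R * dl) `|`
        [set N : set T | measurable N /\ P N = 0%E]).
apply: (@measurableD _ GT); first exact: sC.
apply: (@bigsetU_measurable _ GT) => i _.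
apply: (augmented_filtrationW (s := i%:R * dl)) (@sC i).
by rewrite ler_pM2r// ler_nat ltnW.
Qed.

(** The half-lines shrink as k grows, so the first event that contains a path already carries the
    longest one. The disjoint events remain adapted to the grid times. *)
Let stripE : strip C dl =
  \bigcup_k (seqDU C k `*` (`]k%:R * dl, +oo[%classic : set (measurableTypeR R))).
Proof.
apply/seteqP; split => [[w t] [k _ [/= Cw kt]]|[w t] [k _ [/= [Cw _] kt]]]; last by exists k.
have : (\big[setU/set0]_(i < k.+1) C i) w by rewrite -bigcup_mkord; exists k => //=.
rewrite bigsetU_seqDU -bigcup_mkord => -[j /= jk Ej]; exists j => //; split => //=.
move: kt; rewrite !in_itv/= !andbT; apply: le_lt_trans.
by rewrite ler_pM2r// ler_nat -ltnS.
Qed.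

Lemma ge0_integral_discounted_strip (f : R -> R) :
  measurable_fun [set: R] f -> (forall x : R, 0 <= f x) ->
  (\int[M]_(x in strip C dl) (Z f x)%:E =
   \sum_(k <oo) \int[P]_(w in seqDU C k) ((expR (- rho * (k%:R * dl)))%:E * U f (Y (k%:R * dl) w)))%E.
Proof.
move=> mf f0; rewrite stripE ge0_integral_bigcup//.
- by apply: eq_eseriesr => k _; exact: ge0_integral_discounted_rect.
- move=> k; apply: measurableX; last exact: measurable_itv.
  exact: (augmented_filtration_measurable hB (@sE k)).
- by apply: measurable_funTS; apply/measurable_EFinP; exact: measurable_discounted.
- by move=> x _; rewrite lee_fin discounted_ge0.
- move=> i j _ _ [[w t] [[/= Ei _] [/= Ej _]]].
  by apply: (@trivIset_seqDU _ C) => //; exists w.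
Qed.

(** The Markov property is spent here: comparing potentials at the entry times compares the
    integrals over everything that comes after them. *)
Lemma le_integral_discounted_strip (f1 f2 : R -> R) :
  measurable_fun [set: R] f1 -> (forall x, 0 <= f1 x) ->
  measurable_fun [set: R] f2 -> (forall x, 0 <= f2 x) ->
  (forall k w, C k w -> (U f1 (Y (k%:R * dl) w) <= U f2 (Y (k%:R * dl) w))%E) ->
  (\int[M]_(x in strip C dl) (Z f1 x)%:E <= \int[M]_(x in strip C dl) (Z f2 x)%:E)%E.
Proof.
move=> mf1 f10 mf2 f20 H.
rewrite (ge0_integral_discounted_strip mf1 f10) (ge0_integral_discounted_strip mf2 f20).
have F0 (f : R -> R) (k : nat) (w : T) : (forall x : R, 0 <= f x) ->
    (0 <= (expR (- rho * (k%:R * dl)))%:E * U f (Y (k%:R * dl) w))%E.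
  by move=> f0; rewrite mule_ge0 ?lee_fin ?expR_ge0// green_potential_ge0.
have mF (f : R -> R) (k : nat) (D : set T) : measurable_fun [set: R] f -> (forall x : R, 0 <= f x) ->
    measurable_fun D (fun w => (expR (- rho * (k%:R * dl)))%:E * U f (Y (k%:R * dl) w))%E.
  move=> mf f0; apply: measurable_funTS; apply: emeasurable_funM => //.
  apply: (measurableT_comp (measurable_green_potential mf f0)).
  exact: (measurable_dual_process hB).
apply: lee_nneseries => [k _ _|k _]; first by apply: integral_ge0 => w _; exact: F0.
apply: ge0_le_integral => //.
- exact: (augmented_filtration_measurable hB (@sE k)).
- by move=> w _; exact: F0.
- exact: mF.
- exact: mF.
- move=> w [Cw _]; apply: lee_wpmul2l; first by rewrite lee_fin expR_ge0.
  exact: H Cw.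
Qed.

End strip.

End discounted_occupation.

Lemma nondecreasing_set_cvg_integral d (T : measurableType d) (R : realType)
    (mu : {measure set T -> \bar R}) (F : (set T)^nat) (f : T -> \bar R) :
  nondecreasing_seq F -> (forall n, measurable (F n)) ->
  mu.-integrable (\bigcup_n F n) f ->
  (\int[mu]_(x in F n) f x @[n --> \oo] --> \int[mu]_(x in \bigcup_n F n) f x)%E.
Proof.
move=> ndF mF fF; have mbF : measurable (\bigcup_n F n) by exact: bigcupT_measurable.
have [mf _] := integrableP _ _ _ fF.
have sF n : F n `<=` \bigcup_n F n by exact: bigcup_sup.
rewrite (_ : (fun n => _) = (fun n => \int[mu]_(x in F n) f^\+ x - \int[mu]_(x in F n) f^\- x)%E); last first.
  by apply/funext => n; rewrite integralE.
rewrite integralE; apply: cvgeB.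
- by rewrite fin_num_adde_defl// fin_numN integrable_neg_fin_num.
- apply: ge0_nondecreasing_set_cvg_integral => // n.
  by apply: measurable_funS mbF (sF n) _; exact: measurable_funepos.
- apply: ge0_nondecreasing_set_cvg_integral => // n.
  by apply: measurable_funS mbF (sF n) _; exact: measurable_funeneg.
Qed.

(** * Integrands of both signs *)

Section signed_occupation.
Context {R : realType} {d : measure_display} {T : measurableType d}.
Variables (P : probability T R) (B : R -> T -> R).
Hypothesis hB : is_standard_brownian_motion P B.
Notation mu := (@lebesgue_measure R).
Local Notation aug := (augmented_filtration P B).
Variables (r rho th n1 n2 y : R).
Let a := rho - r - th ^+ 2 / 2.
Hypotheses (th0 : th != 0) (n12 : n2 < n1)
  (n1D2 : n1 + n2 = - (2 * a / th ^+ 2)) (n1M2 : n1 * n2 = - (2 * rho / th ^+ 2))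
  (y0 : 0 < y).
Local Notation Y := (dual_process r rho th B y).
Local Notation G := (green th n1 n2).
Local Notation M := (P \x mu)%E.
Local Notation TR := (T * measurableTypeR R)%type.
Local Notation Z := (discounted B r rho th y).
Local Notation U := (green_potential th n1 n2).
Local Notation D0 := (`]0%R, +oo[%classic : set R).

Let pos (f : R -> R) (x : R) := Num.max (f x) 0.
Let neg (f : R -> R) (x : R) := Num.max (- f x) 0.

Let pos_ge0 f x : 0 <= pos f x. Proof. by rewrite le_max lexx orbT. Qed.
Let neg_ge0 f x : 0 <= neg f x. Proof. by rewrite le_max lexx orbT. Qed.

Let measurable_pos f : measurable_fun [set: R] f -> measurable_fun [set: R] (pos f).
Proof. by move=> mf; exact: measurable_maxr. Qed.
Let measurable_neg f : measurable_fun [set: R] f -> measurable_fun [set: R] (neg f).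
Proof. by move=> mf; apply: measurable_maxr => //; exact: measurableT_comp. Qed.

Let funepos_discounted f : ((EFin \o Z f)^\+)%E = EFin \o Z (pos f).
Proof.
apply/funext => x; rewrite funepos.unlock/= -EFin_max; congr EFin.
by rewrite /discounted /pos !maxr_pMr ?expR_ge0// !mulr0.
Qed.

Let funeneg_discounted f : ((EFin \o Z f)^\-)%E = EFin \o Z (neg f).
Proof.
apply/funext => x; rewrite funeneg.unlock/= -EFin_max; congr EFin.
by rewrite /discounted /neg !maxr_pMr ?expR_ge0// !mulr0 !mulrN.
Qed.

Let funepos_green f z nu : nu \in D0 ->
  ((fun nu => (f nu * G z nu)%:E)^\+ nu)%E = (pos f nu * G z nu)%:E.
Proof.
rewrite inE/= in_itv/= andbT => nu0; rewrite funepos.unlock/= -EFin_max; congr EFin.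
by rewrite /pos maxr_pMl ?mul0r// (green_nonneg th0 n12).
Qed.

Let funeneg_green f z nu : nu \in D0 ->
  ((fun nu => (f nu * G z nu)%:E)^\- nu)%E = (neg f nu * G z nu)%:E.
Proof.
rewrite inE/= in_itv/= andbT => nu0; rewrite funeneg.unlock/= -EFin_max; congr EFin.
by rewrite /neg maxr_pMl ?mul0r ?mulNr// (green_nonneg th0 n12).
Qed.

Let green_potentialE f z : U f z = (U (pos f) z - U (neg f) z)%E.
Proof.
by rewrite /green_potential integralE; congr (_ - _)%E; apply: eq_integral => nu nu0;
  [exact: funepos_green|exact: funeneg_green].
Qed.

Let ge0_integral_Z := ge0_integral_discounted hB th0 n12 n1D2 n1M2 y0.

(** Both sides are positive part minus negative part, with the same convention for oo - oo, so the
    identity for nonnegative functions gives it for every measurable f. *)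
Lemma integral_discounted (f : R -> R) : measurable_fun [set: R] f ->
  (\int[M]_x (Z f x)%:E = U f y)%E.
Proof.
move=> mf; rewrite green_potentialE integralE.
rewrite -[X in (\int[_]_(x in _) X^\+ x - _)%E]/(EFin \o Z f).
rewrite -[X in (_ - \int[_]_(x in _) X^\- x)%E]/(EFin \o Z f).
rewrite funepos_discounted funeneg_discounted/= !ge0_integral_Z//.
  exact: measurable_neg.
exact: measurable_pos.
Qed.

Lemma integrable_discounted (f : R -> R) : measurable_fun [set: R] f ->
  mu.-integrable D0 (fun nu => (f nu * G y nu)%:E) ->
  M.-integrable setT (EFin \o Z f).
Proof.
move=> mf /integrableP[_ foo]; apply/integrableP; split.
  by apply/measurable_EFinP; exact: (measurable_discounted hB).
rewrite (_ : (\int[M]_x _ = \int[M]_x (Z (fun x => `|f x|) x)%:E)%E); last first.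
  apply: eq_integral => x _ /=; rewrite /discounted !normrM.
  by rewrite (ger0_norm (expR_ge0 _)) (ger0_norm (_ : 0 <= \1__ _)) ?indicE.
rewrite integral_discounted; last exact: measurableT_comp.
apply: le_lt_trans foo; rewrite le_eqVlt; apply/orP; left; apply/eqP.
apply: eq_integral => nu; rewrite inE/= in_itv/= andbT => nu0.
by rewrite /= normrM (ger0_norm (green_nonneg th0 n12 _ nu0)).
Qed.

(** Turns the iterated integrals of the payoffs into integrals over the product space. Time 0 is
    exempted because [D w] may contain it while [Z] vanishes there. Cutting f to the positive
    half-line makes it measurable and changes nothing along the positive process. *)
Lemma integral_integral_discounted (f : R -> R) (D : T -> set R) (S : set TR) :
  measurable_fun [set: R] (f \_ D0) ->
  mu.-integrable D0 (fun nu => (f nu * G y nu)%:E) ->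
  measurable S -> (forall w t, t != 0 -> D w t <-> 0 < t /\ S (w, t)) ->
  (\int[P]_w \int[mu]_(t in D w) (expR (- rho * t) * f (Y t w))%:E =
   \int[M]_(x in S) (Z (f \_ D0) x)%:E)%E.
Proof.
move=> mf foo mS DS.
have ZS : M.-integrable setT ((EFin \o Z (f \_ D0)) \_ S)%E.
  apply: (proj1 (integrable_mkcond _ mS)); apply: (integrableS measurableT) => //.
  apply: integrable_discounted => //.
  apply: eq_integrable foo => //= nu; rewrite inE => nu0.
  by rewrite patchE mem_set.
have fY t w : (f \_ D0) (Y t w) = f (Y t w).
  by rewrite patchE mem_set//= in_itv/= dual_process_gt0.
rewrite [RHS]integral_mkcond -(integral12_prod_meas1 ZS).
apply: eq_integral => w _.
have mZS : measurable_fun [set: measurableTypeR R]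
    (fun t => ((EFin \o Z (f \_ D0)) \_ S)%E (w, t)).
  by apply: measurableT_comp; [case/integrableP: ZS|exact: measurable_pair1].
have mT : measurable ([set: R] `\ 0) by apply: measurableD.
have e t : t != 0 -> ((EFin \o Z (f \_ D0)) \_ S)%E (w, t) =
    ((fun t => (expR (- rho * t) * f (Y t w))%:E) \_ (D w))%E t.
  move=> t0; rewrite !patchE; case: ifPn => [|]; rewrite ?inE ?notin_setE.
  - move=> Swt; case: ifPn => [|]; rewrite ?inE ?notin_setE => Dwt.
      have [t_gt0 _] := (DS w t t0).1 Dwt.
      by rewrite /= discounted_gt0E// fY.
    have [t_gt0|t_le0] := ltP 0 t; last by rewrite /= discounted_le0E.
    by have := (DS w t t0).2 (conj t_gt0 Swt).
  - by move=> nS; rewrite memNset// => /(DS w t t0).1 [].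
(* Measurability in t comes from the slice of the product function, with which the integrand agrees
   off 0. *)
rewrite integral_mkcond -(@integral_setD1 R _ 0)//; last first.
  apply: (eq_measurable_fun (fun t => ((EFin \o Z (f \_ D0)) \_ S)%E (w, t))).
    by move=> t; rewrite inE/= => -[_ /eqP t0]; exact: e.
  exact: measurable_funTS.
rewrite /fubini_F -[RHS](@integral_setD1 R _ 0)//; last exact: measurable_funTS.
by apply: eq_integral => t; rewrite inE/= => -[_ /eqP t0]; rewrite e.
Qed.

Let measurable_Z (f : R -> R) (D : set TR) :
  measurable_fun [set: R] f -> measurable_fun D (EFin \o Z f).
Proof.
move=> mf; apply: measurable_funTS; apply/measurable_EFinP.
exact: (measurable_discounted hB).
Qed.

Lemma integral_discounted_strip_ge0 (C : (set T)^nat) (dl : R) (f : R -> R) :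
  0 < dl -> (forall k, aug (k%:R * dl) (C k)) -> measurable_fun [set: R] f ->
  M.-integrable setT (EFin \o Z f) ->
  (forall k w, C k w -> (0 <= U f (Y (k%:R * dl) w))%E) ->
  (0 <= \int[M]_(x in strip C dl) (Z f x)%:E)%E.
Proof.
move=> dl0 sC mf Zf U0.
have mS := measurable_strip hB sC.
have ZfS : M.-integrable (strip C dl) (EFin \o Z f) by exact: (integrableS measurableT).
rewrite -[X in (\int[_]_(x in _) X x)%E]/(EFin \o Z f).
rewrite integralE sube_ge0 ?(integrable_neg_fin_num _ ZfS)//.
rewrite funepos_discounted funeneg_discounted.
apply: (le_integral_discounted_strip hB th0 n12 n1D2 n1M2 y0 dl0 sC) => //.
- exact: measurable_neg.
- exact: measurable_pos.
move=> k w Cw; have := U0 k w Cw; rewrite green_potentialE.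
case: (U (neg f) _) => [z||]; case: (U (pos f) _) => [x||]//=; rewrite ?leey ?leNye//.
by rewrite !lee_fin subr_ge0.
Qed.

Lemma integral_discounted_strip_eq0 (C : (set T)^nat) (dl : R) (f : R -> R) :
  0 < dl -> (forall k, aug (k%:R * dl) (C k)) -> measurable_fun [set: R] f ->
  M.-integrable setT (EFin \o Z f) ->
  (forall k w, C k w -> U f (Y (k%:R * dl) w) = 0%E) ->
  (\int[M]_(x in strip C dl) (Z f x)%:E = 0)%E.
Proof.
move=> dl0 sC mf Zf U0.
have mS := measurable_strip hB sC.
have ZfS : M.-integrable (strip C dl) (EFin \o Z f) by exact: (integrableS measurableT).
rewrite -[X in (\int[_]_(x in _) X x)%E]/(EFin \o Z f).
rewrite integralE.
rewrite (_ : (\int[M]_(x in strip C dl) (EFin \o Z f)^\+ x)%E =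
  (\int[M]_(x in strip C dl) (EFin \o Z f)^\- x)%E).
  by rewrite subee// (integrable_neg_fin_num _ ZfS).
rewrite funepos_discounted funeneg_discounted.
have intS := ge0_integral_discounted_strip hB th0 n12 n1D2 n1M2 y0 dl0 sC.
rewrite (intS _ (measurable_pos mf) (@pos_ge0 f)) (intS _ (measurable_neg mf) (@neg_ge0 f)).
apply: eq_eseriesr => k _; apply: eq_integral => w; rewrite inE => -[Cw _].
congr (_ * _)%E; have := U0 k w Cw; rewrite green_potentialE.
case: (U (neg f) _) => [z||]; case: (U (pos f) _) => [x||]//= [].
by move=> /eqP; rewrite subr_eq0 => /eqP ->.
Qed.

Section dyadic.
Variable E : R -> set T.
Hypothesis sE : forall t, 0 <= t -> aug t (E t).

(** Dyadic steps make the grids nested, so the strips increase with n. *)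
Definition dyadic_strip (n : nat) : set TR :=
  strip (fun k => E (k%:R * 2 ^- n)) (2 ^- n).

Let dl_gt0 (n : nat) : 0 < 2 ^- n :> R. Proof. by rewrite invr_gt0 exprn_gt0. Qed.

Let sdE (n k : nat) : aug (k%:R * 2 ^- n) (E (k%:R * 2 ^- n)).
Proof. by apply: sE; rewrite mulr_ge0// ltW. Qed.

Lemma measurable_dyadic_strip n : measurable (dyadic_strip n).
Proof. exact: (measurable_strip hB (@sdE n)). Qed.

Lemma nondecreasing_dyadic_strip : nondecreasing_seq dyadic_strip.
Proof.
apply/nondecreasing_seqP => n; apply/subsetPset => -[w t] [k _ [/= Ew kt]].
have e : (k.*2%:R * 2 ^- n.+1 = k%:R * 2 ^- n :> R).
  rewrite exprS invfM mulrA -muln2 natrM; congr (_ * _).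
  by rewrite mulfK.
by exists k.*2 => //=; rewrite e.
Qed.

Let mSE : measurable (\bigcup_n dyadic_strip n).
Proof. by apply: bigcupT_measurable => n; exact: measurable_dyadic_strip. Qed.

Let cvg_dyadic (f : R -> R) : M.-integrable setT (EFin \o Z f) ->
  (\int[M]_(x in dyadic_strip n) (Z f x)%:E @[n --> \oo] -->
   \int[M]_(x in \bigcup_n dyadic_strip n) (Z f x)%:E)%E.
Proof.
move=> Zf; apply: nondecreasing_set_cvg_integral => //.
- exact: nondecreasing_dyadic_strip.
- exact: measurable_dyadic_strip.
- exact: (integrableS measurableT).
Qed.

Lemma integral_discounted_dyadic_ge0 (f : R -> R) :
  measurable_fun [set: R] f -> M.-integrable setT (EFin \o Z f) ->
  (forall z, 0 < z -> (0 <= U f z)%E) ->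
  (0 <= \int[M]_(x in \bigcup_n dyadic_strip n) (Z f x)%:E)%E.
Proof.
move=> mf Zf U0; apply: (cvge_ge _ (cvg_dyadic Zf)); apply: nearW => n.
apply: (integral_discounted_strip_ge0 (dl_gt0 n) (@sdE n) mf Zf) => k w _.
by apply: U0; exact: dual_process_gt0.
Qed.

(** The integral of g over the complement of S stands for the expected discounted potential at the
    stopping time. It is a limit of integrals over strips, each nonnegative because U g >= 0. *)
Lemma integral_discounted_stopped_le (f g : R -> R) (S : set TR) :
  measurable_fun [set: R] f -> M.-integrable setT (EFin \o Z f) ->
  measurable_fun [set: R] g -> M.-integrable setT (EFin \o Z g) ->
  (forall x, f x <= g x) ->
  (forall z, 0 < z -> (0 <= U g z)%E) ->
  S = ~` (\bigcup_n dyadic_strip n) ->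
  (\int[M]_(x in S) (Z f x)%:E <= U g y)%E.
Proof.
move=> mf Zf mg Zg fg U0 SE.
have mS : measurable S by rewrite SE; apply: measurableC; exact: mSE.
apply: (@le_trans _ _ (\int[M]_(x in S) (Z g x)%:E)%E).
  apply: le_integral => //; try exact: (integrableS measurableT).
  move=> x _; rewrite lee_fin /discounted.
  by rewrite !ler_wpM2l ?expR_ge0.
rewrite -integral_discounted// -[in leRHS](setUv S) integral_setU//.
- rewrite leeDl// SE setCK; exact: integral_discounted_dyadic_ge0.
- exact: measurableC.
- exact: measurable_Z.
- exact/disj_setPCl.
Qed.

Let integral_discountedC (f : R -> R) (S : set TR) :
  measurable_fun [set: R] f -> M.-integrable setT (EFin \o Z f) -> measurable S ->
  (\int[M]_(x in ~` S) (Z f x)%:E = U f y - \int[M]_(x in S) (Z f x)%:E)%E.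
Proof.
move=> mf Zf mS.
have ZfS : M.-integrable S (EFin \o Z f) by exact: (integrableS measurableT).
rewrite -integral_discounted// -[in X in (X - _)%E](setUv S) integral_setU//.
- rewrite [X in (X - _)%E]addeC addeK//.
  exact: (integrable_fin_num _ ZfS).
- exact: measurableC.
- exact: measurable_Z.
- exact/disj_setPCl.
Qed.

(** Over a strip g integrates to 0, as its potential vanishes at the entry times. Outside the strip
    g - q therefore gives U g minus the loss, the integral of q outside the strip. The strips
    exhaust the set where q is nonzero, so the loss tends to 0. *)
Lemma integral_discounted_cvg (g q : R -> R) :
  measurable_fun [set: R] g -> M.-integrable setT (EFin \o Z g) ->
  measurable_fun [set: R] q -> M.-integrable setT (EFin \o Z q) ->
  (forall t w, 0 <= t -> E t w -> U g (Y t w) = 0%E) ->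
  (forall t w, 0 < t -> q (Y t w) != 0 -> exists n, dyadic_strip n (w, t)) ->
  (\int[M]_(x in ~` dyadic_strip n) (Z (fun z => g z - q z) x)%:E @[n --> \oo] --> U g y)%E.
Proof.
move=> mg Zg mq Zq Ug0 qE.
have Uq : U q y \is a fin_num.
  by rewrite -integral_discounted//; exact: integrable_fin_num Zq.
have eqn n : (\int[M]_(x in ~` dyadic_strip n) (Z (fun z => g z - q z) x)%:E =
    U g y - (U q y - \int[M]_(x in dyadic_strip n) (Z q x)%:E))%E.
  have mSn : measurable (~` dyadic_strip n) by apply: measurableC; exact: measurable_dyadic_strip.
  rewrite -integral_discountedC//; last exact: measurable_dyadic_strip.
  transitivity (\int[M]_(x in ~` dyadic_strip n) ((EFin \o Z g) \- (EFin \o Z q)) x)%E.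
    by apply: eq_integral => x _; rewrite /= -EFinB /discounted -!mulrBr.
  rewrite integralB//; [|exact: (integrableS measurableT)|exact: (integrableS measurableT)].
  congr (_ - _)%E; rewrite integral_discountedC//; last exact: measurable_dyadic_strip.
  rewrite (integral_discounted_strip_eq0 (dl_gt0 n) (@sdE n) mg Zg) ?sube0// => k w.
  by apply: Ug0; rewrite mulr_ge0// ltW.
rewrite (_ : (fun n => _) = (fun n => U g y - (U q y - \int[M]_(x in dyadic_strip n) (Z q x)%:E))%E); last first.
  by apply/funext => n; exact: eqn.
have Ug : U g y \is a fin_num.
  by rewrite -integral_discounted//; exact: integrable_fin_num Zg.
rewrite -[X in _ --> X]sube0 -(subee Uq).
apply: cvgeB; [by rewrite fin_num_adde_defr|exact: cvg_cst|].
apply: cvgeB; [by rewrite fin_num_adde_defr|exact: cvg_cst|].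
rewrite -[X in _ --> X]integral_discounted//.
rewrite (_ : (\int[M]_x (Z q x)%:E = \int[M]_(x in \bigcup_n dyadic_strip n) (Z q x)%:E)%E).
  exact: cvg_dyadic.
rewrite [RHS]integral_mkcond; apply: eq_integral => -[w t] _.
rewrite patchE; case: ifPn => //; rewrite notin_setE => nS.
have [t0|t0] := ltP 0 t; last by rewrite discounted_le0E.
rewrite discounted_gt0E//; have [->|q0] := eqVneq (q (Y t w)) 0; first by rewrite mulr0.
by exfalso; apply: nS; have [n] := qE _ _ t0 q0; exists n.
Qed.

End dyadic.

End signed_occupation.

(** * Stopping times *)

Lemma dyadic_between (R : realType) (x t : R) : 0 <= x -> x < t ->
  exists n k : nat, x <= k%:R * 2 ^- n < t.
Proof.
move=> x0 xt.
have [n nxt] : exists n : nat, (t - x)^-1 < 2 ^+ n :> R.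
  exists (Num.truncn (t - x)^-1).+1.
  apply: lt_trans (truncnS_gt _) _ => //.
  by rewrite -natrX ltr_nat ltn_expl.
have d0 : 0 < 2 ^- n :> R by rewrite invr_gt0 exprn_gt0.
have dxt : 2 ^- n < t - x.
  by rewrite invf_plt ?posrE ?exprn_gt0 ?subr_gt0.
have /andP[k1 k2] := @truncn_itv R (x * 2 ^+ n) (mulr_ge0 x0 (exprn_ge0 n (ler0n R 2))).
exists n, (Num.truncn (x * 2 ^+ n)).+1; apply/andP; split.
  by rewrite ler_pdivlMr ?exprn_gt0// ltW.
rewrite -natr1 mulrDl mul1r.
have : (Num.truncn (x * 2 ^+ n))%:R * 2 ^- n <= x by rewrite ler_pdivrMr ?exprn_gt0.
move: dxt; lra.
Qed.

Section stopping_region.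
Context {R : realType} {d : measure_display} {T : measurableType d}.
Variables (P : probability T R) (B : R -> T -> R).
Local Notation aug := (augmented_filtration P B).

(** A dyadic time fits between tau and any later t, so the union of the strips is exactly tau < t,
    and its complement t <= tau is the domain of the payoff. *)
Lemma bigcup_dyadic_strip (tau : T -> \bar R) (w : T) (t : R) :
  (forall w, (0 <= tau w)%E) -> 0 < t ->
  (\bigcup_n dyadic_strip (fun s => [set w | (tau w <= s%:E)%E]) n) (w, t) <->
  (tau w < t%:E)%E.
Proof.
move=> tau0 t0; split => [[n _ [k _ [/= tk]]]|].
  by rewrite in_itv/= andbT => kt; rewrite (le_lt_trans tk)// lte_fin.
have := tau0 w; case E : (tau w) => [x||]//; rewrite lee_fin lte_fin => x0 xt.
have [n [k /andP[xk kt]]] := dyadic_between x0 xt.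
by exists n => //; exists k => //; split; rewrite /= ?E ?lee_fin// in_itv/= kt.
Qed.

(** The infimum of the empty set is +oo: a path that meets E at no grid time is never stopped. *)
Definition first_dyadic (E : R -> set T) (n : nat) (w : T) : \bar R :=
  ereal_inf [set (k%:R * 2 ^- n)%:E | k in [set k : nat | E (k%:R * 2 ^- n) w]].

Variable E : R -> set T.
Hypothesis sE : forall t, 0 <= t -> aug t (E t).

Lemma first_dyadic_le (n : nat) (w : T) (t : R) :
  (first_dyadic E n w <= t%:E)%E <->
  exists2 k : nat, k%:R * 2 ^- n <= t & E (k%:R * 2 ^- n) w.
Proof.
have d0 : 0 < 2 ^- n :> R by rewrite invr_gt0 exprn_gt0.
split; last first.
  by move=> [k kt Ek]; apply: (@le_trans _ _ (k%:R * 2 ^- n)%:E); rewrite ?lee_fin//;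
    apply: ereal_inf_lbound; exists k.
apply: contraPP => /forall2NP nE; apply/negP; rewrite -ltNge.
(* The least index whose grid time exceeds t. If E fails at every grid time up to t, the infimum is
   at least this grid time, hence above t. *)
pose m := if 0 <= t then (Num.truncn (t * 2 ^+ n)).+1 else 0%N.
have tm : t < m%:R * 2 ^- n.
  rewrite /m; case: (leP 0 t) => [t0|t0]; last by rewrite mul0r.
  rewrite ltr_pdivlMr ?exprn_gt0//.
  exact: truncnS_gt.
apply: (@lt_le_trans _ _ (m%:R * 2 ^- n)%:E); first by rewrite lte_fin.
apply: le_ereal_inf_tmp => _ [k Ek <-]; rewrite lee_fin ler_pM2r// ler_nat.
have [/negP|//] := nE k; rewrite -ltNge => tk.
rewrite /m; case: ifPn => // t0.
by rewrite truncn_lt_nat ?mulr_ge0// -ltr_pdivlMr// exprn_gt0.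
Qed.

Lemma first_dyadic_stopping (n : nat) : is_stopping_time aug (first_dyadic E n).
Proof.
have d0 : 0 < 2 ^- n :> R by rewrite invr_gt0 exprn_gt0.
have k0 (k : nat) : 0 <= k%:R * 2 ^- n :> R by rewrite mulr_ge0// ltW.
split=> [w|t t0]; first by apply: le_ereal_inf_tmp => _ [k _ <-]; rewrite lee_fin.
rewrite (_ : [set w | _] = \bigcup_k
    (if k%:R * 2 ^- n <= t then E (k%:R * 2 ^- n) else set0)); last first.
  apply/seteqP; split => [w /= /first_dyadic_le [k kt Ek]|w [k _]]; first by exists k; rewrite ?kt.
  by case: ifPn => // kt Ek; apply/first_dyadic_le; exists k.
pose GT := g_sigma_algebraType (natural_filtration B t `|`
        [set N : set T | measurable N /\ P N = 0%E]).
apply: (@bigcupT_measurable _ GT) => k; case: ifPn => [kt|_]; last exact: (@measurable0 _ GT).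
exact: (augmented_filtrationW kt) (@sE _ (k0 k)).
Qed.

Lemma dyadic_stripC (n : nat) (w : T) (t : R) : 0 < t ->
  (~` dyadic_strip E n) (w, t) <-> (t%:E <= first_dyadic E n w)%E.
Proof.
move=> t0; split.
  move=> nS; apply: le_ereal_inf_tmp => _ [k Ek <-]; rewrite lee_fin leNgt; apply/negP => kt.
  by apply: nS; exists k => //; split => //=; rewrite in_itv/= kt.
move=> /[swap] -[k _ [/= Ek]]; rewrite in_itv/= andbT => kt; apply/negP; rewrite -ltNge.
apply: (@le_lt_trans _ _ (k%:R * 2 ^- n)%:E); last by rewrite lte_fin.
by apply: ereal_inf_lbound; exists k.
Qed.

End stopping_region.

(** * The value of the stopping problem *)

Section dual_value.
Context {R : realType} {d : measure_display} {T : measurableType d}.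
Variables (P : probability T R) (B : R -> T -> R).
Hypothesis hB : is_standard_brownian_motion P B.
Notation mu := (@lebesgue_measure R).
Local Notation aug := (augmented_filtration P B).
Variables (uB uA : R -> R) (dB dA : set R) (r rho th n1 n2 eps zbar zR y : R).
Let a := rho - r - th ^+ 2 / 2.
Hypotheses (th0 : th != 0) (n20 : n2 < 0) (n11 : 1 < n1)
  (n1D2 : n1 + n2 = - (2 * a / th ^+ 2)) (n1M2 : n1 * n2 = - (2 * rho / th ^+ 2))
  (y0 : 0 < y).
Hypotheses (huB : class_Sigma n2 dB uB) (huA : class_Sigma n2 dA uA).
Hypothesis huBA : forall y : R, 0 < y ->
  (util_val uB (inv_marginal uB y) < util_val uA (inv_marginal uA y))%E.
Hypotheses (hzbar : 0 < zbar) (hzbar0 : Psi uB uA eps zbar = 0)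
  (hzR : 0 < zR < zbar)
  (hzR0 : (\int[mu]_(nu in `]zR, +oo[) (nu `^ (- n1 - 1) * h uB uA eps nu)%:E = 0)%E).

Local Notation H := (h uB uA eps).
Local Notation Y := (dual_process r rho th B y).
Local Notation G := (green th n1 n2).
Local Notation M := (P \x mu)%E.
Local Notation TR := (T * measurableTypeR R)%type.
Local Notation Z := (discounted B r rho th y).
Local Notation U := (green_potential th n1 n2).
Local Notation D0 := (`]0%R, +oo[%classic : set R).

Let n12 : n2 < n1. Proof. exact: lt_trans (lt_trans n20 ltr01) n11. Qed.
Let zR0 : 0 < zR. Proof. by case/andP: hzR. Qed.
Let zRbar : zR < zbar. Proof. by case/andP: hzR. Qed.

Let W (z : R) : R := \int[mu]_(nu in `]zR, +oo[) (H nu * G z nu).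

Let g : R -> R := H \_ (`[zR, +oo[ : set R).
(** On the positive half-line h = g - q, and q >= 0 because h <= 0 below zbar. *)
Let q : R -> R := (fun x => - H x) \_ (`]0, zR[ : set R).

Let mH := measurable_h eps huB huA.

Let mg : measurable_fun [set: R] g.
Proof.
apply: measurable_fun_restrict => //; apply: measurable_funS mH => //.
by apply: subset_itvr; rewrite bnd_simp.
Qed.

Let mq : measurable_fun [set: R] q.
Proof.
apply: measurable_fun_restrict => //.
have mHs : measurable_fun (`]0, zR[%classic : set R) H.
  by apply: measurable_funS mH => //; apply: subset_itvl.
exact: measurableT_comp.
Qed.

Let gE x : zR <= x -> g x = H x.
Proof. by move=> zx; rewrite /g patchE mem_set//= in_itv/= zx. Qed.

Let g0 x : x < zR -> g x = 0.
Proof. by move=> xz; rewrite /g patchE memNset//= in_itv/= leNgt xz. Qed.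

Let qE x : 0 < x -> x < zR -> q x = - H x.
Proof. by move=> x0 xz; rewrite /q patchE mem_set//= in_itv/= x0. Qed.

Let q0 x : ~~ (0 < x < zR) -> q x = 0.
Proof. by move=> xz; rewrite /q patchE memNset//= in_itv/=; exact/negP. Qed.

Let HD0E : H \_ D0 = (fun x => g x - q x).
Proof.
apply/funext => x; rewrite patchE; case: ifPn => [|]; rewrite ?inE ?notin_setE/= in_itv/= andbT.
  move=> x0; have [zx|xz] := leP zR x.
    by rewrite gE// q0 ?subr0// x0/= -leNgt.
  by rewrite g0// qE// sub0r opprK.
move=> /negP; rewrite -leNgt => x0; rewrite g0 ?q0 ?subr0//.
  by rewrite ltNge x0.
exact: le_lt_trans zR0.
Qed.

Let q_ge0 x : 0 <= q x.
Proof.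
have [/andP[x0 xz]|xz] := boolP (0 < x < zR); last by rewrite q0.
by rewrite qE// oppr_ge0 (h_le0 huB huA huBA hzbar0)// ltW// (lt_trans xz).
Qed.

Let integrable_HG z : 0 < z -> mu.-integrable D0 (fun nu => (H nu * G z nu)%:E).
Proof. by move=> z0; exact: (@integrable_h_green R uB uA dB dA th n1 n2 eps huB huA n20 n11 z z0). Qed.

Let integrable_gG z : 0 < z -> mu.-integrable D0 (fun nu => (g nu * G z nu)%:E).
Proof.
move=> z0; apply: le_integrable (integrable_HG z0) => //.
  apply/measurable_EFinP; apply: measurable_funM; first exact: measurable_funTS.
  by apply: measurable_funTS; exact: measurable_green.
move=> nu; rewrite /= => _; rewrite lee_fin (normrM (g nu)) (normrM (H nu)) ler_wpM2r//.
by have [zx|xz] := leP zR nu; [rewrite gE|rewrite g0 ?normr0].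
Qed.

Let integrable_qG z : 0 < z -> mu.-integrable D0 (fun nu => (q nu * G z nu)%:E).
Proof.
move=> z0; apply: le_integrable (integrable_HG z0) => //.
  apply/measurable_EFinP; apply: measurable_funM; first exact: measurable_funTS.
  by apply: measurable_funTS; exact: measurable_green.
move=> nu; rewrite /= => _; rewrite lee_fin (normrM (q nu)) (normrM (H nu)) ler_wpM2r//.
have [/andP[x0 xz]|xz] := boolP (0 < nu < zR); last by rewrite q0 ?normr0.
by rewrite qE// normrN.
Qed.

Let Zg : M.-integrable setT (EFin \o Z g).
Proof. exact: (integrable_discounted hB th0 n12 n1D2 n1M2 y0 mg (integrable_gG y0)). Qed.

Let Zq : M.-integrable setT (EFin \o Z q).
Proof. exact: (integrable_discounted hB th0 n12 n1D2 n1M2 y0 mq (integrable_qG y0)). Qed.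

Let UgE z : 0 < z -> U g z = (W z)%:E.
Proof.
move=> z0; rewrite /W /Rintegral fineK; last first.
  apply: integrable_fin_num => //; apply: integrableS (integrable_HG z0) => //.
  by apply: subset_itvr; rewrite bnd_simp ltW.
have mHG : measurable_fun (`[zR, +oo[%classic : set R) (fun nu => (H nu * G z nu)%:E).
  have [m _] := integrableP _ _ _ (integrable_HG z0).
  by apply: measurable_funS m => //; apply: subset_itvr; rewrite bnd_simp.
rewrite integral_itv_obnd_cbnd; last first.
  by apply: measurable_funS mHG => //; apply: subset_itvr; rewrite bnd_simp.
rewrite /green_potential integral_mkcond [RHS]integral_mkcond; apply: eq_integral => nu _.
rewrite !patchE; case: ifPn => [_|nu0].
  have [znu|nuz] := leP zR nu; first by rewrite gE// mem_set//= in_itv/= znu.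
  by rewrite g0// mul0r memNset//= in_itv/= leNgt nuz.
rewrite memNset//= in_itv/= andbT => znu; move: nu0; rewrite notin_setE/= in_itv/= andbT.
by apply; exact: lt_le_trans znu.
Qed.

Let stopping_payoffE (tau : T -> \bar R) (S : set TR) : measurable S ->
  (forall w t, 0 < t -> S (w, t) <-> (t%:E <= tau w)%E) ->
  (forall w, (0 <= tau w)%E) ->
  stopping_payoff P B r rho th eps uB uA y tau = (\int[M]_(x in S) (Z (fun z => g z - q z) x)%:E)%E.
Proof.
move=> mS SE tau0; rewrite -HD0E.
have mHD : measurable_fun [set: R] (H \_ D0) by exact: measurable_fun_restrict.
rewrite -(integral_integral_discounted hB th0 n12 n1D2 n1M2 y0
  (D := fun w => [set t : R | (0 <= t%:E <= tau w)%E]) mHD (integrable_HG y0) mS).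
- apply: eq_integral => w _; apply: eq_integral => t _ /=.
  by rewrite hE ?dual_process_gt0// [eps * _]mulrC.
- move=> w t t0 /=; rewrite lee_fin le_eqVlt eq_sym (negbTE t0)/=; split.
    by move=> /andP[t_gt0 tt]; split => //; apply/SE.
  by move=> [t_gt0 /SE -/(_ t_gt0) ->]; rewrite t_gt0.
Qed.

Let payoff_le (tau : T -> \bar R) : is_stopping_time aug tau ->
  (stopping_payoff P B r rho th eps uB uA y tau <= (W y)%:E)%E.
Proof.
move=> [tau0 sT]; pose E s := [set w | (tau w <= s%:E)%E].
pose S : set TR := ~` \bigcup_n dyadic_strip E n.
have mS : measurable S.
  by apply: measurableC; apply: bigcupT_measurable => n; exact: (measurable_dyadic_strip hB sT).
rewrite (stopping_payoffE mS)//; last first.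
  move=> w t t0; rewrite leNgt; split; first by move=> nS; apply/negP => /(bigcup_dyadic_strip _ tau0 t0).
  by move=> /negP nt /(bigcup_dyadic_strip _ tau0 t0).
rewrite -UgE//.
apply: (integral_discounted_stopped_le hB th0 n12 n1D2 n1M2 y0 sT) => //.
- exact: measurable_funB.
- rewrite -HD0E.
  apply: (integrable_discounted hB th0 n12 n1D2 n1M2 y0); first exact: measurable_fun_restrict.
  apply: eq_integrable (integrable_HG y0) => //= nu nu0.
  by rewrite patchE nu0.
- by move=> x; rewrite gerBl.
- by move=> z z0; rewrite UgE// lee_fin (continuation_value_ge0 huB huA huBA hzbar hzbar0).
Qed.

Let E (s : R) : set T := [set w | Y s w <= zR].

Let sE s : 0 <= s -> aug s (E s).
Proof.
move=> s0; rewrite (_ : E s = B s @^-1` ((fun x => y * expR (a * s - th * x)) @^-1` `]-oo, zR])).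
  apply: augmented_filtration_preimage => //.
  rewrite -[X in measurable X]setTI.
  have mY : measurable_fun [set: R] (fun x => y * expR (a * s - th * x)).
    apply: measurable_funM => //; apply: measurableT_comp => //.
    by apply: measurable_funB => //; exact: measurable_funM.
  by apply: mY => //; exact: measurable_itv.
by apply/seteqP; split => w; rewrite /E/= in_itv/= dual_processE.
Qed.

(** If Y_t < zR, continuity keeps the path below zR on a left neighbourhood of t, which contains a
    dyadic time before t. *)
Let qE_strip t w : 0 < t -> q (Y t w) != 0 -> exists n, dyadic_strip E n (w, t).
Proof.
move=> t0 qY.
have Yz : Y t w < zR.
  by rewrite ltNge; apply: contra qY => zY; rewrite q0// dual_process_gt0//= -leNgt.
pose F := within (`[0, +oo[%classic : set R) (nbhs t).
have tD : (`[0, +oo[%classic : set R) t by rewrite /= in_itv/= andbT ltW.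
have PF : ProperFilter F by rewrite /F nbhs_subspace_in//; exact: nbhs_subspace_filter.
have cB : B s w @[s --> F] --> B t w.
  have := @bm_continuous _ _ _ _ _ hB w.
  rewrite continuous_subspace_in => /(_ t (mem_set tD)).
  by rewrite /F nbhs_subspace_in.
have cid : s @[s --> F] --> t by exact: cvg_within.
have cY : Y s w @[s --> F] --> Y t w.
  have -> : (fun s => Y s w) = (fun s => y * expR (a * s - th * B s w)).
    by apply/funext => s; exact: dual_processE.
  rewrite dual_processE; apply: cvgMr.
  apply: (continuous_cvg _ (@continuous_expR R _)).
  by apply: cvgB; apply: cvgMr.
have : \forall s \near F, Y s w < zR by exact: (cvgr_lt (Y t w)).
rewrite /F /within/= => -[e /= e0 He].
(* The maximum with 0 keeps the search within nonnegative times, and e / 2 leaves room for the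
   strict inequality of the ball. *)
have te : Num.max (t - e / 2) 0 < t by rewrite gt_max t0 andbT gtrBl divr_gt0.
have [|n [k /andP[ks kt]]] := dyadic_between _ te; first by rewrite le_max lexx orbT.
move: ks; rewrite ge_max => /andP[ks k0].
exists n, k => //; split; rewrite /= ?in_itv/= ?kt//.
apply/ltW/He; last by rewrite /= in_itv/= k0.
by rewrite /= ger0_norm ?subr_ge0 ?(ltW kt)//; move: e0 ks kt; lra.
Qed.

Let payoff_ge : ((W y)%:E <= ereal_sup [set stopping_payoff P B r rho th eps uB uA y tau |
  tau in [set tau | is_stopping_time aug tau]])%E.
Proof.
have UE t w : 0 <= t -> E t w -> U g (Y t w) = 0%E.
  move=> t0 Etw; rewrite UgE ?dual_process_gt0//.
  by rewrite /W (@continuation_value_eq0 R uB uA dB dA th n1 n2 eps huB huA zbar zR n11 hzR hzR0)// dual_process_gt0.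
rewrite -UgE//.
apply: (cvge_le _ (integral_discounted_cvg hB th0 n12 n1D2 n1M2 y0 sE mg Zg mq Zq UE qE_strip)).
apply: nearW => n; apply: ereal_sup_ubound.
have sn := first_dyadic_stopping sE n.
exists (first_dyadic E n) => //; apply: stopping_payoffE.
- by apply: measurableC; exact: (measurable_dyadic_strip hB sE).
- by move=> w t; exact: dyadic_stripC.
- by case: sn.
Qed.

Lemma J_AE : J_A P B r rho th uA y = (Xi th n1 n2 (conjugate uA) y)%:E.
Proof.
have mA : measurable_fun [set: R] (conjugate uA \_ D0).
  by apply: measurable_fun_restrict => //; exact: (measurable_conjugate huA).
have iA := integrable_green th y0 (measurable_conjugate huA)
  (integrable_conjugate_0o huA n20 y0) (integrable_conjugate_yo huA n11 y0).
rewrite /J_A (integral_integral_discounted hB th0 n12 n1D2 n1M2 y0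
  (D := fun=> `[0, +oo[%classic) (S := setT) mA iA measurableT); last first.
  move=> w t t0; rewrite /= in_itv/= andbT le_eqVlt eq_sym (negbTE t0)/=.
  by split => [->|[]].
rewrite (integral_discounted hB th0 n12 n1D2 n1M2 y0 mA).
rewrite (Xi_green th y0 (measurable_conjugate huA)
  (integrable_conjugate_0o huA n20 y0) (integrable_conjugate_yo huA n11 y0)).
rewrite /Rintegral fineK; last exact: (integrable_fin_num _ iA).
by apply: eq_integral => nu nu0; rewrite patchE nu0.
Qed.

Lemma dual_valueE : dual_value P B r rho th eps uB uA y =
  (Xi th n1 n2 (conjugate uA) y + W y)%:E.
Proof.
rewrite /dual_value J_AE EFinD; congr (_ + _)%E; apply/eqP; rewrite eq_le payoff_ge andbT.
by apply: ge_ereal_sup => _ [tau sT <-]; exact: payoff_le.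
Qed.

End dual_value.

(** Subtracting the two equations leaves the factor n1 - n2, which is cancelled. *)
Lemma char_poly_n_sum (R : realType) (r rho th n1 n2 : R) : th != 0 -> n1 != n2 ->
  char_poly_n r rho th n1 = 0 -> char_poly_n r rho th n2 = 0 ->
  n1 + n2 = - (2 * (rho - r - th ^+ 2 / 2) / th ^+ 2).
Proof.
move=> th0 n12 e1 e2.
have : (n1 - n2) * (th ^+ 2 / 2 * (n1 + n2) + (rho - r - th ^+ 2 / 2)) = 0.
  rewrite -[RHS](subrr 0) -{1}e1 -e2 /char_poly_n; ring.
move/eqP; rewrite mulf_eq0 subr_eq0 (negbTE n12)/= => /eqP e.
have -> : n1 + n2 = 2 / th ^+ 2 * (th ^+ 2 / 2 * (n1 + n2) + (rho - r - th ^+ 2 / 2))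
   - 2 * (rho - r - th ^+ 2 / 2) / th ^+ 2 by field.
by rewrite e mulr0 sub0r.
Qed.

Theorem corollary3p1 (R : realType) (d : measure_display)
  (T : measurableType d) (P : probability T R) (B : R -> T -> R)
  (r rho mu sigma eps n1 n2 : R) (dB dA : set R) (uB uA : R -> R)
  (lPsi : \bar R) (zbar zR : R)
  (hB : is_standard_brownian_motion P B)
  (hr : 0 < r) (hrho : 0 < rho) (hmu : 0 < mu) (hsigma : 0 < sigma)
  (heps : 0 < eps) (hmur : mu != r)
  (hn1 : 0 < n1) (hn1root : char_poly_n r rho (theta mu r sigma) n1 = 0)
  (hn2 : n2 < 0) (hn2root : char_poly_n r rho (theta mu r sigma) n2 = 0)
  (huB : class_Sigma n2 dB uB) (huA : class_Sigma n2 dA uA)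
  (huBA : forall y : R, 0 < y ->
     (util_val uB (inv_marginal uB y) < util_val uA (inv_marginal uA y))%E)
  (hPsi : (Psi uB uA eps y)%:E @[y --> 0^'+] --> lPsi)
  (hPsi0 : (lPsi < 0)%E)
  (hzbar : 0 < zbar) (hzbar0 : Psi uB uA eps zbar = 0)
  (hzR : 0 < zR < zbar)
  (hzR0 : (\int[lebesgue_measure]_(nu in `]zR, +oo[)
             (nu `^ (- n1 - 1) * h uB uA eps nu)%:E = 0)%E) :
  forall y : R, 0 < y ->
    (zR <= y ->
       dual_value P B r rho (theta mu r sigma) eps uB uA y =
       (coef_D (theta mu r sigma) n1 n2 uB uA eps zR * y `^ n2 +
        Xi (theta mu r sigma) n1 n2 (conjugate uB) y + eps / r * y)%:E) /\
    (y <= zR ->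
       dual_value P B r rho (theta mu r sigma) eps uB uA y =
       (Xi (theta mu r sigma) n1 n2 (conjugate uA) y)%:E).
Proof.
move=> y y0.
have th0 : theta mu r sigma != 0.
  by rewrite /theta mulf_neq0 ?subr_eq0// invr_eq0 gt_eqF.
move: (theta mu r sigma) th0 hn1root hn2root => th th0 e1 e2.
have n12 : n1 != n2 by rewrite gt_eqF// (lt_trans hn2).
have n1D2 := char_poly_n_sum th0 n12 e1 e2.
have thp : 0 < th ^+ 2 by rewrite exprn_even_gt0.
have n1M2 : n1 * n2 = - (2 * rho / th ^+ 2).
  have -> : n2 = - (2 * (rho - r - th ^+ 2 / 2) / th ^+ 2) - n1 by rewrite -n1D2; ring.
  transitivity (- (2 / th ^+ 2) * (char_poly_n r rho th n1) - 2 * rho / th ^+ 2).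
    by rewrite /char_poly_n; field.
  by rewrite e1 mulr0 sub0r.
have n1r : (1 - n1) * (1 - n2) = - (2 * r / th ^+ 2).
  have -> : (1 - n1) * (1 - n2) = 1 - (n1 + n2) + n1 * n2 by ring.
  by rewrite n1D2 n1M2; field.
(* As (n1 - 1)(1 - n2) = 2 r / th^2 is positive and n2 < 0, the point 1 lies strictly between the
   roots. *)
have n11 : 1 < n1.
  have : 0 < (n1 - 1) * (1 - n2).
    have -> : (n1 - 1) * (1 - n2) = 2 * r / th ^+ 2 by rewrite -opprB mulNr n1r opprK.
    by rewrite divr_gt0// mulr_gt0.
  by rewrite pmulr_lgt0 ?subr_gt0// (lt_trans hn2).
rewrite (dual_valueE hB th0 hn2 n11 n1D2 n1M2 y0 huB huA huBA hzbar hzbar0 hzR hzR0).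
split => yz; congr EFin.
  rewrite (@continuation_valueE R uB uA dB dA th n1 n2 eps huB huA zbar zR hn2 n11 hzR y yz).
  rewrite (Xi_hE eps huB huA th0 hn2 n11 hr y0 n1r); ring.
by rewrite (@continuation_value_eq0 R uB uA dB dA th n1 n2 eps huB huA zbar zR n11 hzR hzR0)// addr0.
Qed.
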